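(* Let $N\ge 2$ be an integer, $\lambda=2/N$, and let $T=\lambda M+\tau_0$ with an integer $M>1$ and $0<\tau_0<\lambda$. Then for any functions $v_0,r_0,v_1,r_1\in H^1(I_L)$ the set of solutions $v,r\in H^1(\Omega)$ (with some control $\boldsymbol{u}$) of the boundary value problem (BVP) described in the context is nonempty. Moreover, the solutions are expressed algebraically in terms of traveling waves $w^{\pm}_{k,m}$ and control maps $u_{n,m}$: for every solution $(v,r,\boldsymbol{u})$ and every $k\in J_s$ there are continuous functions $w_k^{\pm}:I_k^{\pm}\to\mathbb{R}$ such that $$v(t,x)=w_k^{+}(t+x)+w_k^{-}(t-x),\qquad r(t,x)=w_k^{+}(t+x)-w_k^{-}(t-x)+u_k(t),\qquad (t,x)\in I_T\times I^x_k ,$$ so that $v$ and $r$ are given on $I_T\times I^x_k$ by the pieces $w^{\pm}_{k,m}$ of $w^\pm_k$ and the pieces $u_{n,m}$ of the control functions $u_n$, $n\in J_x$ (the functions $u_k$, $k\in J_c$, being the linear combinations of $u_n$, $n\in J_x$, specified in the context).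
   Context: Setting: dimensionless longitudinal motion of a uniform elastic rod of length $2$ with $N$ control elements of equal length $\lambda=2/N$. Notation: $I_L=(-1,1)$, $I_T=(0,T)$, $\Omega=I_T\times I_L$. Index sets: $J_s=\{1-N,3-N,\dots,N-1\}$, $J_x=\{-N,2-N,\dots,N\}$, $J_c=J_s\cup\{-N-1,N+1\}$. Points and intervals: $x_n=n\lambda/2$ for $n\in J_x$ (so $x_{\pm N}=\pm1$), $I^x_k=(x_{k-1},x_{k+1})$ for $k\in J_s$. Controls: a control is $\boldsymbol{u}=(u_n)_{n\in J_x}\in H^1(I_T;\mathbb{R}^{N+1})$ with $\boldsymbol{u}(0)=0$. It determines uniquely functions $u_k\in H^1(I_T)$, $k\in J_c$, with $u_k(0)=0$, by the linear relations $u_n=u_{n+1}-u_{n-1}$ for $n\in J_x$ and $\sum_{k\in J_c}u_k=0$. (The indices in $J_x$ and $J_c$ have different parity, so the notation is unambiguous.) The force function $f\in L^2(\Omega)$ is $f(t,x)=u_k'(t)$ for $x\in I^x_k$, $k\in J_s$. The BVP: given $v_0,r_0,v_1,r_1\in H^1(I_L)$ and $T$, find $v,r\in H^1(\Omega)$ and a control $\boldsymbol{u}=(u_n)_{n\in J_x}\in H^1(I_T;\mathbb{R}^{N+1})$ with $\boldsymbol{u}(0)=0$ (which determines the functions $u_k$, $k\in J_c$, and the force $f$ by the stated relations) such that (1) $Q[v,r,\boldsymbol{u}]=0$, where $Q=\int_\Omega q\,\mathrm{d}\Omega$ and $q=\frac14(v_t-r_x)^2+\frac14\big(v_x-(r_t-f)\big)^2$;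 (2) $v(0,x)=v_0(x)$, $r(0,x)=r_0(x)$, $v(T,x)=v_1(x)$, $r(T,x)=r_1(x)$ for $x\in \bar I_L$; (3) $v(t,\cdot)$ and $r(t,\cdot)$ have no jump at the interior points $x_n$, $n\in J_x\setminus\{-N,N\}$; (4) $r(t,\pm1)=r_0(\pm1)+u_{\pm N\pm1}(t)$ for $t\in I_T$ (signs correlated). Initial, terminal and boundary values are understood in the sense of traces. Pieces: put $\tau_1=\lambda-\tau_0$, $z^+_k=\frac{k-1}{2}\lambda$, $z^-_k=-\frac{k+1}{2}\lambda$, $I^\pm_k=(z^\pm_k,\,z^\pm_k+\lambda+T)$. For $m=2j+i\in\{0,1,\dots,2M+2\}$ with $i\in\{0,1\}$, put $z^\pm_{k,m}=z^\pm_k+j\lambda+i\tau_0$ and $w^\pm_{k,m}(z)=w^\pm_k(z+z^\pm_{k,m})$, $z\in(0,\tau_i)$. For $m=2j+i\in\{0,1,\dots,2M\}$ with $i\in\{0,1\}$, put $t_m=j\lambda+i\tau_0$ and $u_{n,m}(z)=u_n(z+t_m)$, $z\in(0,\tau_i)$. *)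

(* Defs.v *)
From mathcomp Require Import all_boot all_order all_algebra.
From mathcomp Require Import all_classical all_reals all_analysis.

Set Implicit Arguments.
Unset Strict Implicit.
Unset Printing Implicit Defensive.

Import Order.TTheory GRing.Theory Num.Theory.
Import numFieldNormedType.Exports.

Local Open Scope classical_set_scope.
Local Open Scope ring_scope.

(** Sobolev spaces.  As in Brezis' textbook, weak derivatives are tested
    against C^1 functions with compact support in the open set; by
    mollification, C^oo test functions give the same derivatives. *)

Notation mu1 R := (@lebesgue_measure R).

(* Lebesgue measure on the plane; a point is a pair (t, x). *)
Notation mu2 R := (@lebesgue_measure R \x @lebesgue_measure R)%E.

Definition L2 d (X : measurableType d) (R : realType)
    (mu : {measure set X -> \bar R}) (D : set X) (f : X -> R) : Prop :=
  f \_ D \in Lfun mu 2%:E.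

Definition test_fun1 (R : realType) (D : set R) (phi : R -> R) : Prop :=
  [/\ forall x, derivable phi x 1,
      continuous (derive1 phi),
      compact (closure [set x | phi x != 0]) &
      closure [set x | phi x != 0] `<=` D].

Definition dt (R : realType) (phi : R * R -> R) (p : R * R) : R :=
  'D_(1, 0) phi p.
Definition dx (R : realType) (phi : R * R -> R) (p : R * R) : R :=
  'D_(0, 1) phi p.

Definition test_fun2 (R : realType) (D : set (R * R)) (phi : R * R -> R) :
    Prop :=
  [/\ forall p, differentiable phi p,
      continuous (dt phi), continuous (dx phi),
      compact (closure [set p | phi p != 0]) &
      closure [set p | phi p != 0] `<=` D].

Definition weak_deriv (R : realType) (D : set R) (u du : R -> R) : Prop :=
  [/\ L2 (mu1 R) D u, L2 (mu1 R) D du &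
      forall phi, test_fun1 D phi ->
        (\int[mu1 R]_(x in D) (u x * derive1 phi x)) =
        - (\int[mu1 R]_(x in D) (du x * phi x))].

(* An element of H^1(a, b) is represented by its continuous representative on
   [a, b]; in particular its endpoint values are its traces. *)
Definition H1_interval (R : realType) (a b : R) (u : R -> R) : Prop :=
  {within `[a, b], continuous u} /\ exists du, weak_deriv `]a, b[ u du.

(* An element of H^1(D), D open in the plane, is represented by any function
   in its class; all relations between such elements are almost everywhere. *)
Definition weak_grad (R : realType) (D : set (R * R))
    (v vt vx : R * R -> R) : Prop :=
  [/\ L2 (mu2 R) D v, L2 (mu2 R) D vt, L2 (mu2 R) D vx &
      forall phi, test_fun2 D phi ->
        (\int[mu2 R]_(p in D) (v p * dt phi p)) =
          - (\int[mu2 R]_(p in D) (vt p * phi p)) /\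
        (\int[mu2 R]_(p in D) (v p * dx phi p)) =
          - (\int[mu2 R]_(p in D) (vx p * phi p))].

Definition H1 (R : realType) (D : set (R * R)) (v : R * R -> R) : Prop :=
  exists vt vx, weak_grad D v vt vx.

Definition H1_cvg (R : realType) (D : set (R * R))
    (vs : nat -> R * R -> R) (v : R * R -> R) : Prop :=
  exists (vst vsx : nat -> R * R -> R) (vt vx : R * R -> R),
    [/\ forall i, weak_grad D (vs i) (vst i) (vsx i),
        weak_grad D v vt vx &
        (fun i => (\int[mu2 R]_(p in D)
           ((vs i p - v p) ^+ 2 + (vst i p - vt p) ^+ 2
            + (vsx i p - vx p) ^+ 2)%:E)%E) @ \oo --> 0%E].

(* The trace operator of a rectangle D is the continuous extension to H^1(D)
   of the restriction of functions in H^1(D) that are continuous on the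
   closure of D.  Here a side of D is parametrized by gam over J, and g is the
   trace of v on it. *)
Definition has_trace (R : realType) (D : set (R * R)) (v : R * R -> R)
    (J : set R) (gam : R -> R * R) (g : R -> R) : Prop :=
  L2 (mu1 R) J g /\
  exists vs : nat -> R * R -> R,
    [/\ forall i, {within closure D, continuous (vs i)},
        H1_cvg D vs v &
        (fun i => (\int[mu1 R]_(s in J) ((vs i (gam s) - g s) ^+ 2)%:E)%E)
          @ \oo --> 0%E].

(** The rod.  Indices in J_s, J_x, J_c are integers; since J_x and J_c have
    opposite parity, a single family u : int -> R -> R carries both the
    controls u_n, n in J_x, and the functions u_k, k in J_c. *)

Definition lam (R : realType) (N : nat) : R := 2 / N%:R.

Definition Js (N : nat) : seq int :=
  [seq 1 - N%:Z + (i.*2)%:Z | i <- iota 0 N].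
Definition Jx (N : nat) : seq int :=
  [seq - N%:Z + (i.*2)%:Z | i <- iota 0 N.+1].
Definition Jc (N : nat) : seq int := [:: - N%:Z - 1, N%:Z + 1 & Js N].

Definition node (R : realType) (N : nat) (n : int) : R :=
  n%:~R * lam R N / 2.

Definition I_L (R : realType) : set R := `](-1), 1[.
Arguments I_L R : clear implicits.
Definition I_T (R : realType) (T : R) : set R := `]0, T[.
Definition I_x (R : realType) (N : nat) (k : int) : set R :=
  `]node R N (k - 1), node R N (k + 1)[.
Arguments I_x R N k : clear implicits.
Definition Omega (R : realType) (T : R) : set (R * R) := I_T T `*` I_L R.
Definition cell (R : realType) (N : nat) (T : R) (k : int) : set (R * R) :=
  I_T T `*` I_x R N k.

Definition is_control (R : realType) (N : nat) (T : R) (u : int -> R -> R) :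
    Prop :=
  [/\ forall n, n \in Jx N -> H1_interval 0 T (u n) /\ u n 0 = 0,
      forall k, k \in Jc N -> H1_interval 0 T (u k) /\ u k 0 = 0,
      forall n, n \in Jx N -> forall t, t \in `[0, T] ->
        u n t = u (n + 1) t - u (n - 1) t &
      forall t, t \in `[0, T] -> \sum_(k <- Jc N) u k t = 0].

Definition force (R : realType) (N : nat) (du : int -> R -> R) (p : R * R) :
    R :=
  \sum_(k <- Js N) du k p.1 * \1_(I_x R N k) p.2.

Definition q_density (R : realType) (vt vx rt rx f : R * R -> R)
    (p : R * R) : R :=
  4^-1 * (vt p - rx p) ^+ 2 + 4^-1 * (vx p - (rt p - f p)) ^+ 2.

(* The weak derivatives are unique almost everywhere, so that Q does not
   depend on their choice. *)
Definition Q_zero (R : realType) (N : nat) (T : R) (v r : R * R -> R)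
    (u : int -> R -> R) : Prop :=
  exists (vt vx rt rx : R * R -> R) (du : int -> R -> R),
    [/\ weak_grad (Omega T) v vt vx,
        weak_grad (Omega T) r rt rx,
        forall k, k \in Js N -> weak_deriv (I_T T) (u k) (du k) &
        (\int[mu2 R]_(p in Omega T)
           (q_density vt vx rt rx (force N du) p)%:E)%E = 0%E].

(* Equality of the traces from the two cells adjacent to x_n. *)
Definition no_jump (R : realType) (N : nat) (T : R) (v : R * R -> R)
    (n : int) : Prop :=
  exists g : R -> R,
    has_trace (cell N T (n - 1)) v (I_T T) (fun t => (t, node R N n)) g /\
    has_trace (cell N T (n + 1)) v (I_T T) (fun t => (t, node R N n)) g.

Record bvp_solution (R : realType) (N : nat) (T : R) (v0 r0 v1 r1 : R -> R)
    (v r : R * R -> R) (u : int -> R -> R) : Prop := BvpSolution {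
  sol_v : H1 (Omega T) v;
  sol_r : H1 (Omega T) r;
  sol_control : is_control N T u;
  sol_Q : Q_zero N T v r u;
  sol_v_init : has_trace (Omega T) v (I_L R) (fun x => (0, x)) v0;
  sol_r_init : has_trace (Omega T) r (I_L R) (fun x => (0, x)) r0;
  sol_v_term : has_trace (Omega T) v (I_L R) (fun x => (T, x)) v1;
  sol_r_term : has_trace (Omega T) r (I_L R) (fun x => (T, x)) r1;
  sol_no_jump : forall n, n \in Jx N -> n != - N%:Z -> n != N%:Z ->
    no_jump N T v n /\ no_jump N T r n;
  sol_left : has_trace (Omega T) r (I_T T) (fun t => (t, -1))
    (fun t => r0 (-1) + u (- N%:Z - 1) t);
  sol_right : has_trace (Omega T) r (I_T T) (fun t => (t, 1))
    (fun t => r0 1 + u (N%:Z + 1) t) }.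

(** Pieces are numbered by m = 2j + i with j = m./2 and i = odd m. *)

Definition z_plus (R : realType) (N : nat) (k : int) : R :=
  (k - 1)%:~R / 2 * lam R N.
Definition z_minus (R : realType) (N : nat) (k : int) : R :=
  - ((k + 1)%:~R / 2 * lam R N).

Definition I_plus (R : realType) (N : nat) (T : R) (k : int) : set R :=
  `]z_plus R N k, z_plus R N k + lam R N + T[.
Definition I_minus (R : realType) (N : nat) (T : R) (k : int) : set R :=
  `]z_minus R N k, z_minus R N k + lam R N + T[.

Definition tau (R : realType) (N : nat) (tau0 : R) (m : nat) : R :=
  if odd m then lam R N - tau0 else tau0.
Definition t_ (R : realType) (N : nat) (tau0 : R) (m : nat) : R :=
  m./2%:R * lam R N + (odd m)%:R * tau0.

Definition w_plus_piece (R : realType) (N : nat) (tau0 : R) (k : int)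
    (m : nat) (w : R -> R) (z : R) : R :=
  w (z + (z_plus R N k + t_ N tau0 m)).
Definition w_minus_piece (R : realType) (N : nat) (tau0 : R) (k : int)
    (m : nat) (w : R -> R) (z : R) : R :=
  w (z + (z_minus R N k + t_ N tau0 m)).
Definition u_piece (R : realType) (N : nat) (tau0 : R) (m : nat) (un : R -> R)
    (z : R) : R :=
  un (z + t_ N tau0 m).

(* Solving u_n = u_(n+1) - u_(n-1), n in J_x, and sum_(k in J_c) u_k = 0 gives
   u_k = sum_(n in J_x) ctrl_coef N k n * u_n for k in J_c: the term [n < k]
   comes from telescoping from u_(-N-1), and the other one from the zero-sum
   condition, (N + 2 - n)/2 being the number of indices of J_c above n. *)
Definition ctrl_coef (R : realType) (N : nat) (k n : int) : R :=
  (n < k)%R%:R - (N%:Z + 2 - n)%:~R / (2 * (N + 2)%:R).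

Definition dalembert (R : realType) (N : nat) (T : R) (k : int)
    (v r : R * R -> R) (uk wp wm : R -> R) : Prop :=
  {ae mu2 R, forall p, cell N T k p ->
    v p = wp (p.1 + p.2) + wm (p.1 - p.2) /\
    r p = wp (p.1 + p.2) - wm (p.1 - p.2) + uk p.1}.

(* The same formula through the pieces: zp, zm and zu are the local
   coordinates of t + x, t - x and t in the pieces that contain them. *)
Definition dalembert_pieces (R : realType) (N M : nat) (T tau0 : R) (k : int)
    (v r : R * R -> R) (u : int -> R -> R) (wp wm : R -> R) : Prop :=
  {ae mu2 R, forall p, cell N T k p ->
    exists (mp mm ml : nat) (zp zm zu : R),
      [/\ [/\ (mp <= 2 * M + 2)%N, zp \in `]0, tau N tau0 mp[ &
              p.1 + p.2 = zp + (z_plus R N k + t_ N tau0 mp)],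
          [/\ (mm <= 2 * M + 2)%N, zm \in `]0, tau N tau0 mm[ &
              p.1 - p.2 = zm + (z_minus R N k + t_ N tau0 mm)],
          [/\ (ml <= 2 * M)%N, zu \in `]0, tau N tau0 ml[ &
              p.1 = zu + t_ N tau0 ml],
          v p = w_plus_piece N tau0 k mp wp zp
                + w_minus_piece N tau0 k mm wm zm &
          r p = w_plus_piece N tau0 k mp wp zp
                - w_minus_piece N tau0 k mm wm zm
                + \sum_(n <- Jx N)
                    ctrl_coef R N k n * u_piece N tau0 ml (u n) zu]}.

(* Main.v *)
Require Import Defs.
From mathcomp Require Import all_boot all_order all_algebra.
From mathcomp Require Import all_classical all_reals all_analysis.
From mathcomp Require Import measurable_realfun.
From mathcomp Require Import ring lra zify.

Set Implicit Arguments.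
Unset Strict Implicit.
Unset Printing Implicit Defensive.

Import Order.TTheory GRing.Theory Num.Theory.
Import numFieldNormedType.Exports.

Local Open Scope classical_set_scope.
Local Open Scope ring_scope.

(* The first-order system v_t = r_x, v_x = r_t - f decouples: on I_T x I_x k the
   functions h = v +- (r - u_k) satisfy h_t = +-h_x weakly, so after the
   measure-preserving shear (t, x) |-> (t, t +- x) they do not depend on t; the
   functions of one variable found on small boxes are absolutely continuous, and
   patching them over rational boxes gives the waves w_k^+-.

   Conversely v and r are glued from waves chosen segment by segment, from left
   to right.  Initial and terminal data prescribe both waves of a segment on
   windows of length lambda at both ends of their domain; as T > 2 lambda, the
   wave in t + x is still free somewhere in between and can be chosen so that
   the wave in t - x produces a given velocity at the left end of the segment.
   The velocity at the right end is passed on to the next segment.  The force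
   controls only have to compensate the jumps of the resulting r, so the u_k
   are the primitives, with zero sum, of these jumps. *)

(** * Measure-preserving changes of variables *)

(** Why boxes: a sheared cell is a parallelogram, not a product, so the variables can be separated
    only on boxes inside it. Two boxes over the same value of [t + s * x] may have disjoint time
    ranges; they are compared through a third box whose time range spans both. Each test function
    and each box brings its own null set, so both are drawn from countable families with rational
    endpoints.

    Why a constant [kap]: the terminal datum prescribes [w+ - w- + u_k], so [u_k T] must be known
    before the waves are chosen. The boundary conditions force the two outer controls to end at
    [r1 (-1) - r0 (-1)] and [r1 1 - r0 1]. The N inner ones are given a common terminal value [kap],
    which the zero-sum condition then determines, and the waves are built for the datum [r1 - kap].
    With this choice the jumps of the glued waves at time T are the ones that the controls need.

    All waves are absolutely continuous on the whole line, so that shifts, reflections and clamps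
    require no bookkeeping of domains. *)

Section measure_preserving.
Context d (X : measurableType d) (R : realType) (mu : {measure set X -> \bar R}).
Variables (phi : X -> X) (mphi : measurable_fun setT phi).
Hypothesis muphi : forall A, measurable A -> mu (phi @^-1` A) = mu A.

Lemma ge0_integral_preserving (f : X -> \bar R) : measurable_fun setT f ->
  (forall x, 0 <= f x)%E -> (\int[mu]_x f (phi x) = \int[mu]_x f x)%E.
Proof.
move=> mf f0; rewrite -[LHS](@ge0_integral_pushforward _ _ _ _ _ phi mphi mu setT f)//.
by apply: eq_measure_integral => //= A mA _; rewrite /pushforward muphi.
Qed.

Lemma integrable_preserving (f : X -> R) :
  mu.-integrable setT (EFin \o f) ->
  mu.-integrable setT (EFin \o (f \o phi)).
Proof.
move=> /integrableP[mf fi].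
apply/integrableP; split; first exact: (measurableT_comp mf mphi).
rewrite (_ : (fun x => _) = (fun x => `|(f (phi x))%:E|%E))//.
rewrite (@ge0_integral_preserving (fun x => `|(f x)%:E|%E))//.
exact: measurableT_comp.
Qed.

Lemma Rintegral_preserving (f : X -> R) :
  mu.-integrable setT (EFin \o f) ->
  \int[mu]_x f (phi x) = \int[mu]_x f x.
Proof.
move=> fi; have fi' := integrable_preserving fi.
rewrite /Rintegral; congr fine.
rewrite -[LHS](@integral_pushforward _ _ _ _ _ phi mphi mu setT (EFin \o f))//.
  by apply: eq_measure_integral => //= A mA _; rewrite /pushforward muphi.
by case/integrableP: fi.
Qed.

Lemma ae_preserving (P : X -> Prop) :
  {ae mu, forall p, P p} -> {ae mu, forall p, P (phi p)}.
Proof.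
move=> [N [mN N0 PN]]; exists (phi @^-1` N); split.
- by rewrite -[X in measurable X]setTI; exact: mphi.
- by rewrite muphi.
- by move=> p /= /PN.
Qed.

End measure_preserving.

Section rigid_motions.
Context {R : realType}.
Local Notation mu := (@lebesgue_measure R).
Implicit Types (s c : R).

(** The condition [s * s = 1] encodes a sign throughout, so that both families of characteristics
    share one proof. *)
Lemma sqr1_cases s : s * s = 1 -> s = 1 \/ s = -1.
Proof.
rewrite -expr2 => /eqP; rewrite sqrf_eq1 => /orP[/eqP->|/eqP->];
  [by left|by right].
Qed.

Lemma ae_neq c : {ae mu, forall z, z <> c}.
Proof.
exists [set c]; split; [exact: measurable_set1|exact: lebesgue_measure_set1|].
by move=> z /=; apply: contra_notP => /= nz; exact: nz.
Qed.

Lemma measurable_affine s c : measurable_fun [set: R] (fun x : R => c + s * x).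
Proof. by apply: measurable_funD => //; exact: measurable_funM. Qed.

Lemma lebesgue_measure_affine s c (B : set R) : s * s = 1 -> measurable B ->
  mu ((fun x => c + s * x) @^-1` B) = mu B.
Proof.
move=> ss1 mB.
pose phi : measurableTypeR R -> measurableTypeR R := fun x => c + s * x.
have mphi : measurable_fun setT phi := measurable_affine s c.
suff : forall A, measurable A -> mu A = pushforward mu phi A by move=> /(_ _ mB).
apply: lebesgue_measure_unique => //= _ [[a b] _ <-] /=.
rewrite /pushforward; case: (sqr1_cases ss1) => se.
- have -> : phi @^-1` `]a, b] = `]a - c, b - c]%classic.
    apply/seteqP; split => x /=; rewrite /phi se mul1r !in_itv /=; lra.
  rewrite !lebesgue_measure_itv /= !lte_fin ltrD2r; case: ifP => // _.
  by rewrite -!EFinB; congr EFin; ring.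
- have -> : phi @^-1` `]a, b] = `[c - b, c - a[%classic.
    apply/seteqP; split => x /=; rewrite /phi se mulN1r !in_itv /=; lra.
  rewrite !lebesgue_measure_itv /= !lte_fin ltrD2l ltrN2; case: ifP => // _.
  by rewrite -!EFinB; congr EFin; ring.
Qed.

Lemma integrable_affine s c (f : R -> R) : s * s = 1 ->
  mu.-integrable setT (EFin \o f) ->
  mu.-integrable setT (EFin \o (fun x => f (c + s * x))).
Proof.
move=> ss1.
apply: (integrable_preserving (mu := mu) (measurable_affine s c)) => A mA.
exact: lebesgue_measure_affine.
Qed.

Lemma Rintegral_affine s c (f : R -> R) : s * s = 1 ->
  mu.-integrable setT (EFin \o f) ->
  \int[mu]_x f (c + s * x) = \int[mu]_x f x.
Proof.
move=> ss1.
apply: (Rintegral_preserving (mu := mu) (measurable_affine s c)) => A mA.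
exact: lebesgue_measure_affine.
Qed.

Definition shear s (p : R * R) : R * R := (p.1, p.1 + s * p.2).

Lemma measurable_shear s : measurable_fun setT (shear s).
Proof.
apply/measurable_fun_pairP; split; first exact: measurable_fst.
by apply: measurable_funD => //; exact: measurable_funM.
Qed.

(** Cavalieri's principle: on the section over a fixed [t] the shear is the isometry
    [x |-> t + s * x]. *)
Lemma lebesgue_measure_shear s (B : set (R * R)) : s * s = 1 -> measurable B ->
  mu2 R (shear s @^-1` B) = mu2 R B.
Proof.
move=> ss1 mB.
rewrite /product_measure1 /=; apply: eq_integral => t _ /=.
rewrite -[RHS](@lebesgue_measure_affine s t)//; last exact: measurable_xsection.
Qed.

Lemma integrable_shear s (f : R * R -> R) : s * s = 1 ->
  (mu2 R).-integrable setT (EFin \o f) ->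
  (mu2 R).-integrable setT (EFin \o (fun p => f (shear s p))).
Proof.
move=> ss1; apply: (integrable_preserving (mu := mu2 R) (measurable_shear s)) => A mA.
exact: lebesgue_measure_shear.
Qed.

Lemma Rintegral_shear s (f : R * R -> R) : s * s = 1 ->
  (mu2 R).-integrable setT (EFin \o f) ->
  \int[mu2 R]_p f (shear s p) = \int[mu2 R]_p f p.
Proof.
move=> ss1; apply: (Rintegral_preserving (mu := mu2 R) (measurable_shear s)) => A mA.
exact: lebesgue_measure_shear.
Qed.

Lemma ae_shear s (P : R * R -> Prop) : s * s = 1 ->
  {ae mu2 R, forall p, P p} -> {ae mu2 R, forall p, P (shear s p)}.
Proof.
move=> ss1; apply: (ae_preserving (mu := mu2 R) (measurable_shear s)) => A mA.
exact: lebesgue_measure_shear.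
Qed.

End rigid_motions.

(** * Integrability and Fubini's theorem for real-valued functions *)

Section integrability.
Context d (X : measurableType d) (R : realType) (mu : {measure set X -> \bar R}).
Implicit Types (f g h : X -> R) (D : set X).

Lemma patch_indic_mul D f : f \_ D = f \* \1_D.
Proof.
apply/funext => x; rewrite patchE /= indicE.
by case: ifP => xD; rewrite ?mulr1 ?mulr0.
Qed.

Lemma intg_measurable f : mu.-integrable setT (EFin \o f) -> measurable_fun setT f.
Proof. by case/integrableP => /measurable_EFinP. Qed.

Lemma intg_add f g : mu.-integrable setT (EFin \o f) ->
  mu.-integrable setT (EFin \o g) -> mu.-integrable setT (EFin \o (f \+ g)).
Proof. by move=> fi gi; exact: (integrableD measurableT fi gi). Qed.

Lemma intg_scale (c : R) f : mu.-integrable setT (EFin \o f) ->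
  mu.-integrable setT (EFin \o (fun x => c * f x)).
Proof. by move=> fi; exact: (integrableZl measurableT c fi). Qed.

Lemma intg_sub f g : mu.-integrable setT (EFin \o f) ->
  mu.-integrable setT (EFin \o g) -> mu.-integrable setT (EFin \o (f \- g)).
Proof. by move=> fi gi; exact: (integrableB measurableT fi gi). Qed.

Lemma intg_le f g : measurable_fun setT f -> mu.-integrable setT (EFin \o g) ->
  (forall x, `|f x| <= g x) -> mu.-integrable setT (EFin \o f).
Proof.
move=> mf gi fg; apply: le_integrable gi => //; first exact/measurable_EFinP.
by move=> x _ /=; rewrite lee_fin (le_trans (fg x)) ?ler_norm.
Qed.

Lemma intg_norm f : mu.-integrable setT (EFin \o f) ->
  mu.-integrable setT (EFin \o (fun x => `|f x|)).
Proof. by move=> fi; apply: (integrable_abse fi). Qed.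

Lemma intg_mul_bounded (C : R) f h : mu.-integrable setT (EFin \o f) ->
  measurable_fun setT h -> (forall x, `|h x| <= C) ->
  mu.-integrable setT (EFin \o (f \* h)).
Proof.
move=> fi mh hC; apply: (@intg_le _ (fun x => C * `|f x|)).
- exact: measurable_funM (intg_measurable fi) mh.
- exact/intg_scale/intg_norm.
- by move=> x; rewrite /= normrM mulrC ler_wpM2r.
Qed.

Lemma intg_indic D : measurable D -> (mu D < +oo)%E ->
  mu.-integrable setT (EFin \o (\1_D : X -> R)).
Proof.
move=> mD muD; apply/integrableP; split; first exact/measurable_EFinP.
under eq_integral => x _ do rewrite /= ger0_norm//.
by rewrite integral_indic// setIT.
Qed.

Lemma intg_patch f D : measurable D -> mu.-integrable setT (EFin \o f) ->
  mu.-integrable setT (EFin \o (f \_ D)).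
Proof.
move=> mD fi; rewrite patch_indic_mul; apply: (@intg_mul_bounded 1) => //.
by move=> x; rewrite indicE; case: (_ \in _); rewrite ?normr1 ?normr0.
Qed.

Lemma intg_mkcond f D : measurable D -> mu.-integrable D (EFin \o f) ->
  mu.-integrable setT (EFin \o (f \_ D)).
Proof.
move=> mD fi; have := (integrable_mkcond (EFin \o f) mD).1 fi.
congr (mu.-integrable _ _); apply/funext => x /=; rewrite !patchE; case: ifP => //.
Qed.

Lemma mkcond_intg f D : measurable D -> mu.-integrable setT (EFin \o (f \_ D)) ->
  mu.-integrable D (EFin \o f).
Proof.
move=> mD fi; apply/(integrable_mkcond (EFin \o f) mD).
move: fi; congr (mu.-integrable _ _).
apply/funext => x /=; rewrite !patchE; case: ifP => //.
Qed.

Lemma Lfun2P f : f \in Lfun mu 2%:E <->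
  measurable_fun setT f /\ mu.-integrable setT (EFin \o (fun x => f x ^+ 2)).
Proof.
split=> [f2|[mf /integrableP[_ f2]]].
  split; last exact: Lfun2_integrable_sqr.
  by move: f2; rewrite inE => /andP[]; rewrite inE.
rewrite inE; apply/andP; split; rewrite inE //=.
rewrite /finite_norm unlock /= poweR_lty//.
by move: f2; congr (_ < _)%E; apply: eq_integral => x _ /=;
  rewrite powR_mulrn// normrX.
Qed.

Lemma Lfun2_le f g : measurable_fun setT f -> g \in Lfun mu 2%:E ->
  (forall x, `|f x| <= `|g x|) -> f \in Lfun mu 2%:E.
Proof.
move=> mf /Lfun2P[mg g2] fg; apply/Lfun2P; split => //.
apply: intg_le g2 _; first exact: measurable_funX.
by move=> x; rewrite normrX -(real_normK (num_real (g x))) lerXn2r ?nnegrE.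
Qed.

Lemma Lfun2_add f g : f \in Lfun mu 2%:E -> g \in Lfun mu 2%:E ->
  f \+ g \in Lfun mu 2%:E.
Proof. by move=> f2 g2; apply: (Lfun_addr_closed mu _).2 => //; rewrite lee1n. Qed.

Lemma Lfun2_scale (c : R) f : f \in Lfun mu 2%:E ->
  (fun x => c * f x) \in Lfun mu 2%:E.
Proof.
move=> /Lfun2P[mf f2]; apply/Lfun2P; split; first exact: measurable_funM.
under eq_fun do rewrite exprMn.
exact: intg_scale.
Qed.

Lemma Lfun2_mul_bounded (C : R) f h : f \in Lfun mu 2%:E ->
  measurable_fun setT h -> (forall x, `|h x| <= C) -> f \* h \in Lfun mu 2%:E.
Proof.
move=> f2 mh hC; apply: (@Lfun2_le _ (fun x => C * f x)); last first.
- by move=> x /=; rewrite !normrM mulrC ler_wpM2r// (le_trans (hC x))// ler_norm.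
- exact: Lfun2_scale.
- by apply: measurable_funM => //; case/Lfun2P : f2.
Qed.

Lemma Lfun2_indic D : measurable D -> (mu D < +oo)%E -> (\1_D : X -> R) \in Lfun mu 2%:E.
Proof.
move=> mD muD; apply/Lfun2P; split => //.
rewrite (_ : (fun x => _) = \1_D); first exact: intg_indic.
by apply/funext => x; rewrite indicE; case: (_ \in _); rewrite ?expr1n ?expr0n.
Qed.

Lemma indic_le1 D (x : X) : `|\1_D x| <= 1 :> R.
Proof. by rewrite indicE; case: (_ \in _); rewrite ?normr1 ?normr0. Qed.

Lemma L2_patch D D' f : measurable D' -> L2 mu D f -> L2 mu (D `&` D') f.
Proof.
move=> mD' f2; rewrite /L2 (_ : _ \_ _ = f \_ D \* \1_D').
  by apply: (@Lfun2_mul_bounded 1) => //; exact: indic_le1.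
by rewrite !patch_indic_mul indicI; apply/funext => x /=; rewrite mulrA.
Qed.

Lemma L2_sub D D' f : measurable D' -> D' `<=` D -> L2 mu D f -> L2 mu D' f.
Proof. by move=> mD' /setIidr <-; exact: L2_patch. Qed.

Lemma L2_add D f g : L2 mu D f -> L2 mu D g -> L2 mu D (f \+ g).
Proof.
move=> f2 g2; rewrite /L2 (_ : _ \_ D = f \_ D \+ g \_ D); first exact: Lfun2_add.
by apply/funext => x /=; rewrite !patchE; case: ifP; rewrite ?addr0.
Qed.

Lemma L2_scale D (c : R) f : L2 mu D f -> L2 mu D (fun x => c * f x).
Proof.
move=> f2; rewrite /L2 (_ : _ \_ D = (fun x => c * (f \_ D) x)); first exact: Lfun2_scale.
by apply/funext => x /=; rewrite !patchE; case: ifP; rewrite ?mulr0.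
Qed.

(** Hölder's inequality against the indicator of [D], itself square integrable because [D] has
    finite measure. *)
Lemma L2_intg D f : measurable D -> (mu D < +oo)%E -> L2 mu D f ->
  mu.-integrable setT (EFin \o (f \_ D)).
Proof.
move=> mD muD f2; have := Lfun2_mul_Lfun1 f2 (Lfun2_indic mD muD).
move/Lfun1_integrable; congr (mu.-integrable _ _); apply/funext => x /=.
by rewrite !patchE indicE; case: ifP; rewrite ?mulr1 ?mul0r.
Qed.

Lemma L2_bounded (C : R) D f : measurable D -> (mu D < +oo)%E ->
  measurable_fun setT (f \_ D) -> (forall x, D x -> `|f x| <= C) -> L2 mu D f.
Proof.
move=> mD muD mf fC; apply: (@Lfun2_le _ (fun x => C * \1_D x)) => //.
  exact/Lfun2_scale/Lfun2_indic.
move=> x; rewrite patchE indicE; case: ifP; rewrite ?normr0 // mulr1 inE => /fC /le_trans; apply.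
exact: ler_norm.
Qed.

Lemma eq_L2 D f g : (forall x, D x -> f x = g x) -> L2 mu D f -> L2 mu D g.
Proof.
move=> fg; rewrite /L2 (_ : f \_ D = g \_ D) //; apply/funext => x; rewrite !patchE.
by case: ifP => //; rewrite inE; exact: fg.
Qed.

End integrability.

Section fubini_Rintegral.
Context d1 d2 (X : measurableType d1) (Y : measurableType d2) (R : realType).
Context (m1 : {sigma_finite_measure set X -> \bar R}).
Context (m2 : {sigma_finite_measure set Y -> \bar R}).
Context (f : X * Y -> R).
Hypothesis fi : (m1 \x m2)%E.-integrable setT (EFin \o f).

(** [Rintegral] applies [fine], which collapses infinite values to 0. Almost every section is
    integrable, so the real inner integral agrees almost everywhere with the extended one, and
    Fubini's theorem carries over. *)
Lemma ae_fin12 : {ae m1, forall x, fubini_F m2 (EFin \o f) x =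
  (\int[m2]_y f (x, y))%:E}.
Proof.
move: (ae_integrable1 fi); apply: filterS => x fx.
by rewrite /fubini_F /Rintegral fineK //; exact: integrable_fin_num.
Qed.

Lemma ae_fin21 : {ae m2, forall y, fubini_G m1 (EFin \o f) y =
  (\int[m1]_x f (x, y))%:E}.
Proof.
move: (ae_integrable2 fi); apply: filterS => x fx.
by rewrite /fubini_G /Rintegral fineK //; exact: integrable_fin_num.
Qed.

Lemma fine_le_abse (y : \bar R) : (`|(fine y)%:E| <= `|y|)%E.
Proof. by case: y => [r||] //=; rewrite normr0 leey. Qed.

Lemma intg_fubini1 : m1.-integrable setT (EFin \o (fun x => \int[m2]_y f (x, y))).
Proof.
have mF := measurable_fubini_F fi.
apply: (le_integrable measurableT _ _ (integrable_fubini_F fi)).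
  by apply/measurable_EFinP; exact: (measurableT_comp _ mF).
by move=> x _; exact: fine_le_abse.
Qed.

Lemma intg_fubini2 : m2.-integrable setT (EFin \o (fun y => \int[m1]_x f (x, y))).
Proof.
have mF := measurable_fubini_G fi.
case/integrableP : (fi) => mf fi'.
apply/integrableP; split.
  by apply/measurable_EFinP; exact: (measurableT_comp _ mF).
apply: le_lt_trans ((integrable21ltyP m1 m2 mf).1 fi).
apply: ge0_le_integral => //.
- apply: measurableT_comp => //; apply/measurable_EFinP.
  exact: (measurableT_comp _ mF).
- apply: (measurable_fun_fubini_tonelli_G (abse \o (EFin \o f))) => //=.
  exact: measurableT_comp.
- move=> y _; apply: (le_trans (fine_le_abse _)); apply: le_abse_integral => //.
  exact: (measurableT_comp mf (measurable_pair2 y)).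
Qed.

Lemma Rintegral12 : \int[(m1 \x m2)%E]_p f p = \int[m1]_x \int[m2]_y f (x, y).
Proof.
rewrite {1}/Rintegral -(integral12_prod_meas1 fi) [in RHS]/Rintegral; congr fine.
apply: ae_eq_integral => //.
- exact: (measurable_fubini_F fi).
- by apply: (measurable_int m1); exact: intg_fubini1.
- by move: ae_fin12; apply: filterS => x ->.
Qed.

Lemma Rintegral21 : \int[(m1 \x m2)%E]_p f p = \int[m2]_y \int[m1]_x f (x, y).
Proof.
rewrite {1}/Rintegral -(integral21_prod_meas1 fi) [in RHS]/Rintegral; congr fine.
apply: ae_eq_integral => //.
- exact: (measurable_fubini_G fi).
- by apply: (measurable_int m2); exact: intg_fubini2.
- by move: ae_fin21; apply: filterS => x ->.
Qed.

End fubini_Rintegral.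

(** * Combining almost-everywhere statements *)

Section almost_everywhere.
Context d (X : measurableType d) (R : realType) (mu : {measure set X -> \bar R}).

Lemma ae_imply (P Q : X -> Prop) : {ae mu, forall x, P x} ->
  (forall x, P x -> Q x) -> {ae mu, forall x, Q x}.
Proof. by move=> aP PQ; move: aP; apply: filterS. Qed.

Lemma ae_imply2 (P1 P2 Q : X -> Prop) : {ae mu, forall x, P1 x} ->
  {ae mu, forall x, P2 x} -> (forall x, P1 x -> P2 x -> Q x) ->
  {ae mu, forall x, Q x}.
Proof. by move=> a1 a2 PQ; move: a1 a2; apply: filterS2. Qed.

(** The index type is enumerated by [unpickle]; numbers that encode no index carry a trivially true
    property. *)
Lemma ae_countable (I : countType) (P : I -> X -> Prop) :
  (forall i, {ae mu, forall x, P i x}) -> {ae mu, forall x, forall i, P i x}.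
Proof.
move=> aP.
have : {ae mu, forall x, forall n : nat, if unpickle n is Some i then P i x else True}.
  apply: ae_foralln => n; case: unpickle => [i|]; first exact: aP.
  exact: aeW.
by move/ae_imply; apply=> x Px i; have := Px (pickle i); rewrite pickleK.
Qed.

End almost_everywhere.

(** * Test functions on the line and the du Bois-Reymond lemma *)

Section bumps.
Context {R : realType}.
Implicit Types (a b x y : R) (n : nat).

(** A quadratic bound on the remainder replaces limit computations. It also covers [pos2], whose
    derivative is merely Lipschitz at 0. *)
Lemma is_derive_quadratic (f : R -> R) (x l C : R) :
  (forall h, `|f (h + x) - f x - l * h| <= C * h ^+ 2) -> is_derive x 1 f l.
Proof.
move=> fC.
have fl : h^-1 *: ((f \o shift x) (h *: (1 : R)) - f x) @[h --> 0^'] --> l.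
  apply/cvgrPdist_le => e e0.
  have C0 : 0 <= C.
    by have := le_trans (normr_ge0 _) (fC 1); rewrite expr1n mulr1.
  near=> h.
  have h0 : h != 0 by near: h; exact: nbhs_dnbhs_neq.
  rewrite /= [h *: 1]mulr1.
  have -> : l - h^-1 *: (f (h + x) - f x) = - (h^-1 * (f (h + x) - f x - l * h)).
    by rewrite /GRing.scale /=; field.
  rewrite normrN normrM normfV ler_pdivrMl ?normr_gt0//.
  apply: (le_trans (fC h)); rewrite -(real_normK (num_real h)) expr2 mulrA mulrC.
  rewrite ler_wpM2l//.
  have : `|h| <= e / (C + 1).
    near: h; apply: dnbhs0_le; rewrite divr_gt0// ltr_wpDl//.
  rewrite ler_pdivlMr ?ltr_wpDl// => he.
  apply: le_trans he; rewrite mulrC ler_wpM2l//; lra.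
apply: DeriveDef; first by apply/cvg_ex; exists l.
by apply/cvg_lim => //; exact: Rhausdorff.
Unshelve. all: by end_near. Qed.

(* As test functions are only C^1, pos2 is smooth enough to build bumps. *)
Definition pos2 y : R := (Num.max 0 y) ^+ 2.

Lemma is_derive_pos2 y : is_derive y 1 pos2 (2 * Num.max 0 y).
Proof.
apply: (@is_derive_quadratic _ _ _ 1) => h; rewrite mul1r /pos2.
rewrite ler_norml.
by case: (ltP 0 (h + y)) => hy; case: (ltP 0 y) => y0; rewrite ?expr0n/=; nra.
Qed.

Lemma continuous_maxr0 : continuous (fun y : R => Num.max 0 y).
Proof.
move=> y; have -> : (fun y : R => Num.max 0 y) = (fun y => 2^-1 * (y + `|y|)).
  apply/funext => z; case: ltP => z0; rewrite ?(gtr0_norm z0) ?(ler0_norm z0); lra.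
apply: cvgM; first exact: cvg_cst.
by apply: cvgD; [exact: cvg_id|exact: norm_continuous].
Qed.

(** Dividing by [(b - a) ^+ 4] keeps the values between 0 and 1, so that the powers of
    [1 - bump_core a b x] tend to 0 inside the interval and stay equal to 1 outside. *)
Definition bump_core a b x : R := pos2 ((x - a) * (b - x)) / (b - a) ^+ 4.
(* Increases with n to the indicator function of ]a, b[. *)
Definition bump a b n x : R := 1 - (1 - bump_core a b x) ^+ n.
Definition dbump a b n x : R :=
  n%:R * (1 - bump_core a b x) ^+ n.-1 *
  (2 * Num.max 0 ((x - a) * (b - x)) * (a + b - 2 * x) / (b - a) ^+ 4).

Lemma is_derive_bump_core a b x : is_derive x 1 (bump_core a b)
  (2 * Num.max 0 ((x - a) * (b - x)) * (a + b - 2 * x) / (b - a) ^+ 4).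
Proof.
have H1 : is_derive x 1 (fun x : R => (x - a) * (b - x)) (a + b - 2 * x).
  apply: (@is_derive_quadratic _ _ _ 1) => h.
  rewrite mul1r (_ : _ - _ = - h ^+ 2); last by ring.
  by rewrite normrN ger0_norm ?sqr_ge0.
have H2 := @is_derive1_comp _ pos2 (fun x => (x - a) * (b - x)) x _ _ (is_derive_pos2 _) H1.
have -> : bump_core a b = (b - a) ^- 4 \*: (pos2 \o (fun x : R => (x - a) * (b - x))).
  by apply/funext => z /=; rewrite /bump_core mulrC.
apply: is_derive_eq; rewrite /GRing.scale /=; ring.
Qed.

Lemma is_derive_bump a b n x : is_derive x 1 (bump a b n) (dbump a b n x).
Proof.
have H1 := is_derive_bump_core a b x.
have -> : bump a b n = cst 1 - (cst 1 - bump_core a b) ^+ n.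
  apply/funext => z; rewrite /bump /= !fctE.
  by congr (_ - _); elim: n => // n IH; rewrite !exprS IH.
apply: is_derive_eq; rewrite /dbump /GRing.scale /= !fctE /=; ring.
Qed.

Lemma continuous_bump_core a b : continuous (bump_core a b).
Proof.
move=> x; apply/differentiable_continuous/derivable1_diffP.
by case: (is_derive_bump_core a b x).
Qed.

Lemma continuous_bump a b n : continuous (bump a b n).
Proof.
move=> x; apply/differentiable_continuous/derivable1_diffP.
by case: (is_derive_bump a b n x).
Qed.

Lemma continuous_dbump a b n : continuous (dbump a b n).
Proof.
move=> x; apply: cvgM.
  apply: cvgM; first exact: cvg_cst.
  have : continuous ((fun z : R => z ^+ n.-1) \o (fun x => 1 - bump_core a b x)).
    move=> z; apply: continuous_comp; last exact: exprn_continuous.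
    by apply: cvgB; [exact: cvg_cst|exact: continuous_bump_core].
  exact.
apply: cvgM; last exact: cvg_cst.
apply: cvgM.
  apply: cvgM; first exact: cvg_cst.
  have : continuous ((fun z : R => Num.max 0 z) \o (fun x => (x - a) * (b - x))).
    move=> z; apply: continuous_comp; last exact: continuous_maxr0.
    by apply: cvgM; apply: cvgB; (exact: cvg_cst || exact: cvg_id).
  exact.
by apply: cvgB; [exact: cvg_cst|apply: cvgM; [exact: cvg_cst|exact: cvg_id]].
Qed.

Lemma bump_core_gt0 a b x : a < x < b -> 0 < bump_core a b x.
Proof.
move=> /andP[ax xb]; rewrite /bump_core /pos2 divr_gt0 ?exprn_gt0//; last by lra.
rewrite lt_max; apply/orP; right; rewrite mulr_gt0//; lra.
Qed.

Lemma bump_core_itv a b x : a < b -> 0 <= bump_core a b x <= 1.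
Proof.
move=> ab; have ba : 0 < b - a by lra.
rewrite /bump_core /pos2 divr_ge0 ?exprn_ge0 ?le_max ?lexx ?(ltW ba)//=.
rewrite ler_pdivrMr ?exprn_gt0// mul1r (_ : 4 = 2 * 2)%N// exprM.
apply: lerXn2r; rewrite ?nnegrE ?le_max ?lexx ?exprn_ge0 ?(ltW ba)//.
rewrite ge_max exprn_ge0 ?(ltW ba)//=.
have := sqr_ge0 (x - a - (b - x)); have := sqr_ge0 (b - a); nra.
Qed.

Lemma bump_out a b n x : a < b -> ~ (a < x < b) -> bump a b n x = 0.
Proof.
move=> ab nx; rewrite /bump (_ : bump_core a b x = 0).
  by rewrite subr0 expr1n subrr.
rewrite /bump_core /pos2 max_l ?expr0n ?mul0r//.
rewrite leNgt; apply/negP => H; apply: nx.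
have [ax|xa] := ltP a x; last by nra.
have [xb|bx] := ltP x b; [by []|nra].
Qed.

Lemma bump_itv a b n x : a < b -> 0 <= bump a b n x <= 1.
Proof.
move=> ab; have /andP[q0 q1] := bump_core_itv x ab.
have q1' : 0 <= 1 - bump_core a b x by lra.
by rewrite /bump subr_ge0 exprn_ile1//=; [rewrite gerBl exprn_ge0|lra].
Qed.

Lemma cvg_bump a b x : a < b ->
  bump a b n x @[n --> \oo] --> (\1_(`]a, b[%classic) x : R).
Proof.
move=> ab; rewrite indicE mem_setE in_itv /=.
case: (boolP (a < x < b)) => [axb|/negP naxb].
  rewrite -[X in _ --> X]subr0; apply: cvgB; first exact: cvg_cst.
  apply: cvg_expr; have := bump_core_gt0 axb.
  have /andP[q0 q1] := bump_core_itv x ab => q.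
  by rewrite ger0_norm; lra.
under eq_cvg do rewrite bump_out//.
exact: cvg_cst.
Qed.

Lemma bump_gt0 a b n x : a < x < b -> 0 < bump a b n.+1 x.
Proof.
move=> axb; have /andP[ax xb] := axb; have ab : a < b by lra.
have q0 := bump_core_gt0 axb; have /andP[_ q1] := bump_core_itv x ab.
by rewrite /bump subr_gt0 exprn_ilt1//; lra.
Qed.

End bumps.

Section test_functions.
Context {R : realType}.
Local Notation mu := (@lebesgue_measure R).
Implicit Types (a b x y : R) (n : nat).

Lemma closure_support_sub (f : R -> R) (al be : R) :
  (forall x, ~ (al <= x <= be) -> f x = 0) ->
  closure [set x | f x != 0] `<=` `[al, be].
Proof.
move=> f0; rewrite [X in _ `<=` X](closure_id _).1; last exact: interval_closed.
apply: closure_subset => x /= fx; rewrite in_itv /=.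
by apply: contraNT fx => /negP/f0/eqP.
Qed.

Lemma test_fun1_itv (f df : R -> R) a b (al be : R) : a < al -> be < b ->
  (forall x, is_derive x 1 f (df x)) -> continuous df ->
  (forall x, ~ (al <= x <= be) -> f x = 0) -> test_fun1 `]a, b[ f.
Proof.
move=> aal beb fdf cdf f0; have sub := closure_support_sub f0.
have dfE : df = derive1 f by apply/funext => x; rewrite derive1E; case: (fdf x).
rewrite {}dfE in cdf.
split.
- by move=> x; case: (fdf x).
- exact: cdf.
- apply: subclosed_compact sub; first exact: closed_closure.
  exact: segment_compact.
- by apply: (subset_trans sub) => x /=; rewrite !in_itv /=; lra.
Qed.

Lemma test_fun1_bump a b (al be : R) n : a < al -> al < be -> be < b ->
  test_fun1 `]a, b[ (bump al be n).
Proof.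
move=> aal ab beb; apply: (test_fun1_itv aal beb (is_derive_bump al be n)).
  exact: continuous_dbump.
by move=> x nx; apply: bump_out => //; lra.
Qed.

Lemma intg_continuous_support (f : R -> R) (al be : R) : continuous f ->
  (forall x, ~ (al <= x <= be) -> f x = 0) ->
  mu.-integrable setT (EFin \o f).
Proof.
move=> cf f0; rewrite (_ : f = f \_ `[al, be]%classic).
  apply: intg_mkcond => //; apply: continuous_compact_integrable.
    exact: segment_compact.
  exact: continuous_subspaceT.
apply/funext => x; rewrite patchE; case: ifPn => //.
by rewrite notin_setE /= in_itv /= => /f0.
Qed.

Lemma intg_itv (f : R -> R) (i : interval R) : mu.-integrable setT (EFin \o f) ->
  mu.-integrable [set` i] (EFin \o f).
Proof. by apply: integrableS => //; exact: measurable_itv. Qed.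

(** The zero integral is what makes the primitive from [-oo] vanish again to the right of the
    support. *)
Lemma test_fun1_primitive (th : R -> R) a b (al be : R) : a < al -> be < b ->
  continuous th -> (forall x, ~ (al <= x <= be) -> th x = 0) ->
  \int[mu]_x th x = 0 ->
  exists2 ps, test_fun1 `]a, b[ ps & derive1 ps = th.
Proof.
move=> aal beb cth th0 Ith.
have ith := intg_continuous_support cth th0.
pose ps x := \int[mu]_(t in `]-oo, x]) th t.
have dps x : is_derive x 1 ps (th x).
  have [] := @continuous_FTC1 _ th -oo%O x (x + 1).
  - by rewrite ltrDl.
  - exact: intg_itv.
  - exact: ltNyr.
  - exact: cth.
  move=> d1 d2; apply: DeriveDef; [exact: d1|by rewrite -derive1E].
exists ps; last by apply/funext => x; rewrite derive1E; case: (dps x).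
apply: (test_fun1_itv aal beb dps cth) => x nx.
have [xal|alx] := ltP x al.
  rewrite /ps /Rintegral integral0_eq// => t /=; rewrite in_itv /= => tx.
  by rewrite th0//; lra.
have bex : be < x by lra.
rewrite -Ith /ps Rintegral_mkcond; apply: eq_Rintegral => t _.
rewrite patchE; case: ifPn => //; rewrite notin_setE /= in_itv /= => /negP.
by rewrite -ltNge => xt; rewrite th0//; lra.
Qed.

Lemma measurable_continuous (f : R -> R) : continuous f -> measurable_fun setT f.
Proof. exact: continuous_measurable_fun. Qed.

(** The primitive of [f] takes a single value at the rational points of the interval, hence by
    continuity at all its points; Lebesgue's differentiation theorem then identifies [f] with the
    derivative of a constant. *)
Lemma Rintegral_zero_itvs (f : R -> R) a b :
  mu.-integrable setT (EFin \o f) ->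
  (forall p q : rat, a < ratr p -> ratr p < ratr q :> R -> ratr q < b ->
    \int[mu]_(x in `]ratr p, ratr q[) f x = 0) ->
  {ae mu, forall x, x \in `]a, b[ -> f x = 0}.
Proof.
move=> fi f0.
pose F x := \int[mu]_(t in `[a, x]) f t.
have fia y : mu.-integrable `[a, y] (EFin \o f) by exact: intg_itv.
have lf : locally_integrable [set: R] f.
  by apply: open_integrable_locally => //; exact: openT.
have cF : {within `[a, b], continuous F}.
  have [ab|ba] := leP a b; last by rewrite set_itv_ge ?bnd_simp -?ltNge//; exact: continuous_subspace0.
  exact: parameterized_integral_continuous.
have FE p q : a <= p -> p < q -> F q - F p = \int[mu]_(x in `]p, q[) f x.
  move=> ap pq; rewrite /F Rintegral_itvB ?bnd_simp//; last exact: ltW.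
  by rewrite -Rintegral_itv_bndo_bndc//; exact: intg_itv.
have Fat x : x \in `]a, b[ -> {for x, continuous F}.
  have := subset_itv_oo_cc => /(_ _ _ a b) => /continuous_subspaceW /(_ cF).
  by rewrite continuous_open_subspace; [move=> H xab; apply: H; rewrite inE|exact: interval_open].
have Frat (p q : rat) : ratr p \in `]a, b[ -> ratr q \in `]a, b[ ->
    F (ratr p) = F (ratr q).
  wlog pq : p q / (ratr p : R) < ratr q.
    move=> H pab qab; have [?|?|->//] := ltgtP (ratr p : R) (ratr q); first exact: H.
    by apply/esym; exact: H.
  rewrite !in_itv /= => /andP[ap _] /andP[_ qb]; apply/eqP; rewrite eq_sym -subr_eq0.
  by rewrite FE ?f0// ltW.
have Frn x (e : R) : x \in `]a, b[ -> 0 < e ->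
    exists2 p : rat, ratr p \in `]a, b[ & `|F x - F (ratr p)| < e.
  move=> xab e0; have /cvgrPdist_lt /(_ e e0) := Fat x xab.
  case/nbhs_ballP => d d0 dF; move: xab; rewrite in_itv /= => /andP[ax xb].
  have [] := @rat_in_itvoo _ x (Num.min (x + d) b); first by rewrite lt_min xb ltrDl d0.
  move=> p; rewrite in_itv /= lt_min => /and3P[xp pd pb].
  exists p; first by rewrite in_itv /=; lra.
  by apply: dF; rewrite /ball/= ltr_norml; lra.
have Fc x y : x \in `]a, b[ -> y \in `]a, b[ -> F x = F y.
  move=> xab yab; apply/eqP/negPn/negP => Fxy.
  have d0 : 0 < `|F x - F y| / 2 by rewrite divr_gt0// normr_gt0 subr_eq0.
  have [p pab Fp] := Frn x _ xab d0; have [q qab Fq] := Frn y _ yab d0.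
  move: Fp Fq; rewrite (Frat p q)// => Fp Fq.
  have := ler_distD (F (ratr q)) (F x) (F y).
  rewrite (distrC (F (ratr q))); lra.
have := @FTC1 _ f (BLeft a) fia lf => /ae_imply; apply => x /= Fx xab.
have ax : (a%:E < x%:E)%E by move: xab; rewrite in_itv /= lte_fin => /andP[].
have [dF <-] := Fx ax.
rewrite derive1E (@near_eq_derive _ _ _ F (cst (F x))) ?derive_cst//.
near=> y; apply: Fc => //; near: y.
by apply: near_in_itvoo.
Unshelve. all: by end_near. Qed.

End test_functions.

Lemma Rintegral_dominated d (X : measurableType d) (R : realType)
    (mu : {measure set X -> \bar R}) (f_ : nat -> X -> R) (f g : X -> R) :
  (forall n, measurable_fun setT (f_ n)) -> measurable_fun setT f ->
  (forall x, f_ n x @[n --> \oo] --> f x) ->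
  mu.-integrable setT (EFin \o g) -> (forall n x, `|f_ n x| <= g x) ->
  \int[mu]_x f_ n x @[n --> \oo] --> \int[mu]_x f x.
Proof.
move=> mf_ mf f_f gi f_g.
have [] := @dominated_convergence _ _ _ mu setT measurableT
  (fun n => EFin \o f_ n) (EFin \o f) (EFin \o g).
- by move=> n; exact/measurable_EFinP.
- exact/measurable_EFinP.
- by apply: aeW => x _ /=; apply: cvg_EFin; [exact: nearW|exact: f_f].
- exact: gi.
- by apply: aeW => x n _ /=; rewrite lee_fin.
move=> fi _ H; rewrite /Rintegral; apply: fine_cvg; rewrite fineK//.
exact: integrable_fin_num.
Qed.

Section variational_lemmas.
Context {R : realType}.
Local Notation mu := (@lebesgue_measure R).
Implicit Types (a b x y : R) (n : nat).

Lemma lebesgue_measure_itv_oo_lty a b : (mu `]a, b[%classic < +oo)%E.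
Proof. by rewrite lebesgue_measure_itv /=; case: ifP => // _; rewrite -EFinB ltry. Qed.

(** Dominated convergence in [n] turns the bumps into indicators of rational intervals. The family
    of tests is countable, which is essential when each test is known to vanish only for almost
    every slice. *)
Lemma bump_test_zero (f : R -> R) a b : mu.-integrable setT (EFin \o f) ->
  (forall (p q : rat) n, a < ratr p -> ratr p < ratr q :> R -> ratr q < b ->
    \int[mu]_x (f x * bump (ratr p) (ratr q) n x) = 0) ->
  {ae mu, forall x, x \in `]a, b[ -> f x = 0}.
Proof.
move=> fi f0; apply: Rintegral_zero_itvs => // p q ap pq qb.
have mf := intg_measurable fi.
have : \int[mu]_x (f x * bump (ratr p) (ratr q) n x) @[n --> \oo] -->
       \int[mu]_x (f x * \1_(`]ratr p, ratr q[%classic) x).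
  apply: (@Rintegral_dominated _ _ _ mu _ _ (fun x => `|f x|)).
  - move=> n; apply: measurable_funM => //.
    by apply: measurable_continuous; exact: continuous_bump.
  - exact: measurable_funM.
  - by move=> x; apply: cvgM; [exact: cvg_cst|exact: cvg_bump].
  - exact: intg_norm.
  - move=> n x; rewrite normrM ler_piMr//.
    by have /andP[b0 b1] := bump_itv n x pq; rewrite ger0_norm.
under eq_cvg do rewrite f0//.
move=> /(cvg_unique (@Rhausdorff R)) -/(_ _ (cvg_cst _)) H.
by rewrite Rintegral_mkcond patch_indic_mul -[RHS]H.
Qed.

Lemma Rintegral_bump_gt0 a b n : a < b -> 0 < \int[mu]_x bump a b n.+1 x.
Proof.
move=> ab.
have bi : mu.-integrable setT (EFin \o bump a b n.+1).
  apply: (@intg_continuous_support _ _ a b); first exact: continuous_bump.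
  by move=> x nx; apply: bump_out => //; lra.
rewrite lt_def Rintegral_ge0 ?andbT; last first.
  by move=> x _; case/andP : (bump_itv n.+1 x ab).
apply/negP => /eqP I0.
have : {ae mu, forall x, x \in `]a, b[ -> bump a b n.+1 x = 0}.
  apply: Rintegral_zero_itvs => // p q ap pq qb.
  apply/eqP; rewrite eq_le Rintegral_ge0 ?andbT; last first.
    by move=> x _; case/andP : (bump_itv n.+1 x ab).
  rewrite -I0 Rintegral_mkcond le_Rintegral//.
    exact: intg_patch.
  move=> x _; rewrite patchE; case: ifP => // _.
  by case/andP : (bump_itv n.+1 x ab).
move=> [N [mN N0 sub]].
have : (mu `]a, b[%classic <= mu N)%E.
  apply: le_measure; rewrite ?inE//.
  move=> x /= xab; apply: sub => /= /(_ xab); move: xab; rewrite in_itv /= => xab.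
  by have := bump_gt0 n xab => /[swap] ->; rewrite ltxx.
by rewrite N0 lebesgue_measure_itv /= lte_fin ab -EFinD lee_fin; lra.
Qed.

(** A bump minus the multiple of a fixed bump [th0] with the same integral is the derivative of a
    test function. Hence [f - c] is orthogonal to every bump, where [c] is the mean of [f] with
    weight [th0]. *)
Lemma dubois_reymond (f : R -> R) a b : a < b ->
  mu.-integrable setT (EFin \o f) ->
  (forall ps, test_fun1 `]a, b[ ps -> \int[mu]_x (f x * derive1 ps x) = 0) ->
  exists c, {ae mu, forall x, x \in `]a, b[ -> f x = c}.
Proof.
move=> ab fi f0.
pose al := a + (b - a) / 3; pose be := b - (b - a) / 3.
have [aal albe beb] : [/\ a < al, al < be & be < b] by rewrite /al /be; split; lra.
pose th0 := bump al be 1.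
have th00 x : ~ (al <= x <= be) -> th0 x = 0.
  by move=> nx; apply: bump_out => //; lra.
have cth0 : continuous th0 by exact: continuous_bump.
have I0 : 0 < \int[mu]_x th0 x := Rintegral_bump_gt0 0 albe.
have ith0 := intg_continuous_support cth0 th00.
have mbd (p q : R) n : p < q -> mu.-integrable setT (EFin \o (fun x => f x * bump p q n x)).
  move=> pq; apply: (@intg_mul_bounded _ _ _ _ 1) => //.
    by apply: measurable_continuous; exact: continuous_bump.
  by move=> x; have /andP[? ?] := bump_itv n x pq; rewrite ger0_norm.
pose c := \int[mu]_x (f x * th0 x) / \int[mu]_x th0 x.
exists c.
have abi : mu.-integrable setT (EFin \o (fun x => c * \1_(`]a, b[%classic) x)).
  by apply: intg_scale; apply: intg_indic; [|exact: lebesgue_measure_itv_oo_lty].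
have : {ae mu, forall x, x \in `]a, b[ -> f x - c * \1_(`]a, b[%classic) x = 0}.
  apply: bump_test_zero; first exact: intg_sub.
  move=> p q n ap pq qb.
  pose be1 := bump (ratr p : R) (ratr q) n.
  have cbe1 : continuous be1 by exact: continuous_bump.
  have be10 x : ~ (ratr p <= x <= ratr q) -> be1 x = 0.
    by move=> nx; apply: bump_out => //; lra.
  have ibe1 := intg_continuous_support cbe1 be10.
  pose k := \int[mu]_x be1 x / \int[mu]_x th0 x.
  pose th x := be1 x - k * th0 x.
  have [] := @test_fun1_primitive _ th a b (Num.min al (ratr p)) (Num.max be (ratr q)).
  - by rewrite lt_min aal.
  - by rewrite gt_max beb.
  - by move=> x; apply: cvgB; [exact: cbe1|apply: cvgM; [exact: cvg_cst|exact: cth0]].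
  - move=> x nx; rewrite /th be10 ?th00 ?mulr0 ?subr0// => /andP[h1 h2]; apply: nx;
      by rewrite ge_min le_max h1 h2 ?orbT.
  - rewrite /th RintegralB//; last exact: intg_scale.
    by rewrite RintegralZl// /k divfK ?subrr// gt_eqF.
  move=> ps tps psth; have := f0 _ tps; rewrite psth /th => H.
  have H2 : \int[mu]_x (f x * be1 x) - k * \int[mu]_x (f x * th0 x) = 0.
    rewrite -[RHS]H -RintegralZl//; last exact: mbd.
    rewrite -RintegralB//; [|exact: mbd|exact/intg_scale/mbd].
    by apply: eq_Rintegral => x _; ring.
  transitivity (\int[mu]_x (f x * be1 x) - c * \int[mu]_x be1 x).
    rewrite -RintegralZl// -RintegralB//; [|exact: mbd|exact: intg_scale].
    apply: eq_Rintegral => x _; rewrite mulrBl -/be1; congr (_ - _).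
    rewrite indicE mem_setE; case: (boolP (x \in _)) => [_|]; first by rewrite mulr1.
    rewrite in_itv /= => nx; rewrite be10 ?mulr0// => pxq; move/negP : nx; apply; lra.
  rewrite -H2 /k /c; congr (_ - _); ring.
move=> /ae_imply; apply => x /[swap] xab /(_ xab).
by rewrite indicE mem_setE xab mulr1 => /eqP; rewrite subr_eq0 => /eqP.
Qed.

End variational_lemmas.

Lemma intg_tensor d1 d2 (X : measurableType d1) (Y : measurableType d2)
    (R : realType) (m1 : {sigma_finite_measure set X -> \bar R})
    (m2 : {sigma_finite_measure set Y -> \bar R}) (f : X -> R) (g : Y -> R) :
  m1.-integrable setT (EFin \o f) -> m2.-integrable setT (EFin \o g) ->
  (m1 \x m2)%E.-integrable setT (EFin \o (fun p => f p.1 * g p.2)).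
Proof.
move=> fi gi; have mf := intg_measurable fi; have mg := intg_measurable gi.
have mfg : measurable_fun setT (EFin \o (fun p : X * Y => f p.1 * g p.2)).
  by apply/measurable_EFinP; apply: measurable_funM; apply: measurableT_comp.
apply: (@integrable12ltyP _ _ X Y R m1 m2 _ mfg).2.
rewrite (eq_integral (fun x => (`|f x|%:E * \int[m2]_y `|(g y)%:E|)%E)); last first.
  move=> x _; rewrite -ge0_integralZl//; last first.
    by apply: measurableT_comp => //; exact/measurable_EFinP.
  by apply: eq_integral => y _ /=; rewrite normrM EFinM.
have [mg' gfin] := integrableP _ _ _ gi.
rewrite ge0_integralZr//; last 2 first.
- exact/measurable_EFinP/measurableT_comp.
- exact: integral_ge0.
rewrite lte_mul_pinfty//; first exact: integral_ge0.
- have := integrable_fin_num measurableT (intg_norm fi).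
  exact.
Qed.

(** * Integration by parts against a primitive *)

Section absolutely_continuous.
Context {R : realType}.
Local Notation mu := (@lebesgue_measure R).
Implicit Types (a b x y c : R).

Lemma Rintegral_derive (ph dph : R -> R) x y : x <= y ->
  (forall z : R, is_derive z 1 ph (dph z)) -> continuous dph ->
  \int[mu]_(z in `[x, y]) dph z = ph y - ph x.
Proof.
rewrite le_eqVlt => /predU1P[<- _ _|xy dp cdp].
  by rewrite set_itv1 Rintegral_set1 subrr.
rewrite /Rintegral (@continuous_FTC2 _ dph ph)//.
- exact: continuous_subspaceT.
- have cph z : {for z, continuous ph}.
    by apply/differentiable_continuous/derivable1_diffP; case: (dp z).
  split.
  + by move=> z _; case: (dp z).
  + exact: (cvg_at_right_filter (cph x)).
  + exact: (cvg_at_left_filter (cph y)).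
- by move=> z _; rewrite derive1E; case: (dp z).
Qed.

Lemma continuous_bounded_itv (f : R -> R) a b : continuous f ->
  exists C, forall x, x \in `[a, b] -> `|f x| <= C.
Proof.
move=> cf; have [ab|ba] := leP a b; last first.
  by exists 0 => x; rewrite in_itv /=; lra.
have cn : {within `[a, b], continuous (fun x => `|f x|)}.
  apply: continuous_subspaceT => x.
  by apply: (@continuous_comp _ _ _ f (fun y : R => `|y|)); [exact: cf|exact: norm_continuous].
by have [c _ H] := EVT_max ab cn; exists `|f c|.
Qed.

Lemma intg_patch_mul_continuous (f ph : R -> R) a b :
  mu.-integrable setT (EFin \o f) -> continuous ph ->
  mu.-integrable setT (EFin \o ((f \* ph) \_ `]a, b[%classic)).
Proof.
move=> fi cph; have [C phC] := continuous_bounded_itv a b cph.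
rewrite (_ : _ \_ _ = f \* (ph \_ `]a, b[%classic)); last first.
  by apply/funext => x /=; rewrite !patchE; case: ifP; rewrite ?mulr0.
apply: (@intg_mul_bounded _ _ _ _ (Num.max C 0)) => //.
  rewrite patch_indic_mul; apply: measurable_funM => //.
  exact: continuous_measurable_fun.
move=> x; rewrite patchE; case: ifPn => [|_]; last by rewrite normr0 le_max lexx orbT.
rewrite inE => xab; rewrite le_max phC//; move: xab; rewrite /= !in_itv /=; lra.
Qed.

Lemma intg_continuous_itv (f : R -> R) (i : interval R) a b : continuous f ->
  [set` i] `<=` `[a, b] -> mu.-integrable [set` i] (EFin \o f).
Proof.
move=> cf iab; apply: (@integrableS _ _ _ mu `[a, b]) => //.
apply: continuous_compact_integrable; first exact: segment_compact.
exact: continuous_subspaceT.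
Qed.

(** Fubini's theorem on a triangle takes the place of the product rule, as the primitive of [g] is
    differentiable only almost everywhere. The constant [k] drops out because [ph] vanishes at both
    ends. *)
Lemma Rintegral_parts (g ph dph : R -> R) a b k : a < b ->
  mu.-integrable setT (EFin \o g) ->
  (forall z : R, is_derive z 1 ph (dph z)) -> continuous dph ->
  ph a = 0 -> ph b = 0 ->
  \int[mu]_(x in `]a, b[) ((k + \int[mu]_(z in `[a, x]) g z) * dph x) =
  - \int[mu]_(x in `]a, b[) (g x * ph x).
Proof.
move=> ab gi dp cdp pa pb.
have cph : continuous ph.
  by move=> z; apply/differentiable_continuous/derivable1_diffP; case: (dp z).
pose h := dph \_ `]a, b[%classic; pose G := g \_ `]a, b[%classic.
have hi : mu.-integrable setT (EFin \o h).
  by apply: intg_mkcond => //; apply: (intg_continuous_itv cdp); exact: subset_itv_oo_cc.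
have Gi : mu.-integrable setT (EFin \o G) by exact: intg_patch.
(* Supported on the triangle [a < z <= x < b]. Integrating first in [z] produces the primitive of
   [g]; integrating first in [x] produces [ph b - ph z], that is [- ph z]. *)
pose F (p : R * R) := h p.1 * G p.2 * (p.2 <= p.1)%R%:R.
have mle : measurable_fun setT (fun p : R * R => (p.2 <= p.1)%R%:R : R).
  have mb : measurable_fun setT (fun p : R * R => (p.2 <= p.1)%R).
    exact: measurable_fun_ler.
  rewrite (_ : (fun p => _) = \1_((fun p : R * R => p.2 <= p.1) @^-1` [set true])).
    by apply: measurable_indic; rewrite -[X in measurable X]setTI; exact: mb.
  apply/funext => p; rewrite indicE (_ : (p \in _) = (p.2 <= p.1))//.
  by apply/idP/idP; rewrite inE.
have Fi : (mu2 R).-integrable setT (EFin \o F).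
  apply: (@intg_mul_bounded _ _ _ _ 1) => //; first exact: intg_tensor.
  by move=> p; case: (p.2 <= p.1); rewrite ?normr1 ?normr0.
have F1 x : \int[mu]_z F (x, z) = h x * \int[mu]_(z in `[a, x]) g z.
  rewrite /F /= /h patchE; case: ifPn => [|_]; last first.
    rewrite mul0r /Rintegral integral0_eq// => z _; by rewrite !mul0r.
  rewrite inE /= in_itv /= => /andP[ax xb].
  rewrite -(@Rintegral_itv_obnd_cbnd _ a (BRight x)); last exact: intg_itv.
  rewrite Rintegral_mkcond -RintegralZl//; last exact: intg_patch.
  apply: eq_Rintegral => z _; rewrite -mulrA; congr (_ * _).
  rewrite /G !patchE !mem_setE !in_itv /=.
  case: (ltP a z) => az /=; last by rewrite mul0r.
  case: (leP z x) => zx /=; last by rewrite mulr0.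
  by rewrite mulr1 (le_lt_trans zx xb).
have F2 z : \int[mu]_x F (x, z) = - (G z * ph z).
  rewrite /F /= /G patchE; case: ifPn => [|_]; last first.
    rewrite mul0r oppr0 /Rintegral integral0_eq// => x _; by rewrite mulr0 mul0r.
  rewrite inE /= in_itv /= => /andP[az zb].
  have -> : - (g z * ph z) = g z * (ph b - ph z) by rewrite pb; ring.
  rewrite -(@Rintegral_derive ph dph z b)//; last exact: ltW.
  rewrite -Rintegral_itv_bndo_bndc; last first.
    by apply: (intg_continuous_itv cdp); apply: subset_itvl; rewrite bnd_simp.
  rewrite Rintegral_mkcond -RintegralZl//; last first.
    rewrite (_ : _ \_ _ = h \_ `[z, b[%classic); first exact: intg_patch.
    apply/funext => x; rewrite /h !patchE !mem_setE !in_itv /=.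
    by case: (leP z x) => zx //=; rewrite (lt_le_trans az zx) /=; case: ifP.
  apply: eq_Rintegral => x _; rewrite -mulrA mulrC -mulrA; congr (_ * _).
  rewrite /h !patchE !mem_setE !in_itv /= mulrC.
  case: (leP z x) => zx /=; last by rewrite mulr0.
  by rewrite mulr1 (lt_le_trans az zx).
have E : \int[mu]_x (h x * \int[mu]_(z in `[a, x]) g z) =
         - \int[mu]_(x in `]a, b[) (g x * ph x).
  transitivity (\int[mu]_x \int[mu]_z F (x, z)).
    by apply: eq_Rintegral => x _; rewrite F1.
  rewrite -Rintegral12// Rintegral21//.
  transitivity (\int[mu]_z (- 1 * (G z * ph z))).
    by apply: eq_Rintegral => z _; rewrite F2 mulN1r.
  have EG : (fun z => G z * ph z) = (g \* ph) \_ `]a, b[%classic.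
    by apply/funext => z; rewrite /G !patchE; case: ifP; rewrite ?mul0r.
  rewrite RintegralZl//; last by rewrite EG; exact: intg_patch_mul_continuous.
  by rewrite mulN1r EG [in RHS]Rintegral_mkcond.
rewrite -E Rintegral_mkcond.
transitivity (\int[mu]_x (k * h x + h x * \int[mu]_(z in `[a, x]) g z)).
  apply: eq_Rintegral => x _; rewrite /h !patchE; case: ifP => _; last by rewrite mulr0 mul0r addr0.
  by rewrite mulrDl; congr (_ + _); exact: mulrC.
rewrite RintegralD//; last 2 first.
- exact: intg_scale.
- have := intg_fubini1 Fi; congr (mu.-integrable _ _).
  by apply/funext => x /=; rewrite F1.
rewrite RintegralZl// -Rintegral_mkcond.
have -> : \int[mu]_(x in `]a, b[) dph x = 0; last by rewrite mulr0 add0r.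
rewrite Rintegral_itv_bndo_bndc; last exact: mkcond_intg.
rewrite Rintegral_itv_obnd_cbnd; last first.
  by apply: (intg_continuous_itv cdp); apply: subset_itvr; rewrite bnd_simp.
by rewrite (Rintegral_derive (ltW ab) dp cdp) pa pb subrr.
Qed.

End absolutely_continuous.

Lemma Rintegral_patch d (X : measurableType d) (R : realType)
    (mu : {measure set X -> \bar R}) (D K : set X) (f : X -> R) :
  \int[mu]_(x in D) (f \_ K) x = \int[mu]_(x in D `&` K) f x.
Proof.
rewrite Rintegral_mkcond [RHS]Rintegral_mkcond; congr Rintegral.
by apply/funext => x; rewrite !patchE in_setI; case: (x \in D); case: (x \in K).
Qed.

(** * Absolutely continuous functions and H^1 of an interval *)

Section H1_line.
Context {R : realType}.
Local Notation mu := (@lebesgue_measure R).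
Implicit Types (a b x y c k : R) (w g u : R -> R).

(* acf w g: w is absolutely continuous on the whole line, with the density g. *)
Definition acf w g : Prop :=
  [/\ g \in Lfun mu 2%:E, mu.-integrable setT (EFin \o g) &
      forall x y, x <= y -> w y - w x = \int[mu]_(z in `[x, y]) g z].

(** Integrating from [-oo] treats the points on both sides of [a] alike; the value at [a] is
    adjusted afterwards by a constant. *)
Lemma primitive_exists g a k : mu.-integrable setT (EFin \o g) ->
  exists2 w, w a = k & forall x y, x <= y -> w y - w x = \int[mu]_(z in `[x, y]) g z.
Proof.
move=> gi; pose I x := \int[mu]_(z in `]-oo, x]) g z.
exists (fun x => k + (I x - I a)); first by rewrite subrr addr0.
move=> x y xy; rewrite -(@Rintegral_itv_obnd_cbnd _ x (BRight y)); last exact: intg_itv.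
by rewrite -(@Rintegral_itvB _ g -oo%O (BRight y) x) ?bnd_simp//;
  [rewrite -/(I x) -/(I y); ring|exact: intg_itv].
Qed.

Lemma primitive_continuous w g : mu.-integrable setT (EFin \o g) ->
  (forall x y, x <= y -> w y - w x = \int[mu]_(z in `[x, y]) g z) ->
  continuous w.
Proof.
move=> gi wg x.
have c1 : {within `[x - 1, x + 1], continuous w}.
  have : {within `[x - 1, x + 1], continuous (fun z => w (x - 1) + \int[mu]_(t in `[x - 1, z]) g t)}.
    move=> z; apply: cvgD; first exact: cvg_cst.
    apply: parameterized_integral_continuous; first by lra.
    exact: intg_itv.
  apply: subspace_eq_continuous => z /=; rewrite inE /= in_itv /= => /andP[xz _].
  by rewrite /from_subspace /= -wg//; ring.
have := @subset_itv_oo_cc _ _ (x - 1) (x + 1) => /continuous_subspaceW /(_ c1).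
rewrite continuous_open_subspace; last exact: interval_open.
by apply; rewrite inE /= in_itv /=; lra.
Qed.

Lemma acf_continuous w g : acf w g -> continuous w.
Proof. by case=> _; exact: primitive_continuous. Qed.

Lemma acf_cst k : acf (fun=> k) (fun=> 0).
Proof.
have i0 : mu.-integrable setT (EFin \o (fun=> 0 : R)) by exact: integrable0.
split=> [||x y xy] //.
  by apply/Lfun2P; split => //; rewrite (_ : (fun=> _) = (fun=> 0))// expr0n.
by rewrite subrr /Rintegral integral0.
Qed.

Lemma acf_add w1 g1 w2 g2 : acf w1 g1 -> acf w2 g2 ->
  acf (w1 \+ w2) (g1 \+ g2).
Proof.
move=> [l1 i1 e1] [l2 i2 e2]; split=> [||x y xy].
- exact: Lfun2_add.
- exact: intg_add.
- by rewrite RintegralD//; [rewrite -e1// -e2//=; ring|exact: intg_itv|exact: intg_itv].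
Qed.

Lemma acf_scale k w g : acf w g -> acf (fun x => k * w x) (fun x => k * g x).
Proof.
move=> [l1 i1 e1]; split=> [||x y xy].
- exact: Lfun2_scale.
- exact: intg_scale.
- by rewrite RintegralZl//; [rewrite -e1//; ring|exact: intg_itv].
Qed.

Lemma acf_affine s c w g : s * s = 1 -> acf w g ->
  acf (fun x => w (c + s * x)) (fun x => s * g (c + s * x)).
Proof.
move=> ss1 [/Lfun2P[mg l2] i1 e1].
have i' := integrable_affine c ss1 i1.
have m' : measurable_fun setT (fun x => g (c + s * x)) := intg_measurable i'.
split=> [||x y xy].
- apply/Lfun2P; split; first exact: measurable_funM.
  under eq_fun do rewrite exprMn expr2 ss1 mul1r.
  exact: (@integrable_affine _ s c (fun x => g x ^+ 2)).
- exact: intg_scale.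
rewrite RintegralZl//; last exact: intg_itv.
case: (sqr1_cases ss1) => se; rewrite se in i' m' *.
- rewrite mul1r !mul1r e1; last by rewrite lerD2l.
  rewrite Rintegral_mkcond -(@Rintegral_affine _ 1 c)//; last first.
  + exact: intg_patch.
  + by rewrite mulr1.
  rewrite [RHS]Rintegral_mkcond; apply: eq_Rintegral => z _.
  by rewrite !patchE !mem_setE !in_itv /= !mul1r !lerD2l.
- rewrite !mulN1r -[LHS]opprB e1; last by rewrite lerD2l lerN2.
  congr (- _); rewrite Rintegral_mkcond -(@Rintegral_affine _ (-1) c)//; last first.
  + exact: intg_patch.
  + by rewrite mulrNN mulr1.
  rewrite [RHS]Rintegral_mkcond; apply: eq_Rintegral => z _.
  by rewrite !patchE !mem_setE !in_itv /= !mulN1r !lerD2l !lerN2 andbC.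
Qed.

(** Stopping a function at [k] cuts its density off beyond [k]. Together with [acf_max] this is the
    source of all gluing and clamping. *)
Lemma acf_min k w g : acf w g ->
  acf (fun x => w (Num.min x k)) (g \_ `]-oo, k]%classic).
Proof.
move=> [l1 i1 e1]; split=> [||x y xy].
- rewrite patch_indic_mul; apply: (@Lfun2_mul_bounded _ _ _ _ 1) => //.
  exact: indic_le1.
- exact: intg_patch.
rewrite Rintegral_patch.
have [xk|kx] := leP x k; last first.
  rewrite min_r ?(le_trans (ltW kx))// subrr.
  rewrite (_ : _ `&` _ = set0) ?Rintegral_set0//.
  by apply/seteqP; split => z //=; rewrite !in_itv /=; lra.
rewrite e1 ?le_min ?xy//; congr Rintegral.
apply/seteqP; split => z //=; rewrite !in_itv /= ?le_min; lra.
Qed.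

Lemma acf_max k w g : acf w g ->
  acf (fun x => w (Num.max x k)) (g \_ `[k, +oo[%classic).
Proof.
move=> [l1 i1 e1]; split=> [||x y xy].
- rewrite patch_indic_mul; apply: (@Lfun2_mul_bounded _ _ _ _ 1) => //.
  exact: indic_le1.
- exact: intg_patch.
rewrite Rintegral_patch.
have [yk|ky] := leP k y; last first.
  rewrite max_r ?(le_trans xy) ?(ltW ky)// subrr.
  rewrite (_ : _ `&` _ = set0) ?Rintegral_set0//.
  by apply/seteqP; split => z //=; rewrite !in_itv /=; lra.
rewrite e1 ?ge_max ?xy//; congr Rintegral.
apply/seteqP; split => z //=; rewrite !in_itv /= ?ge_max; lra.
Qed.

Lemma acf_clamp al be : al <= be ->
  acf (fun x => Num.min (Num.max x al) be) (\1_(`[al, be]%classic)).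
Proof.
move=> ab; have fin : (mu `[al, be]%classic < +oo)%E.
  by rewrite lebesgue_measure_itv /=; case: ifP => // _; rewrite -EFinB ltry.
split=> [||x y xy]; [exact: Lfun2_indic|exact: intg_indic|].
rewrite /Rintegral integral_indic// (_ : _ `&` _ = `[Num.max x al, Num.min y be]%classic); last first.
  by apply/seteqP; split => z //=; rewrite !in_itv /= ?ge_max ?le_min; lra.
transitivity (fine (if Num.max x al < Num.min y be
    then (Num.min y be - Num.max x al)%:E else 0%E)); last first.
  apply: (congr1 fine); apply: esym.
  have := @lebesgue_measure_itv R `[Num.max x al, Num.min y be].
  by rewrite /= lte_fin -EFinB.
have [x1|x1] := leP x al; have [y1|y1] := leP y al; rewrite ?(min_l ab).
- by rewrite subrr; have [y2|y2] := leP y be; case: ltP => //=; lra.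
- by have [y2|y2] := leP y be; case: ltP => //=; lra.
- by lra.
- by have [y2|y2] := leP y be; have [x2|x2] := leP x be; case: ltP => //=; lra.
Qed.

Lemma test_fun1_out (D : set R) (ph : R -> R) x : test_fun1 D ph -> ~ D x -> ph x = 0.
Proof.
move=> [_ _ _ sub] nx; apply/eqP/negPn/negP => px; apply: nx; apply: sub.
exact: subset_closure.
Qed.

Lemma test_fun1_derive_out (D : set R) (ph : R -> R) x : test_fun1 D ph ->
  ~ D x -> derive1 ph x = 0.
Proof.
move=> [_ _ _ sub] nx; rewrite derive1E (@near_eq_derive _ _ _ ph (cst 0)) ?derive_cst//.
have : nbhs x (~` closure [set x | ph x != 0]).
  apply: open_nbhs_nbhs; split; last by move=> /sub.
  exact/closed_openC/closed_closure.
apply: filterS => y ny; apply/eqP/negPn/negP => py; apply: ny.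
exact: subset_closure.
Qed.

Lemma test_fun1_derive (D : set R) (ph : R -> R) x : test_fun1 D ph ->
  is_derive x 1 ph (derive1 ph x).
Proof. by case=> dph _ _ _; apply: DeriveDef; [exact: dph|rewrite derive1E]. Qed.

Lemma primitive_parts w g a b ph : a < b -> mu.-integrable setT (EFin \o g) ->
  (forall x y, x <= y -> w y - w x = \int[mu]_(z in `[x, y]) g z) ->
  test_fun1 `]a, b[ ph ->
  \int[mu]_(x in `]a, b[) (w x * derive1 ph x) =
  - \int[mu]_(x in `]a, b[) (g x * ph x).
Proof.
move=> ab gi wg tph.
have dp (z : R) := test_fun1_derive z tph.
have cdp : continuous (derive1 ph) by case: tph.
have pa : ph a = 0 by apply: (test_fun1_out tph); rewrite /= in_itv /= ltxx.
have pb : ph b = 0 by apply: (test_fun1_out tph); rewrite /= in_itv /= ltxx andbF.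
rewrite -(Rintegral_parts (w a) ab gi dp cdp pa pb).
apply: eq_Rintegral => x; rewrite inE /= in_itv /= => /andP[/ltW ax _].
by rewrite -wg//; congr (_ * _); ring.
Qed.

Lemma acf_weak_deriv w g a b : a < b -> acf w g -> weak_deriv `]a, b[ w g.
Proof.
move=> ab wg; have cw := acf_continuous wg; move: wg => [l1 i1 e1]; split.
- have [C wC] := continuous_bounded_itv a b cw.
  apply: (@L2_bounded _ _ _ _ C) => //; first exact: lebesgue_measure_itv_oo_lty.
    rewrite patch_indic_mul; apply: measurable_funM => //.
    exact: measurable_continuous.
  by move=> x xab; apply: wC; apply: subset_itv_oo_cc.
- rewrite /L2 patch_indic_mul; apply: (@Lfun2_mul_bounded _ _ _ _ 1) => //.
  exact: indic_le1.
by move=> ph; exact: primitive_parts.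
Qed.

Lemma acf_H1_interval w g a b : a < b -> acf w g -> H1_interval a b w.
Proof.
move=> ab wg; split; first exact: continuous_subspaceT (acf_continuous wg).
by exists g; exact: acf_weak_deriv.
Qed.

(** A difference at one point persists by continuity on an interval, which would be a null set of
    positive length. *)
Lemma ae_continuous_eq (f1 f2 : R -> R) a b : a < b -> {within `[a, b], continuous f1} ->
  {within `[a, b], continuous f2} ->
  {ae mu, forall x, x \in `]a, b[ -> f1 x = f2 x} ->
  forall x, x \in `[a, b] -> f1 x = f2 x.
Proof.
move=> ab c1 c2 [N [mN N0 sub]] x xab.
apply/eqP/negPn/negP => fx.
pose h z := f1 z - f2 z.
have ch : {within `[a, b], continuous h} by move=> z; apply: cvgB; [exact: c1|exact: c2].
have hx0 : 0 < `|h x| by rewrite normr_gt0 subr_eq0.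
have := (@subspace_continuousP _ `[a, b]%classic _ h).1 ch.
move=> /(_ x xab) /cvgrPdist_lt /(_ _ hx0).
rewrite near_withinE => /nbhs_ballP[d /= d0 dH].
(* The point [x] may be an endpoint of the interval, so the ball around it is trimmed to [a] and
   [b]; a nondegenerate interval always remains. *)
pose l := Num.max a (x - d); pose r := Num.min b (x + d).
have lr : l < r by move: xab; rewrite in_itv /= /l /r gt_max !lt_min; lra.
have lrN : `]l, r[%classic `<=` N.
  move=> z /=; rewrite in_itv /= /l /r gt_max lt_min => /andP[/andP[az xz] /andP[zb zd]].
  apply: sub => /=; rewrite in_itv /= az zb => /(_ isT) e.
  have := dH z; rewrite /ball /= ltr_norml in_itv /= /h e subrr subr0 ltxx.
  by move=> H; suff : false by []; apply: H; lra.
have : (mu `]l, r[%classic <= mu N)%E by apply: le_measure; rewrite ?inE.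
by rewrite N0 lebesgue_measure_itv /= lte_fin lr -EFinD lee_fin; lra.
Qed.

(** By [primitive_parts], [u] minus a primitive of [g] has zero weak derivative, so it is constant
    by [dubois_reymond]. Integrability is assumed rather than membership in L2, since the averages
    in [box_lemma] are only known to be integrable. *)
Lemma weak_deriv_primitive u g a b : a < b ->
  mu.-integrable setT (EFin \o u) -> mu.-integrable setT (EFin \o g) ->
  (forall ps, test_fun1 `]a, b[ ps ->
    \int[mu]_x (u x * derive1 ps x) = - \int[mu]_x (g x * ps x)) ->
  exists w, [/\ continuous w,
    forall x y, x <= y -> w y - w x = \int[mu]_(z in `[x, y]) g z &
    {ae mu, forall x, x \in `]a, b[ -> u x = w x}].
Proof.
move=> ab ui gi wd.
have [w _ wg] := primitive_exists a 0 gi.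
have cw := primitive_continuous gi wg.
pose wab := w \_ `]a, b[%classic.
have wabi : mu.-integrable setT (EFin \o wab).
  by apply: intg_mkcond => //; apply: (intg_continuous_itv cw); exact: subset_itv_oo_cc.
have [|ps tps|c cE] := @dubois_reymond _ (u \- wab) a b ab; first exact: intg_sub.
  have [_ cdps _ _] := tps.
  have out x : x \notin `]a, b[%classic -> ps x = 0 /\ derive1 ps x = 0.
    rewrite notin_setE => nx; split; first exact: test_fun1_out tps nx.
    exact: test_fun1_derive_out tps nx.
  have udi : mu.-integrable setT (EFin \o (fun x => u x * derive1 ps x)).
    have := intg_patch_mul_continuous a b ui cdps; congr (mu.-integrable _ _).
    apply/funext => x /=; rewrite patchE; case: ifPn => // /out[_ ->].
    by rewrite mulr0.
  have wdi : mu.-integrable setT (EFin \o (fun x => wab x * derive1 ps x)).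
    have := intg_patch_mul_continuous a b wabi cdps; congr (mu.-integrable _ _).
    apply/funext => x /=; rewrite patchE; case: ifPn => // /out[_ ->].
    by rewrite mulr0.
  transitivity (\int[mu]_x (u x * derive1 ps x) - \int[mu]_x (wab x * derive1 ps x)).
    by rewrite -RintegralB//; apply: eq_Rintegral => x _; rewrite mulrBl.
  rewrite (wd _ tps) [X in _ - X](_ : _ = \int[mu]_(x in `]a, b[) (w x * derive1 ps x)).
    rewrite (primitive_parts ab gi wg tps) opprK addrC; apply/eqP.
    rewrite subr_eq0 [X in X == _]Rintegral_mkcond; apply/eqP/eq_Rintegral => x _.
    by rewrite patchE; case: ifPn => // /out[-> _]; rewrite mulr0.
  rewrite [RHS]Rintegral_mkcond; apply: eq_Rintegral => x _.
  by rewrite /wab !patchE; case: ifP => // _; rewrite mul0r.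
exists (fun x => w x + c); split.
- by move=> x; apply: cvgD; [exact: cw|exact: cvg_cst].
- by move=> x y xy; rewrite -wg//; ring.
- move: cE => /ae_imply; apply => x /[swap] xab /(_ xab) /=.
  by rewrite /wab patchE mem_setE xab => <-; ring.
Qed.

Lemma weak_deriv_acf u du a b : a < b -> {within `[a, b], continuous u} ->
  weak_deriv `]a, b[ u du ->
  exists2 w, acf w (du \_ `]a, b[%classic) & forall x, x \in `[a, b] -> w x = u x.
Proof.
move=> ab cu [l2u l2d wd].
have fin := lebesgue_measure_itv_oo_lty a b.
have ui : mu.-integrable setT (EFin \o (u \_ `]a, b[%classic)) by exact: L2_intg.
have gi : mu.-integrable setT (EFin \o (du \_ `]a, b[%classic)) by exact: L2_intg.
have patchM (f ph : R -> R) :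
    (fun x => (f \_ `]a, b[%classic) x * ph x) = (f \* ph) \_ `]a, b[%classic.
  by apply/funext => x; rewrite !patchE; case: ifP => _ //; rewrite mul0r.
have [ps tps|w [cw wg uw]] := weak_deriv_primitive ab ui gi.
  by have := wd _ tps; rewrite [in LHS]Rintegral_mkcond [in RHS]Rintegral_mkcond !patchM.
exists w; first by split.
move=> x xab; apply/esym; apply: (ae_continuous_eq ab cu _ _ xab).
  exact: continuous_subspaceT.
move: uw => /ae_imply; apply => z /[swap] zab /(_ zab).
by rewrite patchE mem_setE zab.
Qed.

Lemma H1_interval_acf u a b : a < b -> H1_interval a b u ->
  exists w g, acf w g /\ forall x, x \in `[a, b] -> w x = u x.
Proof.
move=> ab [cu [du wd]]; have [w wg wu] := weak_deriv_acf ab cu wd.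
by exists w, (du \_ `]a, b[%classic).
Qed.

End H1_line.

Lemma ae_Rintegral d (X : measurableType d) (R : realType)
    (mu : {measure set X -> \bar R}) (f g : X -> R) :
  measurable_fun setT f -> measurable_fun setT g ->
  {ae mu, forall x, f x = g x} -> \int[mu]_x f x = \int[mu]_x g x.
Proof.
move=> mf mg fg; rewrite /Rintegral; congr fine; apply: ae_eq_integral => //.
- exact/measurable_EFinP.
- exact/measurable_EFinP.
- by move: fg; apply: filterS => x -> _.
Qed.

(** Tonelli's theorem for the absolute value of [D]: its iterated integral is zero, hence so is its
    integral over the product. *)
Lemma ae_sections d1 d2 (X : measurableType d1) (Y : measurableType d2)
    (R : realType) (m1 : {sigma_finite_measure set X -> \bar R})
    (m2 : {sigma_finite_measure set Y -> \bar R}) (D : X * Y -> R) :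
  measurable_fun setT D ->
  {ae m2, forall y, {ae m1, forall x, D (x, y) = 0}} ->
  {ae (m1 \x m2)%E, forall p, D p = 0}.
Proof.
move=> mD D0.
have mDE : measurable_fun setT (fun p => `|(D p)%:E|)%E.
  by apply: measurableT_comp => //; exact/measurable_EFinP.
have H0 : (\int[m1 \x m2]_p `|(D p)%:E| = 0)%E.
  rewrite (fubini_tonelli2 (fun p => `|(D p)%:E|)%E)// (ae_eq_integral (cst 0%E))//.
  - by rewrite integral0.
  - exact: (measurable_fun_fubini_tonelli_G (fun p => `|(D p)%:E|)%E).
  move: D0 => /ae_imply; apply => y Hy _.
  rewrite /fubini_G (ae_eq_integral (cst 0%E))//.
  - by rewrite integral0.
  - exact: (measurableT_comp mDE (measurable_pair2 y)).
  by move: Hy => /ae_imply; apply => x -> _; rewrite abse0.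
have mDE' : measurable_fun setT (EFin \o D) by exact/measurable_EFinP.
have /ae_imply := (ae_eq_integral_abs (m1 \x m2)%E measurableT mDE').1 H0.
by apply => p /(_ I) /= [].
Qed.

(** * Transport along characteristics *)

Section box_lemma.
Context {R : realType}.
Local Notation mu := (@lebesgue_measure R).

Lemma test_fun1_continuous (D : set R) (ps : R -> R) : test_fun1 D ps -> continuous ps.
Proof.
by case=> dps _ _ _ x; apply/differentiable_continuous/derivable1_diffP.
Qed.

Lemma test_fun1_bounded a b (ps : R -> R) : test_fun1 `]a, b[ ps ->
  exists C, forall x, `|ps x| <= C /\ `|derive1 ps x| <= C.
Proof.
move=> tps; have cps := test_fun1_continuous tps; have [_ cdps _ _] := tps.
have [C1 H1] := continuous_bounded_itv a b cps.
have [C2 H2] := continuous_bounded_itv a b cdps.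
exists (`|C1| + `|C2|) => x.
have [xab|xab] := boolP (x \in `]a, b[).
  have xab' : x \in `[a, b] by apply: subset_itv_oo_cc.
  have := H1 x xab'; have := H2 x xab'; have := ler_norm C1; have := ler_norm C2.
  by have := normr_ge0 C1; have := normr_ge0 C2; lra.
have nx : ~ `]a, b[%classic x by apply/negP.
by rewrite (test_fun1_out tps nx) (test_fun1_derive_out tps nx) normr0 addr_ge0.
Qed.

Lemma intg_slice (K : R * R -> R) (ph : R -> R) (C : R) :
  (mu2 R).-integrable setT (EFin \o K) ->
  measurable_fun setT ph -> (forall t, `|ph t| <= C) ->
  mu.-integrable setT (EFin \o (fun s : R => \int[mu]_t (K (t, s) * ph t))).
Proof.
move=> Ki mph phC.
pose K1 p := K p * ph p.1.
have K1i : (mu2 R).-integrable setT (EFin \o K1).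
  by apply: (@intg_mul_bounded _ _ _ _ C) => //; exact: measurableT_comp.
exact: (intg_fubini2 K1i).
Qed.

Lemma Rintegral_slice (K : R * R -> R) (ph P : R -> R) (C1 C2 : R) :
  (mu2 R).-integrable setT (EFin \o K) ->
  measurable_fun setT ph -> (forall t, `|ph t| <= C1) ->
  measurable_fun setT P -> (forall t, `|P t| <= C2) ->
  \int[mu2 R]_p (K p * (P p.2 * ph p.1)) =
  \int[mu]_s ((\int[mu]_t (K (t, s) * ph t)) * P s).
Proof.
move=> Ki mph phC mP PC.
pose K1 p := K p * ph p.1.
have K1i : (mu2 R).-integrable setT (EFin \o K1).
  by apply: (@intg_mul_bounded _ _ _ _ C1) => //; exact: measurableT_comp.
pose K2 p := K1 p * P p.2.
have K2i : (mu2 R).-integrable setT (EFin \o K2).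
  by apply: (@intg_mul_bounded _ _ _ _ C2) => //; exact: measurableT_comp.
transitivity (\int[mu2 R]_p K2 p).
  by apply: eq_Rintegral => p _; rewrite /K2 /K1; ring.
rewrite Rintegral21//; apply: ae_Rintegral.
- exact: intg_measurable (intg_fubini2 K2i).
- by apply: measurable_funM => //; exact: intg_measurable (intg_fubini2 K1i).
move: (ae_integrable2 K1i) => /ae_imply; apply => s K1s.
by rewrite /K2 /K1 /= RintegralZr.
Qed.

(* H_t = 0 and H_s = G weakly: averaging H in t against a bump of integral 1
   gives a function of s equal to H almost everywhere, with density the same
   average of G, hence continuous. *)
Lemma box_lemma (H G : R * R -> R) (t1 t2 s1 s2 : R) : t1 < t2 -> s1 < s2 ->
  (mu2 R).-integrable setT (EFin \o H) -> (mu2 R).-integrable setT (EFin \o G) ->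
  (forall P Q, test_fun1 `]s1, s2[ P -> test_fun1 `]t1, t2[ Q ->
    \int[mu2 R]_p (H p * (P p.2 * derive1 Q p.1)) = 0) ->
  (forall P Q, test_fun1 `]s1, s2[ P -> test_fun1 `]t1, t2[ Q ->
    \int[mu2 R]_p (H p * (derive1 P p.2 * Q p.1)) =
    - \int[mu2 R]_p (G p * (P p.2 * Q p.1))) ->
  exists2 c : R -> R, continuous c &
  {ae mu2 R, forall p, p.1 \in `]t1, t2[ -> p.2 \in `]s1, s2[ -> H p = c p.2}.
Proof.
move=> t12 s12 Hi Gi h1 h2.
(* The middle third leaves a margin on both sides, so that the averaging bump has compact support in
   the open time interval. *)
pose al := t1 + (t2 - t1) / 3; pose be := t2 - (t2 - t1) / 3.
have [al1 albe be2] : [/\ t1 < al, al < be & be < t2] by rewrite /al /be; split; lra.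
pose q0 := bump al be 1.
have tq0 : test_fun1 `]t1, t2[ q0 by exact: test_fun1_bump.
have bmp (p q : R) n x : p < q -> `|bump p q n x| <= 1.
  by move=> pq; have /andP[? ?] := bump_itv n x pq; rewrite ger0_norm.
have mbmp (p q : R) n : measurable_fun setT (bump p q n).
  by apply: measurable_continuous; exact: continuous_bump.
have bmp0 (p q : R) n x : p < q -> ~ (p <= x <= q) -> bump p q n x = 0.
  by move=> pq nx; apply: bump_out => //; lra.
have bmpi (p q : R) n : p < q -> mu.-integrable setT (EFin \o bump p q n).
  move=> pq; apply: (@intg_continuous_support _ _ p q).
    exact: continuous_bump.
  by move=> x; exact: bmp0.
have I0 : 0 < \int[mu]_t q0 t := Rintegral_bump_gt0 0 albe.
pose m s := \int[mu]_t (H (t, s) * q0 t).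
pose n s := \int[mu]_t (G (t, s) * q0 t).
have mi : mu.-integrable setT (EFin \o m) .
  by apply: (@intg_slice _ q0 1) => //; [exact: mbmp|move=> t; exact: bmp].
have ni : mu.-integrable setT (EFin \o n) .
  by apply: (@intg_slice _ q0 1) => //; [exact: mbmp|move=> t; exact: bmp].
have [P tP|w [cw _ mw]] := weak_deriv_primitive s12 mi ni.
  have [C PC] := test_fun1_bounded tP; have [_ cdP _ _] := tP.
  have cP := test_fun1_continuous tP.
  rewrite -(@Rintegral_slice H q0 (derive1 P) 1 C)//; last 4 first.
  - exact: mbmp.
  - by move=> t; exact: bmp.
  - exact: measurable_continuous.
  - by move=> t; case: (PC t).
  rewrite -(@Rintegral_slice G q0 P 1 C)//; last 4 first.
  - exact: mbmp.
  - by move=> t; exact: bmp.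
  - exact: measurable_continuous.
  - by move=> t; case: (PC t).
  exact: h2.
(* The bump [q0] is not normalized, so its integral is divided out here. *)
pose c s := w s / \int[mu]_t q0 t.
exists c; first by move=> s; apply: cvgM; [exact: cw|exact: cvg_cst].
(* The multiple of [q0] makes the integral zero, so [th] is the derivative of a test function [Q] in
   time, and [h1] says that almost every slice of [H] is orthogonal to [th]. *)
pose th (p q : R) N t := bump p q N t - (\int[mu]_t bump p q N t / \int[mu]_t q0 t) * q0 t.
have fth (p q : rat) N : t1 < ratr p -> ratr p < ratr q :> R -> ratr q < t2 ->
    {ae mu, forall s, s \in `]s1, s2[ ->
       \int[mu]_t (H (t, s) * th (ratr p) (ratr q) N t) = 0}.
  move=> tp pq qt.
  have [|||||Q tQ QE] := @test_fun1_primitive _ (th (ratr p) (ratr q) N) t1 t2 (Num.min al (ratr p)) (Num.max be (ratr q)).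
  - by rewrite lt_min al1.
  - by rewrite gt_max be2.
  - move=> x; apply: cvgB; first exact: continuous_bump.
    by apply: cvgM; [exact: cvg_cst|exact: continuous_bump].
  - move=> x nx; rewrite /th /q0 !bmp0 ?mulr0 ?subr0// => /andP[g1 g2]; apply: nx;
      by rewrite ge_min le_max g1 g2 ?orbT.
  - rewrite /th RintegralB//; [|exact: bmpi|exact/intg_scale/bmpi].
    by rewrite RintegralZl ?divfK ?subrr ?gt_eqF//; exact: bmpi.
  have [C QC] := test_fun1_bounded tQ; have [_ cdQ _ _] := tQ.
  rewrite QE in cdQ QC; have mth := measurable_continuous cdQ.
  have thC t : `|th (ratr p) (ratr q) N t| <= C by case: (QC t).
  apply: bump_test_zero.
    exact: (intg_slice Hi mth thC).
  move=> p' q' N' sp pq' qs.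
  rewrite -(@Rintegral_slice H _ _ C 1)//; last by move=> t; exact: bmp.
  by rewrite -QE h1//; exact: test_fun1_bump.
have good : {ae mu, forall s, s \in `]s1, s2[ -> {ae mu, forall t, t \in `]t1, t2[ -> H (t, s) = c s}}.
  (* Exchange of quantifiers: one null set of [s] serves all the tests at once, as they are indexed
     by two rationals and an integer. *)
  have aeth : {ae mu, forall s, forall pqN : rat * rat * nat,
      t1 < ratr pqN.1.1 -> ratr pqN.1.1 < ratr pqN.1.2 :> R -> ratr pqN.1.2 < t2 ->
      s \in `]s1, s2[ -> \int[mu]_t (H (t, s) * th (ratr pqN.1.1) (ratr pqN.1.2) pqN.2 t) = 0}.
    apply: ae_countable => -[[p q] N] /=.
    have [tp|?] := ltP t1 (ratr p); last exact: aeW.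
    have [pq|?] := ltP (ratr p : R) (ratr q); last exact: aeW.
    have [qt|?] := ltP (ratr q) t2; last exact: aeW.
    by move: (fth p q N tp pq qt) => /ae_imply; apply.
  apply: (ae_imply2 (ae_integrable2 Hi) (ae_imply2 aeth mw (fun s A B => conj A B))).
  move=> s /= Hs [As Bs] ss.
  have Hs' : mu.-integrable setT (EFin \o (fun t => H (t, s))) by exact: Hs.
  have Hbi (p q : R) N : p < q -> mu.-integrable setT (EFin \o (fun t => H (t, s) * bump p q N t)).
    move=> pq; apply: (@intg_mul_bounded _ _ _ _ 1) => //.
    - exact: mbmp.
    - by move=> x; exact: bmp.
  have : {ae mu, forall t, t \in `]t1, t2[ -> H (t, s) - c s * \1_(`]t1, t2[%classic) t = 0}.
    apply: bump_test_zero.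
      apply: intg_sub => //; apply: intg_scale; apply: intg_indic => //.
      exact: lebesgue_measure_itv_oo_lty.
    move=> p q N tp pq qt.
    have := As ((p, q), N) tp pq qt ss; rewrite /th /=.
    set k := (_ / _) => E.
    have E2 : \int[mu]_t (H (t, s) * bump (ratr p) (ratr q) N t) - k * m s = 0.
      rewrite -[RHS]E /m -RintegralZl//; last exact: Hbi.
      rewrite -RintegralB//; [|exact: Hbi|exact/intg_scale/Hbi].
      by apply: eq_Rintegral => x _; ring.
    rewrite -[RHS]E2 (Bs ss) (_ : k * w s = c s * \int[mu]_t bump (ratr p) (ratr q) N t); last first.
      by rewrite /k /c; ring.
    rewrite -RintegralZl//; last exact: bmpi.
    rewrite -RintegralB//; [|exact: Hbi|exact/intg_scale/bmpi].
    apply: eq_Rintegral => x _; rewrite mulrBl; congr (_ - _).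
    rewrite indicE mem_setE; case: (boolP (x \in _)) => [_|]; first by rewrite mulr1.
    rewrite in_itv /= => nx; rewrite bmp0 ?mulr0// => pxq; move/negP : nx; apply; lra.
  move=> /ae_imply; apply => t /[swap] tt /(_ tt).
  by rewrite indicE mem_setE tt mulr1 => /eqP; rewrite subr_eq0 => /eqP.
have mc : measurable_fun setT c.
  by apply: measurable_continuous => s; apply: cvgM; [exact: cw|exact: cvg_cst].
pose B : set (R * R) := `]t1, t2[%classic `*` `]s1, s2[%classic.
have mB : measurable B by exact: measurableX.
pose D p := (H p - c p.2) * \1_B p.
have mD : measurable_fun setT D.
  apply: measurable_funM => //; apply: measurable_funB.
    exact: (intg_measurable Hi).
  exact: (measurableT_comp mc measurable_snd).
have D0 : {ae mu, forall s, {ae mu, forall t, D (t, s) = 0}}.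
  move: good => /ae_imply; apply => s Hs.
  have [ss|ns] := boolP (s \in `]s1, s2[); last first.
    apply: aeW => t; rewrite /D indicE memNset ?mulr0//.
    by move=> -[_ /=]; exact/negP.
  move: (Hs ss) => /ae_imply; apply => t Ht; rewrite /D indicE.
  have [tt|nt] := boolP (t \in `]t1, t2[); last first.
    by rewrite memNset ?mulr0// => -[/= tt _]; move/negP : nt.
  by rewrite Ht// subrr mul0r.
have /ae_imply := @ae_sections _ _ _ _ _ mu mu D mD D0; apply => p + pt ps.
by rewrite /D indicE mem_set// mulr1 => /eqP; rewrite subr_eq0 => /eqP.
Qed.

End box_lemma.

(** * Test functions of two variables *)

Section plane_derivatives.
Context {R : realType}.
Implicit Types (f ph : R * R -> R) (p : R * R) (D : set (R * R)).

Lemma pair_shift (h a b : R) p :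
  h *: ((a, b) : R * R) + p = (h * a + p.1, h * b + p.2).
Proof. by case: p. Qed.

Lemma dt_slice f p : dt f p = derive1 (fun t => f (t, p.2)) p.1.
Proof.
rewrite /dt /derive /derive1; set d := (fun _ : R => _).
set d' := (fun _ : R => _); suff -> : d = d' by [].
apply/funext => h; rewrite /d /d' /= pair_shift mulr1 mulr0 add0r.
by rewrite -surjective_pairing.
Qed.

Lemma dx_slice f p : dx f p = derive1 (fun x => f (p.1, x)) p.2.
Proof.
rewrite /dx /derive /derive1; set d := (fun _ : R => _).
set d' := (fun _ : R => _); suff -> : d = d' by [].
apply/funext => h; rewrite /d /d' /= pair_shift mulr1 mulr0 add0r.
by rewrite -surjective_pairing.
Qed.

Lemma is_derive_slice_t f t x : differentiable f (t, x) ->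
  is_derive t 1 (fun t => f (t, x)) (dt f (t, x)).
Proof.
move=> df; have := @diff_derivable _ _ _ f (t, x) (1, 0) df.
rewrite /derivable => H; apply: DeriveDef; last by rewrite -derive1E dt_slice.
move: H; rewrite /derivable; set d := (fun _ : R => _).
set d' := (fun _ : R => _); suff -> : d = d' by [].
by apply/funext => h; rewrite /d /d' /= pair_shift /= mulr1 mulr0 add0r [h%:A]mulr1.
Qed.

Lemma is_derive_slice_x f t x : differentiable f (t, x) ->
  is_derive x 1 (fun x => f (t, x)) (dx f (t, x)).
Proof.
move=> df; have := @diff_derivable _ _ _ f (t, x) (0, 1) df.
rewrite /derivable => H; apply: DeriveDef; last by rewrite -derive1E dx_slice.
move: H; rewrite /derivable; set d := (fun _ : R => _).
set d' := (fun _ : R => _); suff -> : d = d' by [].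
by apply/funext => h; rewrite /d /d' /= pair_shift /= mulr1 mulr0 add0r [h%:A]mulr1.
Qed.

Lemma test_fun2_out D ph p : test_fun2 D ph -> ~ D p -> ph p = 0.
Proof.
move=> [_ _ _ _ sub] nx; apply/eqP/negPn/negP => px; apply: nx; apply: sub.
exact: subset_closure.
Qed.

Lemma continuous_pair_l (x : R) : continuous (fun t : R => (t, x)).
Proof. by move=> t; exact: (cvg_pair cvg_id (cvg_cst _)). Qed.

Lemma continuous_pair_r (t : R) : continuous (fun x : R => (t, x)).
Proof. by move=> z; exact: (cvg_pair (cvg_cst _) cvg_id). Qed.

Lemma test_fun2_continuous D ph : test_fun2 D ph -> continuous ph.
Proof. by case=> dph _ _ _ _ p; exact: differentiable_continuous. Qed.

Lemma continuous_bounded_compact (f : R * R -> R) (K : set (R * R)) :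
  compact K -> continuous f -> exists C, forall p, K p -> `|f p| <= C.
Proof.
move=> cK cf.
have cn : {within K, continuous f} by exact: continuous_subspaceT.
have [M [_ HM]] := compact_bounded (continuous_compact cn cK).
exists (M + 1) => p Kp; apply: (HM (M + 1)); first by rewrite ltrDl.
by exists p.
Qed.

Lemma dt_out D ph p : test_fun2 D ph -> ~ D p -> dt ph p = 0 /\ dx ph p = 0.
Proof.
move=> [_ _ _ _ sub] nx.
have nb : \near p, ph p = (cst 0 : R * R -> R) p.
  have : nbhs p (~` closure [set p | ph p != 0]).
    apply: open_nbhs_nbhs; split; last by move=> /sub.
    exact/closed_openC/closed_closure.
  apply: filterS => y ny; apply/eqP/negPn/negP => py; apply: ny.
  exact: subset_closure.
by rewrite /dt /dx !(near_eq_derive _ nb) !derive_cst.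
Qed.

Lemma test_fun2_bounded D ph : test_fun2 D ph ->
  exists C, forall p, [/\ `|ph p| <= C, `|dt ph p| <= C & `|dx ph p| <= C].
Proof.
move=> tph; have cph := test_fun2_continuous tph; have [dph cdt cdx cK sub] := tph.
have tph' : test_fun2 (closure [set p | ph p != 0]) ph.
  by split; [exact: dph|exact: cdt|exact: cdx|exact: cK|exact: subset_refl].
have [C1 H1] := continuous_bounded_compact cK cph.
have [C2 H2] := continuous_bounded_compact cK cdt.
have [C3 H3] := continuous_bounded_compact cK cdx.
pose M := Num.max C1 (Num.max C2 (Num.max C3 0)).
have [M1 M2 M3 M0] : [/\ C1 <= M, C2 <= M, C3 <= M & 0 <= M].
  by rewrite /M !le_max !lexx !orbT.
exists M => p; have [Kp|nKp] := pselect (closure [set p | ph p != 0] p).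
  split; [exact: le_trans (H1 p Kp) M1|exact: le_trans (H2 p Kp) M2|].
  exact: le_trans (H3 p Kp) M3.
have [dt0 dx0] := dt_out tph' nKp.
by rewrite dt0 dx0 (test_fun2_out tph' nKp) normr0.
Qed.

(** Links the topology of the plane with the product sigma-algebra: an open set is the union of the
    countably many rational boxes that it contains, the other boxes being replaced by the empty
    set. *)
Lemma open_measurable2 (A : set (R * R)) : open A -> measurable A.
Proof.
move=> oA.
pose box (q : rat * rat * rat * rat) : set (R * R) :=
  `]ratr q.1.1.1, ratr q.1.1.2[%classic `*` `]ratr q.1.2, ratr q.2[%classic.
pose B q := if `[< box q `<=` A >] then box q else set0.
rewrite (_ : A = \bigcup_q B q).
  apply: countable_bigcupT_measurable => [|q]; first exact: countableP.
  rewrite /B; case: ifP => // _; exact: measurableX.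
apply/seteqP; split => [[t x] Atx|p [q _]]; last first.
  by rewrite /B; case: asboolP => // qA /qA.
have : nbhs (t, x) A by apply: open_nbhs_nbhs; split.
case/nbhs_ballP => e e0 eA.
have [q1] := @rat_in_itvoo _ (t - e) t (ltac:(by rewrite ltrBlDr ltrDl)).
have [q2] := @rat_in_itvoo _ t (t + e) (ltac:(by rewrite ltrDl)).
have [q3] := @rat_in_itvoo _ (x - e) x (ltac:(by rewrite ltrBlDr ltrDl)).
have [q4] := @rat_in_itvoo _ x (x + e) (ltac:(by rewrite ltrDl)).
rewrite !in_itv /= => q4x q3x q2t q1t.
exists (q1, q2, q3, q4) => //; rewrite /B asboolT.
  by split => /=; rewrite in_itv /=; lra.
move=> [t' x'] [/=]; rewrite !in_itv /= => h1 h2; apply: eA.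
by split; rewrite /ball /= ltr_norml; lra.
Qed.

Lemma measurable_continuous2 f : continuous f -> measurable_fun setT f.
Proof.
move=> cf; apply: (measurability _ (RGenOpens.measurableE R)).
move=> _ [_ [a [b ->] <-]]; rewrite setTI; apply: open_measurable2.
by apply: open_comp => [p _|]; [exact: cf|exact: interval_open].
Qed.

Lemma differentiable_fst p : differentiable (fun p : R * R => p.1) p.
Proof. by apply: (@linear_differentiable _ _ _ fst) => q; exact: cvg_fst. Qed.

Lemma differentiable_snd p : differentiable (fun p : R * R => p.2) p.
Proof. by apply: (@linear_differentiable _ _ _ snd) => q; exact: cvg_snd. Qed.

(** A product test function in the sheared coordinates, pulled back to [(t, x)]. When [s * s = 1],
    the combination [dt ph - s * dx ph] loses the term with the derivative of [P], so the operator
    along the characteristics differentiates [Q] alone. *)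
Lemma test_fun2_characteristic D (P Q : R -> R) (s t1 t2 s1 s2 : R) :
  test_fun1 `]s1, s2[ P -> test_fun1 `]t1, t2[ Q ->
  (forall p, p.1 \in `]t1, t2[ -> p.1 + s * p.2 \in `]s1, s2[ -> D p) ->
  compact (closure D) ->
  let ph p := P (p.1 + s * p.2) * Q p.1 in
  [/\ test_fun2 D ph,
      forall p, dt ph p = derive1 P (p.1 + s * p.2) * Q p.1 +
                P (p.1 + s * p.2) * derive1 Q p.1 &
      forall p, dx ph p = s * (derive1 P (p.1 + s * p.2) * Q p.1)].
Proof.
move=> tP tQ sD cD ph.
have dP z := test_fun1_derive z tP; have dQ z := test_fun1_derive z tQ.
have [_ cdP cP sP] := tP; have [_ cdQ cQ sQ] := tQ.
have cPc := test_fun1_continuous tP; have cQc := test_fun1_continuous tQ.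
have dl p : differentiable (fun p : R * R => p.1 + s * p.2) p.
  apply: (@differentiableD _ _ _ (fun p : R * R => p.1) (fun p : R * R => s * p.2)).
    exact: differentiable_fst.
  exact: (@differentiableZ _ _ _ (fun p : R * R => p.2) s p (differentiable_snd p)).
have cl : continuous (fun p : R * R => p.1 + s * p.2).
  by move=> p; exact: differentiable_continuous.
have cfst : continuous (fun p : R * R => p.1).
  by move=> p; exact: cvg_fst.
have dph p : differentiable ph p.
  apply: differentiableM.
    apply: (@differentiable_comp _ _ _ _ (fun p : R * R => p.1 + s * p.2) P) => //.
    by apply/derivable1_diffP; case: (dP (p.1 + s * p.2)).
  apply: (@differentiable_comp _ _ _ _ (fun p : R * R => p.1) Q).
    exact: differentiable_fst.
  by apply/derivable1_diffP; case: (dQ p.1).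
have dtE p : dt ph p = derive1 P (p.1 + s * p.2) * Q p.1 +
                P (p.1 + s * p.2) * derive1 Q p.1.
  rewrite dt_slice /ph /= derive1E.
  have H1 : is_derive p.1 1 (fun t => P (t + s * p.2)) (derive1 P (p.1 + s * p.2)).
    have H0 : is_derive p.1 1 (fun t : R => t + s * p.2) 1.
      by apply: is_derive_eq; rewrite addr0.
    have := @is_derive1_comp _ P (fun t => t + s * p.2) p.1 _ _ (dP _) H0.
    by rewrite mulr1.
  have H2 := dQ p.1.
  have := @is_deriveM _ _ _ _ _ _ _ _ H1 H2 => -[_].
  by rewrite /GRing.scale /= => ->; ring.
have dxE p : dx ph p = s * (derive1 P (p.1 + s * p.2) * Q p.1).
  rewrite dx_slice /ph /= derive1E.
  have H1 : is_derive p.2 1 (fun x => P (p.1 + s * x)) (derive1 P (p.1 + s * p.2) * s).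
    apply: (@is_derive1_comp _ P (fun x => p.1 + s * x) p.2 _ _ (dP _)).
    apply: (@is_derive_quadratic _ _ _ _ 0) => h.
    by rewrite mul0r normr_le0; apply/eqP; ring.
  have := @is_deriveM _ _ _ _ _ _ _ _ H1 (is_derive_cst (Q p.1) p.2 1) => -[_].
  by rewrite /GRing.scale /= => ->; ring.
have sub : closure [set p | ph p != 0] `<=` D.
  (* The supports of [P] and [Q] pull back to closed sets along continuous maps; their intersection
     is therefore closed, contains the support of [ph] and lies in [D]. *)
  pose K : set (R * R) := (fun p => p.1) @^-1` closure [set x | Q x != 0] `&`
    (fun p => p.1 + s * p.2) @^-1` closure [set x | P x != 0].
  have cK : closed K.
    by apply: closedI; apply: preimage_closed => [p _|];
      (exact: cfst || exact: cl || exact: closed_closure).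
  apply: (@subset_trans _ K); last first.
    by move=> p [/sQ Qp /sP Pp]; exact: sD.
  rewrite [X in _ `<=` X](closure_id _).1//; apply: closure_subset => p /=.
  rewrite mulf_eq0 negb_or => /andP[Pp Qp].
  by split => /=; exact: subset_closure.
split => //; split => //.
- move=> p; rewrite (_ : dt ph = (fun p => derive1 P (p.1 + s * p.2) * Q p.1 + P (p.1 + s * p.2) * derive1 Q p.1)); last exact/funext.
  apply: cvgD; apply: cvgM.
  + by apply: (@continuous_comp _ _ _ (fun p : R * R => p.1 + s * p.2) (derive1 P)); [exact: cl|exact: cdP].
  + by apply: (@continuous_comp _ _ _ (fun p : R * R => p.1) Q); [exact: cfst|exact: cQc].
  + by apply: (@continuous_comp _ _ _ (fun p : R * R => p.1 + s * p.2) P); [exact: cl|exact: cPc].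
  + by apply: (@continuous_comp _ _ _ (fun p : R * R => p.1) (derive1 Q)); [exact: cfst|exact: cdQ].
- move=> p; rewrite (_ : dx ph = (fun p => s * (derive1 P (p.1 + s * p.2) * Q p.1))); last exact/funext.
  apply: cvgM; first exact: cvg_cst.
  apply: cvgM.
  + by apply: (@continuous_comp _ _ _ (fun p : R * R => p.1 + s * p.2) (derive1 P)); [exact: cl|exact: cdP].
  + by apply: (@continuous_comp _ _ _ (fun p : R * R => p.1) Q); [exact: cfst|exact: cQc].
- apply: subclosed_compact cD _; first exact: closed_closure.
  apply: closure_subset; exact: subset_trans (@subset_closure _ _) sub.
Qed.

End plane_derivatives.

(** * Weak derivatives in characteristic coordinates *)

Section characteristics.
Context {R : realType}.
Local Notation mu := (@lebesgue_measure R).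
Implicit Types (h ht hx : R * R -> R) (s : R).

Definition unshear s (p : R * R) : R * R := (p.1, - (s * p.1) + s * p.2).

Lemma shearK s : s * s = 1 -> cancel (shear s) (unshear s).
Proof.
move=> ss1 [t x]; congr pair => /=.
by rewrite mulrDr mulrA ss1 mul1r addKr.
Qed.

Lemma measurable_unshear s : measurable_fun setT (unshear s).
Proof.
apply/measurable_fun_pairP; split; first exact: measurable_fst.
apply: measurable_funD; last exact: measurable_funM.
by apply: measurable_funN; exact: measurable_funM.
Qed.

Lemma lebesgue_measure_unshear s (B : set (R * R)) : s * s = 1 -> measurable B ->
  mu2 R (unshear s @^-1` B) = mu2 R B.
Proof.
move=> ss1 mB.
rewrite /product_measure1 /=; apply: eq_integral => t _ /=.
by rewrite -[RHS](@lebesgue_measure_affine _ s (- (s * t)))//; last exact: measurable_xsection.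
Qed.

Lemma integrable_unshear s (f : R * R -> R) : s * s = 1 ->
  (mu2 R).-integrable setT (EFin \o f) ->
  (mu2 R).-integrable setT (EFin \o (f \o unshear s)).
Proof.
move=> ss1; apply: (integrable_preserving (mu := mu2 R) (measurable_unshear s)) => A mA.
exact: lebesgue_measure_unshear.
Qed.

Lemma rect_finite (a b c d : R) :
  (mu2 R (`]a, b[%classic `*` `]c, d[%classic) < +oo)%E.
Proof.
rewrite product_measure1E// lte_mul_pinfty//.
- rewrite ge0_fin_numE//; exact: lebesgue_measure_itv_oo_lty.
- exact: lebesgue_measure_itv_oo_lty.
Qed.

Lemma closed_rect (a b c d : R) : closed (`[a, b]%classic `*` `[c, d]%classic : set (R * R)).
Proof.
rewrite (_ : _ `*` _ = (fun p : R * R => p.1) @^-1` `[a, b]%classic `&`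
  (fun p => p.2) @^-1` `[c, d]%classic)//.
apply: closedI; apply: preimage_closed => [p _|].
- exact: cvg_fst.
- exact: interval_closed.
- exact: cvg_snd.
- exact: interval_closed.
Qed.

Lemma closure_rect_sub (a b c d : R) :
  closure (`]a, b[%classic `*` `]c, d[%classic : set (R * R)) `<=`
  `[a, b]%classic `*` `[c, d]%classic.
Proof.
rewrite [X in _ `<=` X](closure_id _).1; last exact: closed_rect.
by apply: closure_subset => p [/= h1 h2]; split; exact: subset_itv_oo_cc.
Qed.

Lemma compact_closure_rect (a b c d : R) :
  compact (closure (`]a, b[%classic `*` `]c, d[%classic : set (R * R))).
Proof.
apply: subclosed_compact (@closure_rect_sub a b c d); first exact: closed_closure.
by apply: compact_setX; exact: segment_compact.
Qed.

(* The image of ]0, T[ x ]a, b[ under (t, x) |-> (t, t + s x) is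
   {(t, z) | 0 < t < T, al < z - t < be}. *)
Lemma characteristic_box h ht hx (T a b al be s t1 t2 s1 s2 : R) :
  s * s = 1 -> (forall x, (s * x \in `]al, be[) = (x \in `]a, b[)) ->
  let D := (`]0, T[%classic `*` `]a, b[%classic : set (R * R)) in
  weak_grad D h ht hx ->
  {ae mu2 R, forall p, D p -> ht p = s * hx p} ->
  0 <= t1 -> t1 < t2 -> t2 <= T -> s1 < s2 -> al <= s1 - t2 -> s2 - t1 <= be ->
  exists2 c : R -> R, continuous c &
  {ae mu2 R, forall p, p.1 \in `]t1, t2[ -> p.2 \in `]s1, s2[ ->
     (h \_ D \o unshear s) p = c p.2}.
Proof.
move=> ss1 abs D [h2 ht2 hx2 wk] aeh t10 t12 t2T s12 als sbe.
have mD : measurable D by exact: measurableX.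
have fD : (mu2 R D < +oo)%E := rect_finite _ _ _ _.
have hi : (mu2 R).-integrable setT (EFin \o h \_ D) by exact: L2_intg.
have hti : (mu2 R).-integrable setT (EFin \o ht \_ D) by exact: L2_intg.
have hxi : (mu2 R).-integrable setT (EFin \o hx \_ D) by exact: L2_intg.
have Hi := integrable_unshear ss1 hi; have Gi := integrable_unshear ss1 hti.
have boxD p : p.1 \in `]t1, t2[ -> p.1 + s * p.2 \in `]s1, s2[ -> D p.
  rewrite !in_itv /= => ht1 hs1; split => /=; first by rewrite in_itv /=; lra.
  by have := abs p.2; rewrite !in_itv /= => <-; lra.
(* Change of variables by the shear: an integral against the unsheared function becomes one over
   [D], where the weak derivatives are known. *)
have trans (f : R * R -> R) (u : R * R -> R) (C : R) :
    (mu2 R).-integrable setT (EFin \o f \_ D) ->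
    measurable_fun setT u -> (forall p, `|u p| <= C) ->
    \int[mu2 R]_p ((f \_ D \o unshear s) p * u p) =
    \int[mu2 R]_(p in D) (f p * u (shear s p)).
  move=> fi mu' uC.
  have fi' := integrable_unshear ss1 fi.
  have fui : (mu2 R).-integrable setT (EFin \o (fun p => (f \_ D \o unshear s) p * u p)).
    by apply: (@intg_mul_bounded _ _ _ _ C).
  rewrite -(Rintegral_shear ss1 fui) [RHS]Rintegral_mkcond.
  apply: eq_Rintegral => p _; rewrite /= shearK// !patchE.
  by case: (p \in D) => //; rewrite mul0r.
have patchM (f u : R * R -> R) :
    \int[mu2 R]_(p in D) (f p * u p) = \int[mu2 R]_p ((f \_ D) p * u p).
  rewrite Rintegral_mkcond; apply: eq_Rintegral => p _; rewrite !patchE.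
  by case: (p \in D) => //; rewrite mul0r.
have intM (f u : R * R -> R) C : (mu2 R).-integrable setT (EFin \o f \_ D) ->
    continuous u -> (forall p, `|u p| <= C) ->
    (mu2 R).-integrable setT (EFin \o (fun p => (f \_ D) p * u p)).
  move=> fi cu uC; apply: (@intg_mul_bounded _ _ _ _ C) => //.
  exact: measurable_continuous2.
apply: (box_lemma t12 s12 Hi Gi) => P Q tP tQ;
  have [tph dtE dxE] := test_fun2_characteristic tP tQ boxD (@compact_closure_rect _ _ _ _);
  have [wt wx] := wk _ tph;
  have [C1 PC] := test_fun1_bounded tP; have [C2 QC] := test_fun1_bounded tQ;
  have [_ cdP _ _] := tP; have [_ cdQ _ _] := tQ;
  have cP := test_fun1_continuous tP; have cQ := test_fun1_continuous tQ.
all: have [PC1 PC2 QC1 QC2] : [/\ forall x, `|P x| <= C1, forall x, `|derive1 P x| <= C1,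
    forall x, `|Q x| <= C2 & forall x, `|derive1 Q x| <= C2]
  by split => x; move: (PC x) (QC x) => -[? ?] [? ?].
all: have bd (u v : R -> R) : (forall x, `|u x| <= C1) -> (forall x, `|v x| <= C2) ->
    forall p : R * R, `|u p.2 * v p.1| <= C1 * C2
  by move=> hu hv p; rewrite normrM ler_pM.
all: have ms (u v : R -> R) : continuous u -> continuous v ->
    measurable_fun setT (fun p : R * R => u p.2 * v p.1)
  by move=> cu cv; apply: measurable_funM; apply: measurableT_comp => //; exact: measurable_continuous.
all: set ph := (fun p => P (p.1 + s * p.2) * Q p.1) in tph dtE dxE wt wx.
all: have [C3 C3P] := test_fun2_bounded tph; have [_ cdt cdx _ _] := tph;
  have cph := test_fun2_continuous tph.
all: have [b1 b2 b3] : [/\ forall p, `|ph p| <= C3, forall p, `|dt ph p| <= C3 &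
  forall p, `|dx ph p| <= C3] by split => p; case: (C3P p).
(* The transport equation tested with [ph]; it is needed for both hypotheses of [box_lemma]. *)
all: have aeE : \int[mu2 R]_(p in D) (ht p * ph p) = s * \int[mu2 R]_(p in D) (hx p * ph p).
1,3: rewrite !patchM -RintegralZl//; last exact: intM b1.
1,2: apply: ae_Rintegral; [exact: intg_measurable (intM _ _ _ hti cph b1)
  |exact: intg_measurable (intg_scale s (intM _ _ _ hxi cph b1))|].
1,2: move: aeh => /ae_imply; apply => p hp; rewrite !patchE; case: ifPn;
  [rewrite inE => /hp ->; ring|by rewrite !mul0r mulr0].
- rewrite (trans h (fun p => P p.2 * derive1 Q p.1) (C1 * C2) hi (ms _ _ cP cdQ) (bd _ _ PC1 QC2)).
  (* As [s * s = 1], only [P] times the derivative of [Q] survives in [dt ph - s * dx ph]; the two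
     weak derivatives of [h] then cancel by [aeE]. *)
  transitivity (\int[mu2 R]_(p in D) (h p * dt ph p) - s * \int[mu2 R]_(p in D) (h p * dx ph p)).
    rewrite !patchM -RintegralZl//; last exact: intM b3.
    rewrite -RintegralB//; [|exact: intM b2|exact/intg_scale/(intM _ _ _ hi cdx b3)].
    apply: eq_Rintegral => p _; rewrite /= dtE dxE.
    rewrite [X in _ - X](_ : _ = s * s * (h \_ D) p * (derive1 P (p.1 + s * p.2) * Q p.1)); last by ring.
    by rewrite ss1; ring.
  by rewrite wt wx aeE; ring.
- rewrite (trans h (fun p => derive1 P p.2 * Q p.1) (C1 * C2) hi (ms _ _ cdP cQ) (bd _ _ PC2 QC1)).
  rewrite (trans ht (fun p => P p.2 * Q p.1) (C1 * C2) hti (ms _ _ cP cQ) (bd _ _ PC1 QC1)).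
  (* With [z = t + s * x], the derivative of [h] in [z] at fixed [t] is [s * hx], which is [ht] by
     the transport equation; hence [ht] serves as the density. *)
  transitivity (s * \int[mu2 R]_(p in D) (h p * dx ph p)).
    rewrite !patchM -RintegralZl//; last exact: intM b3.
    apply: eq_Rintegral => p _; rewrite /= dxE.
    rewrite [RHS](_ : _ = s * s * (h \_ D) p * (derive1 P (p.1 + s * p.2) * Q p.1)); last by ring.
    by rewrite ss1; ring.
  by rewrite wx mulrN -aeE.
Qed.

End characteristics.

(** * Weak gradients on rectangles *)

Section weak_gradients.
Context {R : realType}.
Local Notation mu := (@lebesgue_measure R).
Implicit Types (v vt vx : R * R -> R).

Lemma weak_grad_sub D D' v vt vx : measurable D' -> D' `<=` D ->
  weak_grad D v vt vx -> weak_grad D' v vt vx.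
Proof.
move=> mD sub [h1 h2 h3 h4]; split; [exact: L2_sub h1|exact: L2_sub h2|exact: L2_sub h3|].
move=> ph tph.
have tph' : test_fun2 D ph.
  by case: tph => a b c d e; split => //; exact: subset_trans sub.
have E (f u : R * R -> R) : (forall p, ~ D' p -> u p = 0) ->
    \int[mu2 R]_(p in D') (f p * u p) = \int[mu2 R]_(p in D) (f p * u p).
  move=> u0; rewrite [LHS]Rintegral_mkcond [RHS]Rintegral_mkcond.
  apply: eq_Rintegral => p _; rewrite !patchE.
  have [pD'|pD'] := boolP (p \in D').
    by rewrite mem_set//; apply: sub; rewrite inE in pD'.
  by case: ifP => // _; rewrite u0 ?mulr0//; rewrite notin_setE in pD'.
have [e1 e2] := h4 _ tph'.
have out p : ~ D' p -> [/\ ph p = 0, dt ph p = 0 & dx ph p = 0].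
  by move=> np; have [? ?] := dt_out tph np; split => //; exact: test_fun2_out np.
by split; rewrite !E//; move=> p /out[].
Qed.

Lemma weak_gradD D v vt vx w wt wx : measurable D -> (mu2 R D < +oo)%E ->
  weak_grad D v vt vx -> weak_grad D w wt wx ->
  weak_grad D (v \+ w) (vt \+ wt) (vx \+ wx).
Proof.
move=> mD fD [h1 h2 h3 h4] [k1 k2 k3 k4]; split; [exact: L2_add|exact: L2_add|exact: L2_add|].
move=> ph tph; have [C CP] := test_fun2_bounded tph; have [dph cdt cdx _ _] := tph.
have cph := test_fun2_continuous tph.
have E (f g u : R * R -> R) : L2 (mu2 R) D f -> L2 (mu2 R) D g -> continuous u ->
    (forall p, `|u p| <= C) ->
    \int[mu2 R]_(p in D) ((f \+ g) p * u p) =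
    \int[mu2 R]_(p in D) (f p * u p) + \int[mu2 R]_(p in D) (g p * u p).
  move=> f2 g2 cu uC.
  have iu (f' : R * R -> R) : L2 (mu2 R) D f' -> (mu2 R).-integrable D (EFin \o (fun p => f' p * u p)).
    move=> l2; apply: mkcond_intg => //.
    rewrite (_ : _ \_ _ = (f' \_ D) \* u).
      by apply: (@intg_mul_bounded _ _ _ _ C); [exact: L2_intg|exact: measurable_continuous2|].
    by apply/funext => p; rewrite /= !patchE; case: ifP; rewrite ?mul0r.
  rewrite -RintegralD//; [|exact: iu|exact: iu].
  by apply: eq_Rintegral => p _ /=; rewrite mulrDl.
have [e1 e2] := h4 _ tph; have [e3 e4] := k4 _ tph.
have [b1 b2 b3] : [/\ forall p, `|ph p| <= C, forall p, `|dt ph p| <= C &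
  forall p, `|dx ph p| <= C] by split => p; case: (CP p).
by split; rewrite !E// ?e1 ?e2 ?e3 ?e4 opprD.
Qed.

Lemma weak_gradZ D v vt vx k : measurable D -> (mu2 R D < +oo)%E ->
  weak_grad D v vt vx ->
  weak_grad D (fun p => k * v p) (fun p => k * vt p) (fun p => k * vx p).
Proof.
move=> mD fD [h1 h2 h3 h4]; split; [exact: L2_scale|exact: L2_scale|exact: L2_scale|].
move=> ph tph; have [C CP] := test_fun2_bounded tph; have [dph cdt cdx _ _] := tph.
have cph := test_fun2_continuous tph.
have E (f u : R * R -> R) : L2 (mu2 R) D f -> continuous u ->
    (forall p, `|u p| <= C) ->
    \int[mu2 R]_(p in D) (k * f p * u p) = k * \int[mu2 R]_(p in D) (f p * u p).
  move=> f2 cu uC.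
  rewrite -RintegralZl//; first by apply: eq_Rintegral => p _; rewrite mulrA.
  apply: mkcond_intg => //; rewrite (_ : _ \_ _ = (f \_ D) \* u).
    by apply: (@intg_mul_bounded _ _ _ _ C); [exact: L2_intg|exact: measurable_continuous2|].
  by apply/funext => p; rewrite /= !patchE; case: ifP; rewrite ?mul0r.
have [e1 e2] := h4 _ tph.
have [b1 b2 b3] : [/\ forall p, `|ph p| <= C, forall p, `|dt ph p| <= C &
  forall p, `|dx ph p| <= C] by split => p; case: (CP p).
by split; rewrite !E// ?e1 ?e2 mulrN.
Qed.

(* The easy half of the ACL characterization of Sobolev functions. *)
Lemma weak_grad_slices (T a b : R) v vt vx : 0 < T -> a < b ->
  let D := (`]0, T[%classic `*` `]a, b[%classic : set (R * R)) in
  L2 (mu2 R) D v -> L2 (mu2 R) D vt -> L2 (mu2 R) D vx ->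
  {ae mu, forall x, x \in `]a, b[ -> exists w g,
     [/\ mu.-integrable setT (EFin \o g),
         forall s t, s <= t -> w t - w s = \int[mu]_(z in `[s, t]) g z &
         forall t, t \in `]0, T[ -> v (t, x) = w t /\ vt (t, x) = g t]} ->
  {ae mu, forall t, t \in `]0, T[ -> exists w g,
     [/\ mu.-integrable setT (EFin \o g),
         forall s t, s <= t -> w t - w s = \int[mu]_(z in `[s, t]) g z &
         forall x, x \in `]a, b[ -> v (t, x) = w x /\ vx (t, x) = g x]} ->
  weak_grad D v vt vx.
Proof.
move=> T0 ab D v2 vt2 vx2 sx st; split => // ph tph.
have mD : measurable D by exact: measurableX.
have fD : (mu2 R D < +oo)%E := rect_finite _ _ _ _.
have [C CP] := test_fun2_bounded tph; have [dph cdt cdx _ _] := tph.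
have cph := test_fun2_continuous tph.
have [b1 b2 b3] : [/\ forall p, `|ph p| <= C, forall p, `|dt ph p| <= C &
  forall p, `|dx ph p| <= C] by split => p; case: (CP p).
have ii (f u : R * R -> R) : L2 (mu2 R) D f -> continuous u -> (forall p, `|u p| <= C) ->
    (mu2 R).-integrable setT (EFin \o ((f \_ D) \* u)).
  move=> f2 cu uC; apply: (@intg_mul_bounded _ _ _ _ C) => //; first exact: L2_intg.
  exact: measurable_continuous2.
have pE (f u : R * R -> R) : \int[mu2 R]_(p in D) (f p * u p) =
    \int[mu2 R]_p (((f \_ D) \* u) p).
  rewrite Rintegral_mkcond; apply: eq_Rintegral => p _; rewrite /= !patchE.
  by case: (p \in D) => //; rewrite mul0r.
have slx (f : R * R -> R) t x : x \in `]a, b[ ->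
    (f \_ D) (t, x) = ((fun t => f (t, x)) \_ `]0, T[%classic) t.
  move=> xab; rewrite !patchE; have [tT|tT] := boolP (t \in `]0, T[%classic).
    by rewrite mem_set//; split => //=; rewrite inE in tT.
  by rewrite memNset// => -[/= h _]; rewrite notin_setE in tT.
have slt (f : R * R -> R) t x : t \in `]0, T[ ->
    (f \_ D) (t, x) = ((fun x => f (t, x)) \_ `]a, b[%classic) x.
  move=> tT; rewrite !patchE; have [xab|xab] := boolP (x \in `]a, b[%classic).
    by rewrite mem_set//; split => //=; rewrite inE in xab.
  by rewrite memNset// => -[/= _ h]; rewrite notin_setE in xab.
have outx (f : R * R -> R) t x : x \notin `]a, b[ -> (f \_ D) (t, x) = 0.
  by move=> nx; rewrite patchE memNset// => -[/= _ h]; move/negP: nx; apply.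
have outt (f : R * R -> R) t x : t \notin `]0, T[ -> (f \_ D) (t, x) = 0.
  by move=> nx; rewrite patchE memNset// => -[/= h _]; move/negP: nx; apply.
rewrite !pE; split.
- have i1 := ii _ _ v2 cdt b2; have i2 := ii _ _ vt2 cph b1.
  rewrite Rintegral21// -[RHS]mulN1r Rintegral21// -RintegralZl//; last exact: (intg_fubini2 i2).
  apply: ae_Rintegral; [exact: intg_measurable (intg_fubini2 i1)
    |exact: intg_measurable (intg_scale (-1) (intg_fubini2 i2))|].
  move: sx => /ae_imply; apply => x xs; have [xab|xab] := boolP (x \in `]a, b[); last first.
    rewrite [X in X = _](_ : _ = 0) 1?[X in _ * X](_ : _ = 0) ?mulr0//.
      by rewrite /Rintegral integral0_eq// => t _; rewrite /= outx// mul0r.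
    by rewrite /Rintegral integral0_eq// => t _; rewrite /= outx// mul0r.
  have [w [g [gi wg vw]]] := xs xab.
  have dp (t : R) : is_derive t 1 (fun t => ph (t, x)) (dt ph (t, x)).
    by apply: is_derive_slice_t.
  have cd : continuous (fun t => dt ph (t, x)).
    by move=> t; apply: (@continuous_comp _ _ _ (fun t => (t, x)) (dt ph)); [exact: continuous_pair_l|exact: cdt].
  have p0 : ph (0, x) = 0.
    by apply: (test_fun2_out tph) => -[/=]; rewrite in_itv /= ltxx.
  have pT : ph (T, x) = 0.
    by apply: (test_fun2_out tph) => -[/=]; rewrite in_itv /= ltxx andbF.
  have := Rintegral_parts (w 0) T0 gi dp cd p0 pT.
  rewrite Rintegral_mkcond [X in _ = - X -> _]Rintegral_mkcond mulN1r => E.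
  transitivity (\int[mu]_t ((fun t => (w 0 + \int[mu]_(z in `[0, t]) g z) * dt ph (t, x)) \_ `]0, T[%classic) t).
    apply: eq_Rintegral => t _; rewrite /= slx// !patchE; case: ifPn => [|_]; last by rewrite mul0r.
    rewrite inE /= => tT; have [-> _] := vw t tT; congr (_ * _).
    by move: tT; rewrite in_itv /= => /andP[/ltW t0 _]; rewrite -wg//; ring.
  rewrite E; congr (- _); apply: eq_Rintegral => t _.
  rewrite /= slx// !patchE; case: ifPn => [|_]; last by rewrite mul0r.
  by rewrite inE /= => tT; have [_ ->] := vw t tT.
- have i1 := ii _ _ v2 cdx b3; have i2 := ii _ _ vx2 cph b1.
  rewrite Rintegral12// -[RHS]mulN1r Rintegral12// -RintegralZl//; last exact: (intg_fubini1 i2).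
  apply: ae_Rintegral; [exact: intg_measurable (intg_fubini1 i1)
    |exact: intg_measurable (intg_scale (-1) (intg_fubini1 i2))|].
  move: st => /ae_imply; apply => t ts; have [tT|tT] := boolP (t \in `]0, T[); last first.
    rewrite [X in X = _](_ : _ = 0) 1?[X in _ * X](_ : _ = 0) ?mulr0//.
      by rewrite /Rintegral integral0_eq// => x _; rewrite /= outt// mul0r.
    by rewrite /Rintegral integral0_eq// => x _; rewrite /= outt// mul0r.
  have [w [g [gi wg vw]]] := ts tT.
  have dp (x : R) : is_derive x 1 (fun x => ph (t, x)) (dx ph (t, x)).
    by apply: is_derive_slice_x.
  have cd : continuous (fun x => dx ph (t, x)).
    by move=> x; apply: (@continuous_comp _ _ _ (fun x => (t, x)) (dx ph)); [exact: continuous_pair_r|exact: cdx].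
  have pa : ph (t, a) = 0.
    by apply: (test_fun2_out tph) => -[_ /=]; rewrite in_itv /= ltxx.
  have pb : ph (t, b) = 0.
    by apply: (test_fun2_out tph) => -[_ /=]; rewrite in_itv /= ltxx andbF.
  have := Rintegral_parts (w a) ab gi dp cd pa pb.
  rewrite Rintegral_mkcond [X in _ = - X -> _]Rintegral_mkcond mulN1r => E.
  transitivity (\int[mu]_x ((fun x => (w a + \int[mu]_(z in `[a, x]) g z) * dx ph (t, x)) \_ `]a, b[%classic) x).
    apply: eq_Rintegral => x _; rewrite /= slt// !patchE; case: ifPn => [|_]; last by rewrite mul0r.
    rewrite inE /= => xab; have [-> _] := vw x xab; congr (_ * _).
    by move: xab; rewrite in_itv /= => /andP[/ltW x0 _]; rewrite -wg//; ring.
  rewrite E; congr (- _); apply: eq_Rintegral => x _.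
  rewrite /= slt// !patchE; case: ifPn => [|_]; last by rewrite mul0r.
  by rewrite inE /= => xab; have [_ ->] := vw x xab.
Qed.

End weak_gradients.

(** * Patching local representations into one wave *)

Section travelling_wave.
Context {R : realType}.
Local Notation mu := (@lebesgue_measure R).

(** If [f] and [g] differ at one [s], they differ on a whole strip around it, whose area is positive
    because [t1 < t2]. *)
Lemma ae_box_snd (f g : R -> R) (t1 t2 s1 s2 : R) : t1 < t2 ->
  continuous f -> continuous g ->
  {ae mu2 R, forall p, p.1 \in `]t1, t2[ -> p.2 \in `]s1, s2[ -> f p.2 = g p.2} ->
  forall s, s \in `]s1, s2[ -> f s = g s.
Proof.
move=> t12 cf cg [N [mN N0 sub]] s ss; apply/eqP/negPn/negP => fgs.
have nb : nbhs s [set z | (z \in `]s1, s2[) /\ f z != g z].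
  have n1 : nbhs s [set z | z \in `]s1, s2[] by exact: near_in_itvoo.
  have n2 : nbhs s [set z | f z != g z].
    have c0 : (f z - g z) @[z --> s] --> f s - g s.
      by apply: cvgB; [exact: cf|exact: cg].
    have : \forall z \near s, f z - g z != 0.
      by apply: (cvgr_neq0 _ c0); rewrite subr_eq0.
    by apply: filterS => z; rewrite subr_eq0.
  by move: n1 n2; apply: filterS2.
case/nbhs_ballP : nb => e /= e0 eP.
have sub2 : `]t1, t2[%classic `*` `]s - e, s + e[%classic `<=` N.
  move=> [t z] [/= tt zz]; apply: sub => /= H.
  have [] := eP z; first by move: zz; rewrite in_itv /= /ball /= ltr_norml; lra.
  by move=> z12 /eqP; apply; exact: H.
pose B := `]t1, t2[%classic `*` `]s - e, s + e[%classic.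
have : (mu2 R B <= mu2 R N)%E.
  by apply: le_measure; rewrite ?inE//; exact: measurableX.
have mitv (x y : R) : x < y -> mu `]x, y[%classic = (y - x)%:E.
  by move=> xy; rewrite lebesgue_measure_itv /= lte_fin xy EFinB.
have -> : mu2 R B = ((t2 - t1) * ((s + e) - (s - e)))%:E.
  rewrite /B product_measure1E// EFinM; congr (_ * _)%E; apply: mitv => //.
  by move: e0; clear; lra.
by rewrite N0 lee_fin; move: e0 t12; clear; nra.
Qed.

(* ]t1, t2[ x ]s1, s2[ lies in the image of ]0, T[ x ]a, b[ under the shear. *)
Definition slab_box (T al be t1 t2 s1 s2 : R) : Prop :=
  [/\ 0 <= t1, t1 < t2, t2 <= T & s1 < s2] /\ al <= s1 - t2 /\ s2 - t1 <= be.

(** For a fixed [z] the admissible times form an interval, so over the common range of [z] the hull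
    of the two time ranges stays admissible. This connects boxes that are disjoint in time. *)
Lemma slab_box_merge (T al be t1 t2 s1 s2 t1' t2' s1' s2' : R) :
  slab_box T al be t1 t2 s1 s2 -> slab_box T al be t1' t2' s1' s2' ->
  Num.max s1 s1' < Num.min s2 s2' ->
  slab_box T al be (Num.min t1 t1') (Num.max t2 t2') (Num.max s1 s1') (Num.min s2 s2').
Proof.
move=> [[q1 q2 q3 q4] [q5 q6]] [[q1' q2' q3' q4'] [q5' q6']].
set S1 := Num.max s1 s1'; set S2 := Num.min s2 s2' => s12.
have e1 : s1 <= S1 by rewrite le_max lexx.
have e2 : s1' <= S1 by rewrite le_max lexx orbT.
have e3 : S2 <= s2 by rewrite ge_min lexx.
have e4 : S2 <= s2' by rewrite ge_min lexx orbT.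
have t2E : Num.max t2 t2' = t2 \/ Num.max t2 t2' = t2' by case: leP; [right|left].
have t1E : Num.min t1 t1' = t1 \/ Num.min t1 t1' = t1' by case: leP; [left|right].
split; first split => //.
- by rewrite le_min q1.
- by rewrite lt_max !gt_min q2.
- by rewrite ge_max q3.
split; first by case: t2E => ->; apply: (@le_trans _ _ (_ - _)); [exact: q5|rewrite lerB|exact: q5'|rewrite lerB].
by case: t1E => ->; apply: (@le_trans _ _ (_ - _) _ _ _ _); [|exact: q6| |exact: q6']; rewrite lerB.
Qed.

Lemma slab_box_exists (T al be t z : R) : 0 < t -> t < T -> al < z - t -> z - t < be ->
  exists B : rat * rat * rat * rat,
  [/\ slab_box T al be (ratr B.1.1.1) (ratr B.1.1.2) (ratr B.1.2) (ratr B.2),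
    t \in `]ratr B.1.1.1, ratr B.1.1.2[ & z \in `]ratr B.1.2, ratr B.2[].
Proof.
move=> t0 tT h1 h2.
(* Moving [t] and [z] by at most [e] each changes [z - t] by at most [2 * e]; hence the division by
   2. *)
pose e := Num.min (Num.min t (T - t)) (Num.min (z - t - al) (be - (z - t))) / 2.
have [e1 e2 e3 e4] : [/\ 2 * e <= t, 2 * e <= T - t, 2 * e <= z - t - al & 2 * e <= be - (z - t)].
  by rewrite /e mulrC divfK// !ge_min !lexx !orbT.
have e0 : 0 < e by rewrite /e divr_gt0// !lt_min; lra.
have l x : x - e < x by lra.
have r x : x < x + e by lra.
clearbody e.
have [q1 q1P] := rat_in_itvoo (l t); have [q2 q2P] := rat_in_itvoo (r t).
have [q3 q3P] := rat_in_itvoo (l z); have [q4 q4P] := rat_in_itvoo (r z).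
move: q1P q2P q3P q4P; rewrite !in_itv /= => /andP[? ?] /andP[? ?] /andP[? ?] /andP[? ?].
exists (q1, q2, q3, q4); rewrite /slab_box !in_itv /= {l r}.
by split; [split; [split|split]|apply/andP; split|apply/andP; split]; lra.
Qed.

Lemma characteristic_wave h ht hx (T a b al be s : R) :
  0 < T -> al < be ->
  s * s = 1 -> (forall x, (s * x \in `]al, be[) = (x \in `]a, b[)) ->
  let D := (`]0, T[%classic `*` `]a, b[%classic : set (R * R)) in
  weak_grad D h ht hx ->
  {ae mu2 R, forall p, D p -> ht p = s * hx p} ->
  exists2 W : R -> R, {within `]al, be + T[, continuous W} &
  {ae mu2 R, forall p, D p -> h p = W (p.1 + s * p.2)}.
Proof.
move=> T0 albe ss1 abs D wg aeh.
pose H := (h \_ D \o unshear s).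
pose box : Type := (rat * rat * rat * rat)%type.
pose b1 (B : box) : R := ratr B.1.1.1; pose b2 (B : box) : R := ratr B.1.1.2.
pose b3 (B : box) : R := ratr B.1.2; pose b4 (B : box) : R := ratr B.2.
pose okB B := slab_box T al be (b1 B) (b2 B) (b3 B) (b4 B).
have rep t1 t2 s1 s2 : slab_box T al be t1 t2 s1 s2 -> exists2 c : R -> R, continuous c &
  {ae mu2 R, forall p, p.1 \in `]t1, t2[ -> p.2 \in `]s1, s2[ -> H p = c p.2}.
  move=> [[q1 q2 q3 q4] [q5 q6]].
  exact: (characteristic_box ss1 abs wg aeh q1 q2 q3 q4 q5 q6).
have /choice[C CP] : forall B, exists c, okB B -> continuous c /\
    {ae mu2 R, forall p, p.1 \in `]b1 B, b2 B[ -> p.2 \in `]b3 B, b4 B[ -> H p = c p.2}.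
  move=> B; have [/rep[c cc cH]|nok] := pselect (okB B); first by exists c.
  by exists (fun=> 0).
(* The two boxes need not meet, so their functions are not compared directly: both are compared with
   the function attached to the merged box. *)
have consist B B' z : okB B -> okB B' -> z \in `]b3 B, b4 B[ -> z \in `]b3 B', b4 B'[ ->
    C B z = C B' z.
  move=> oB oB' zB zB'.
  have [cB aB] := CP B oB; have [cB' aB'] := CP B' oB'.
  pose t1 := Num.min (b1 B) (b1 B'); pose t2 := Num.max (b2 B) (b2 B').
  pose s1 := Num.max (b3 B) (b3 B'); pose s2 := Num.min (b4 B) (b4 B').
  have zs : z \in `]s1, s2[.
    by move: zB zB'; rewrite !in_itv /= /s1 /s2 gt_max lt_min; lra.
  have okbig : slab_box T al be t1 t2 s1 s2.
    apply: slab_box_merge => //; move: zs; rewrite in_itv /= => /andP[].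
    exact: lt_trans.
  have [c cc aec] := rep _ _ _ _ okbig.
  have agree B0 : okB B0 -> `]b1 B0, b2 B0[ `<=` `]t1, t2[ -> `]s1, s2[ `<=` `]b3 B0, b4 B0[ ->
      C B0 z = c z.
    move=> oB0 st ss; have [cB0 aB0] := CP B0 oB0; have [[_ b12 _ _] _] := oB0.
    apply: (ae_box_snd b12 cB0 cc _ zs).
    apply: (ae_imply2 aB0 aec) => p h1 h2 pt ps.
    by rewrite -h1 ?h2//; [exact: st|exact: ss].
  transitivity (c z); [apply: agree => // x|apply/esym; apply: agree => // x];
    rewrite /= !in_itv /= /t1 /t2 /s1 /s2 ?gt_max ?lt_min ?gt_min ?lt_max => /andP[x1 x2];
    rewrite ?x1 ?x2 ?orbT//; case/andP: x1 => x1 x1'; case/andP: x2 => x2 x2';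
    by rewrite ?x1 ?x1' ?x2 ?x2'.
(* By [consist] the value does not depend on the box over [z]; where no admissible box lies over
   [z], the default is 0. *)
have /choice[W WP] : forall z, exists y, forall B, okB B -> z \in `]b3 B, b4 B[ -> y = C B z.
  move=> z; have [[B [oB zB]]|nex] := pselect (exists B, okB B /\ z \in `]b3 B, b4 B[).
    by exists (C B z) => B' oB' zB'; exact: consist.
  by exists 0 => B oB zB; case: nex; exists B.
exists W.
  rewrite continuous_open_subspace; last exact: interval_open.
  move=> z; rewrite inE /= in_itv /= => /andP[zal zbe].
  (* The line with second coordinate [z] meets the sheared domain exactly at the times between [lo]
     and [hi]; any of them provides a box over [z], on which [W] inherits the continuity of the
     local function. *)
  pose lo := Num.max 0 (z - be); pose hi := Num.min T (z - al).
  have lohi : lo < hi.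
    by rewrite gt_max !lt_min; move: T0 albe zal zbe; clear; lra.
  have [lo1 lo2] : 0 <= lo /\ z - be <= lo by rewrite !le_max !lexx orbT.
  have [hi1 hi2] : hi <= T /\ hi <= z - al by rewrite !ge_min !lexx orbT.
  have [t [t1 t2]] : exists t, lo < t /\ t < hi.
    by exists ((lo + hi) / 2); move: lohi; clear; lra.
  have [t3 t4] : al < z - t /\ z - t < be by move: t1 t2 lo2 hi2; clear; lra.
  have [B [oB _ zB]] := slab_box_exists (le_lt_trans lo1 t1) (lt_le_trans t2 hi1) t3 t4.
  have [cB _] := CP B oB; have WC : \near z, C B z = W z.
    have : nbhs z [set y | y \in `]b3 B, b4 B[] by exact: near_in_itvoo.
    by apply: filterS => y yB; apply/esym; exact: WP.
  rewrite /continuous_at (WP z B oB zB).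
  exact: cvg_trans (near_eq_cvg WC) (cB z).
have aeC : {ae mu2 R, forall p, forall B : box, okB B ->
    p.1 \in `]b1 B, b2 B[ -> p.2 \in `]b3 B, b4 B[ -> H p = C B p.2}.
  apply: ae_countable => B; have [oB|noB] := pselect (okB B); last exact: aeW.
  by have [_ /ae_imply] := CP B oB; apply.
move: (ae_shear ss1 aeC) => /ae_imply; apply => p pB Dp.
have [p1 p2] := Dp; move: p1 p2; rewrite /= !in_itv /= => /andP[p1 p1'] p2.
have := abs p.2; rewrite !in_itv /= p2 => /andP[p3 p4].
have [p5 p6] : al < p.1 + s * p.2 - p.1 /\ p.1 + s * p.2 - p.1 < be.
  by rewrite addrAC subrr add0r.
have [B [oB tB zB]] := slab_box_exists p1 p1' p5 p6.
rewrite (WP _ B)//; have := pB B oB tB zB.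
by rewrite /H /= shearK// patchE mem_set.
Qed.

End travelling_wave.

(** * Wave representation of the solutions *)

Section rod_geometry.
Context {R : realType}.
Local Notation mu := (@lebesgue_measure R).

Lemma Js_mem (N : nat) (k : int) : k \in Js N ->
  exists2 i : nat, (i < N)%N & k = 1 - N%:Z + (i.*2)%:Z.
Proof. by case/mapP => i; rewrite mem_iota add0n => /andP[_ iN] ->; exists i. Qed.

Lemma uniq_Js (N : nat) : uniq (Js N).
Proof. by rewrite map_inj_uniq ?iota_uniq// => i j; lia. Qed.

Lemma lam_gt0 (N : nat) : (0 < N)%N -> 0 < lam R N.
Proof. by move=> N0; rewrite divr_gt0// ltr0n. Qed.

Lemma nodeD (N : nat) (m n : int) : node R N (m + n) = node R N m + n%:~R * lam R N / 2.
Proof. by rewrite /node intrD; ring. Qed.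

Lemma node_itv (N : nat) (k : int) : node R N (k + 1) = node R N (k - 1) + lam R N.
Proof. by rewrite /node !intrD !mulrDl rmorphN /=; field. Qed.

Lemma z_plusE (N : nat) (k : int) : z_plus R N k = node R N (k - 1).
Proof. by rewrite /z_plus /node mulrAC. Qed.

Lemma z_minusE (N : nat) (k : int) : z_minus R N k = - node R N (k + 1).
Proof. by rewrite /z_minus /node mulrAC. Qed.

Lemma I_plusE (N : nat) (T : R) (k : int) :
  I_plus N T k = `]node R N (k - 1), (node R N (k + 1) + T)[%classic.
Proof. by rewrite /I_plus z_plusE node_itv. Qed.

Lemma I_minusE (N : nat) (T : R) (k : int) :
  I_minus N T k = `](- node R N (k + 1)), (- node R N (k - 1) + T)[%classic.
Proof.
rewrite /I_minus z_minusE (_ : - node R N (k - 1) = - node R N (k + 1) + lam R N)//.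
by rewrite node_itv opprD subrK.
Qed.

Lemma nodeN (N : nat) : (0 < N)%N -> node R N (- N%:Z) = -1 /\ node R N N%:Z = 1.
Proof.
move=> N0; have N0' : N%:R != 0 :> R by rewrite pnatr_eq0 -lt0n.
by rewrite /node /lam rmorphN /=; split; field.
Qed.

Lemma node_le (N : nat) (m n : int) : (0 < N)%N -> m <= n -> node R N m <= node R N n.
Proof.
move=> N0 mn; have l0 := lam_gt0 N0.
by rewrite /node ler_wpM2r ?invr_ge0// ler_wpM2r ?(ltW l0)// ler_int.
Qed.

Lemma node_lt (N : nat) (m n : int) : (0 < N)%N -> (node R N m < node R N n) = (m < n).
Proof.
move=> N0; have l0 := lam_gt0 N0.
by rewrite /node ltr_pM2r ?invr_gt0// ltr_pM2r// ltr_int.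
Qed.

Lemma Ix_sub (N : nat) (k : int) : (0 < N)%N -> k \in Js N -> I_x R N k `<=` I_L R.
Proof.
move=> N0 /Js_mem[i iN ->] x; rewrite /I_x /I_L /= !in_itv /= => /andP[h1 h2].
have [e1 e2] := nodeN N0.
apply/andP; split.
  apply: le_lt_trans h1; rewrite -e1; apply: node_le => //; lia.
apply: lt_le_trans h2 _; rewrite -[X in _ <= X]e2; apply: node_le => //; lia.
Qed.

Lemma cell_sub (N : nat) (T : R) (k : int) : (0 < N)%N -> k \in Js N ->
  cell N T k `<=` Omega T.
Proof. by move=> N0 kJ p [p1 p2]; split => //; exact: Ix_sub p2. Qed.

Lemma Ix_disjoint (N : nat) (k k' : int) (x : R) : (0 < N)%N ->
  k \in Js N -> k' \in Js N -> I_x R N k x -> I_x R N k' x -> k = k'.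
Proof.
move=> N0 /Js_mem[i _ ->] /Js_mem[j _ ->]; rewrite /I_x /= !in_itv /=.
move=> /andP[h1 h2] /andP[h3 h4].
have := lt_trans h1 h4; have := lt_trans h3 h2; rewrite !node_lt//; lia.
Qed.

Lemma force_cell (N : nat) (T : R) (du : int -> R -> R) (k : int) (p : R * R) :
  (0 < N)%N -> k \in Js N -> I_x R N k p.2 -> force N du p = du k p.1.
Proof.
move=> N0 kJ kp; rewrite /force (bigD1_seq k kJ (uniq_Js N)) /= big_seq_cond big1.
  by rewrite addr0 indicE mem_set// mulr1.
move=> j /andP[jJ jk]; rewrite indicE memNset ?mulr0// => jp.
by move/eqP : jk; apply; exact: Ix_disjoint jp kp.
Qed.

Lemma measurable_cell (N : nat) (T : R) k : measurable (cell N T k).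
Proof. by apply: measurableX; exact: measurable_itv. Qed.

Lemma measurable_Omega (T : R) : measurable (Omega T).
Proof. by apply: measurableX; exact: measurable_itv. Qed.

Lemma Lfun2_tensor (f g : R -> R) : f \in Lfun mu 2%:E -> g \in Lfun mu 2%:E ->
  (fun p : R * R => f p.1 * g p.2) \in Lfun (mu2 R) 2%:E.
Proof.
move=> /Lfun2P[mf f2] /Lfun2P[mg g2]; apply/Lfun2P; split.
  by apply: measurable_funM; apply: measurableT_comp.
have := intg_tensor f2 g2; congr ((mu2 R).-integrable _ _).
by apply/funext => p /=; rewrite exprMn.
Qed.

Lemma L2_fst (f : R -> R) (T a b : R) : L2 mu `]0, T[ f ->
  L2 (mu2 R) (`]0, T[%classic `*` `]a, b[%classic) (fun p => f p.1).
Proof.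
move=> f2; rewrite /L2.
rewrite (_ : _ \_ _ = (fun p => (f \_ `]0, T[%classic) p.1 * \1_(`]a, b[%classic) p.2)).
  by apply: Lfun2_tensor => //; apply: Lfun2_indic => //; exact: lebesgue_measure_itv_oo_lty.
apply/funext => p; rewrite !patchE indicE in_setX.
by case: (p.1 \in _) => /=; case: (p.2 \in _); rewrite ?mulr1 ?mulr0 ?mul0r.
Qed.

Lemma weak_grad_fst (u du : R -> R) (T a b : R) : 0 < T -> a < b ->
  {within `[0, T], continuous u} -> weak_deriv `]0, T[ u du ->
  weak_grad (`]0, T[%classic `*` `]a, b[%classic)
    (fun p => u p.1) (fun p => du p.1) (fun=> 0).
Proof.
move=> T0 ab cu wd; have [w [_ gi wg] wu] := weak_deriv_acf T0 cu wd.
have [u2 du2 _] := wd.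
apply: weak_grad_slices => //.
- exact: L2_fst.
- exact: L2_fst.
- rewrite /L2 (_ : _ \_ _ = (fun=> 0)).
    by apply/Lfun2P; split => //; rewrite (_ : (fun=> _) = (fun=> 0));
      [exact: integrable0|apply/funext => ? /=; rewrite expr0n].
  by apply/funext => p; rewrite patchE; case: ifP.
- apply: aeW => x _; exists w, (du \_ `]0, T[%classic); split => // t tT.
  by rewrite wu ?patchE ?mem_setE ?tT//; exact: subset_itv_oo_cc tT.
- apply: aeW => t _; exists (fun=> u t), (fun=> 0); split => //.
    exact: integrable0.
  by move=> x y _; rewrite subrr /Rintegral integral0.
Qed.

End rod_geometry.

Section wave_representation.
Context {R : realType}.
Local Notation mu := (@lebesgue_measure R).

(** The density is a sum of two squares with positive weights, so a zero integral makes both squares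
    vanish almost everywhere. *)
Lemma q_density_zero (N : nat) (T : R) (vt vx rt rx : R * R -> R) (du : int -> R -> R) :
  L2 (mu2 R) (Omega T) vt -> L2 (mu2 R) (Omega T) vx ->
  L2 (mu2 R) (Omega T) rt -> L2 (mu2 R) (Omega T) rx ->
  (forall k, k \in Js N -> L2 mu (I_T T) (du k)) ->
  (\int[mu2 R]_(p in Omega T) (q_density vt vx rt rx (force N du) p)%:E)%E = 0%E ->
  {ae mu2 R, forall p, Omega T p -> vt p = rx p /\ vx p = rt p - force N du p}.
Proof.
move=> /Lfun2P[m1 _] /Lfun2P[m2 _] /Lfun2P[m3 _] /Lfun2P[m4 _] mdu Q0.
have mO := measurable_Omega T.
(* Measurability is known only after cutting off to the domains, and only for [k] in [Js N]; the
   modified densities are globally measurable and give the same force inside [Omega T]. *)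
pose du' k := if k \in Js N then du k \_ (I_T T) else (fun=> 0).
have mdu' k : measurable_fun setT (du' k).
  by rewrite /du'; case: ifPn => // /mdu /Lfun2P[].
have mf : measurable_fun setT (force N du').
  apply: measurable_sum => k; apply: measurable_funM.
    exact: (measurableT_comp (mdu' k) measurable_fst).
  apply: (measurableT_comp _ measurable_snd).
  by apply: measurable_indic; exact: measurable_itv.
pose q p := 4^-1 * ((vt \_ (Omega T)) p - (rx \_ (Omega T)) p) ^+ 2 +
  4^-1 * ((vx \_ (Omega T)) p - ((rt \_ (Omega T)) p - force N du' p * \1_(Omega T) p)) ^+ 2.
have mq : measurable_fun setT q.
  apply: measurable_funD; apply: measurable_funM => //; apply: measurable_funX;
    apply: measurable_funB => //.
  by apply: measurable_funB => //; apply: measurable_funM.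
have qE : q = q_density vt vx rt rx (force N du) \_ (Omega T).
  apply/funext => p; rewrite /q !patchE indicE; case: ifPn => [|_].
    rewrite inE => -[p1 p2]; rewrite mulr1 (_ : force N du' p = force N du p)//.
    rewrite /force big_seq [RHS]big_seq; apply: eq_bigr => k kJ.
    by rewrite /du' kJ patchE mem_set.
  by rewrite mulr0 !subr0 expr0n mulr0 addr0.
have q0 p : 0 <= q p by rewrite addr_ge0// mulr_ge0// sqr_ge0.
have Q0' : (\int[mu2 R]_p `|(q p)%:E| = 0)%E.
  rewrite -Q0 [RHS]integral_mkcond; apply: eq_integral => p _.
  by rewrite gee0_abs ?lee_fin// qE !patchE; case: ifP.
have mqE : measurable_fun setT (EFin \o q) by exact/measurable_EFinP.
have /ae_imply := (ae_eq_integral_abs (mu2 R) measurableT mqE).1 Q0'.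
apply => p /(_ I) /= [qp0] Op; move: qp0.
rewrite qE patchE mem_set// /q_density => /eqP.
set A := _ * _ ^+ 2; set B := _ * _ ^+ 2.
have A0 : 0 <= A by rewrite mulr_ge0// sqr_ge0.
have B0 : 0 <= B by rewrite mulr_ge0// sqr_ge0.
have h4 : 4^-1 != 0 :> R by rewrite invr_eq0 pnatr_eq0.
rewrite paddr_eq0// /A /B !mulf_eq0 (negbTE h4) /= !orbb !subr_eq0.
by move=> /andP[/eqP e1 /eqP e2].
Qed.

Lemma solution_dalembert (N : nat) (T : R) (v r : R * R -> R) (u : int -> R -> R) (k : int) :
  (0 < N)%N -> 0 < T -> is_control N T u -> Q_zero N T v r u -> k \in Js N ->
  exists wp wm : R -> R,
    [/\ {within I_plus N T k, continuous wp},
        {within I_minus N T k, continuous wm} &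
        dalembert N T k v r (u k) wp wm].
Proof.
move=> N0 T0 [_ cu _ _] [vt [vx [rt [rx [du [wv wr wu Q0]]]]]] kJ.
have aeq : {ae mu2 R, forall p, Omega T p -> vt p = rx p /\ vx p = rt p - force N du p}.
  case: wv wr => [_ a1 a2 _] [_ a3 a4 _].
  by apply: q_density_zero => // j /wu[].
have subc := cell_sub (T := T) N0 kJ.
have mc := measurable_cell N T k.
have wvc := weak_grad_sub mc subc wv; have wrc := weak_grad_sub mc subc wr.
have l0 : 0 < lam R N := lam_gt0 N0.
have ab : node R N (k - 1) < node R N (k + 1) by rewrite node_itv; lra.
have [[cuk _] _] : H1_interval 0 T (u k) /\ u k 0 = 0.
  by apply: cu; rewrite /Jc !inE kJ !orbT.
have wuc := weak_grad_fst T0 ab cuk (wu k kJ).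
have fc : (mu2 R (cell N T k) < +oo)%E := rect_finite _ _ _ _.
(* The Riemann invariant [v + s * (r - u_k)]. On one cell the force is the derivative of [u k], so
   subtracting [u k] from [r] makes the system homogeneous. *)
have wh s := weak_gradD mc fc wvc
  (weak_gradZ s mc fc (weak_gradD mc fc wrc (weak_gradZ (-1) mc fc wuc))).
have eqh s : s * s = 1 -> {ae mu2 R, forall p, cell N T k p ->
    (vt \+ (fun p => s * (rt \+ (fun p => -1 * du k p.1)) p)) p =
    s * (vx \+ (fun p => s * (rx \+ (fun p => -1 * 0)) p)) p}.
  move=> ss1; move: aeq => /ae_imply; apply => p hp cp.
  have [e1 e2] := hp (subc _ cp).
  have E (a b c : R) : a + s * (b + -1 * c) = s * (b - c + s * (a + -1 * 0)).
    by rewrite mulr0 addr0 [in RHS]mulrDr (mulrA s s a) ss1; ring.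
  have fE : force N du p = du k p.1 by case: cp => _ cp; exact: force_cell N0 kJ cp.
  rewrite /= e1 e2 fE; exact: E.
have [Wp cWp Wpe] := characteristic_wave T0 ab (mulr1 1)
  (fun x => congr1 (fun y => y \in _) (mul1r x)) (wh 1) (eqh 1 (mulr1 1)).
(* For [s = -1] the quantity [s * x] runs through the reflected interval, which is why the second
   wave lives on [I_minus]. *)
have Nab : - node R N (k + 1) < - node R N (k - 1) by rewrite ltrN2.
have NE (x : R) : (-1 * x \in `](- node R N (k + 1)), (- node R N (k - 1))[) =
    (x \in `]node R N (k - 1), node R N (k + 1)[).
  by rewrite !in_itv /= mulN1r !ltrN2 andbC.
have NN1 : -1 * -1 = 1 :> R by rewrite mulrNN mulr1.
have [Wm cWm Wme] := characteristic_wave T0 Nab NN1 NE (wh (-1)) (eqh (-1) NN1).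
(* [Wp] and [Wm] represent the sum and the difference of [v] and [r - u_k], hence twice the
   waves. *)
exists (fun z => 2^-1 * Wp z), (fun z => 2^-1 * Wm z); split.
- by rewrite I_plusE => z; apply: cvgM; [exact: cvg_cst|exact: cWp].
- by rewrite I_minusE => z; apply: cvgM; [exact: cvg_cst|exact: cWm].
apply: (ae_imply2 Wpe Wme) => p hp hm cp; have := hp cp; have := hm cp => /=.
rewrite mul1r !mulN1r mul1r.
move: (v p) (r p) (u k p.1) (Wp _) (Wm _) => a b c wp wm <- <-; by split; field.
Qed.

End wave_representation.

(** * Waves and controls in pieces *)

Section pieces.
Context {R : realType}.

(** The pieces leave out their endpoints, so points where [t + x], [t - x] or [t] hits a break point
    must be discarded. The slopes 1, -1 and 0 of [s] cover the three cases. *)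
Lemma ae_off_line (s c : R) : {ae mu2 R, forall p, p.1 + s * p.2 <> c}.
Proof.
pose D (p : R * R) : R := \1_[set c] (p.1 + s * p.2).
have mD : measurable_fun setT D.
  apply: (@measurableT_comp _ _ _ _ _ _ (\1_[set c] : R -> R)).
    by apply: measurable_indic; exact: measurable_set1.
  apply: measurable_funD; first exact: measurable_fst.
  by apply: measurable_funM => //; exact: measurable_snd.
suff : {ae mu2 R, forall p, D p = 0}.
  move=> /ae_imply; apply => p; rewrite /D indicE => + pc.
  by rewrite mem_set// => /eqP; rewrite oner_eq0.
apply: ae_sections => //; apply: aeW => y.
exists [set c - s * y]; split; [exact: measurable_set1|exact: lebesgue_measure_set1|].
move=> x /=; apply: contra_notP => /= xc; rewrite /D indicE memNset//= => e.
by apply: xc; rewrite -e addrK.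
Qed.

Lemma t_S (N : nat) (tau0 : R) m : t_ N tau0 m.+1 = t_ N tau0 m + tau N tau0 m.
Proof.
rewrite /t_ /tau /= uphalf_half natrD.
by case: (odd m) => /=; rewrite ?mul1r ?mul0r; ring.
Qed.

Lemma t_pieces (N : nat) (tau0 : R) (n : nat) (z : R) : 0 < z -> z < t_ N tau0 n ->
  (forall m, z <> t_ N tau0 m) ->
  exists m z', [/\ (m < n)%N, z' \in `]0, tau N tau0 m[ & z = z' + t_ N tau0 m].
Proof.
move=> z0 + zt; elim: n => [|n IH].
  by rewrite /t_ /= !mul0r addr0 => /(lt_trans z0); rewrite ltxx.
rewrite t_S => zn; case: (ltgtP z (t_ N tau0 n)) => [/IH[m [z' [mn z'I ->]]]|nz|/zt//].
  by exists m, z'; split => //; exact: ltnW.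
exists n, (z - t_ N tau0 n); split; rewrite ?subrK// in_itv /= subr_gt0 nz /=.
by rewrite ltrBlDl.
Qed.

(** For the given [T] these break points are [T] and [lam R N + T], the lengths of the domains of
    the controls and of the waves; so the last pieces carry the numbers [2 * M] and [2 * M + 2]. *)
Lemma t_last (N M : nat) (tau0 : R) :
  t_ N tau0 (2 * M + 1) = lam R N * M%:R + tau0 /\
  t_ N tau0 (2 * M + 3) = lam R N + (lam R N * M%:R + tau0).
Proof.
have e1 : (2 * M + 1 = (M.*2).+1)%N by lia.
have e2 : (2 * M + 3 = (M.+1.*2).+1)%N by lia.
rewrite e1 e2 /t_ /= !odd_double /= !uphalf_double !mul1r; split; first by rewrite mulrC.
by rewrite -natr1; ring.
Qed.

(** Summation by parts. With [n = N.+1] the weights are the factors [(N + 2 - n) / 2] behind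
    [ctrl_coef], and for a zero-sum sequence the sum isolates its first term. *)
Lemma sum_telescope_weighted (a : nat -> R) n :
  \sum_(0 <= j < n) (n%:R - j%:R) * (a j.+1 - a j) =
  \sum_(0 <= j < n.+1) a j - n.+1%:R * a 0.
Proof.
elim: n => [|n IH]; first by rewrite big_geq// big_nat1 mul1r subrr.
rewrite (eq_bigr (fun j => (n%:R - j%:R) * (a j.+1 - a j) + (a j.+1 - a j))); last first.
  by move=> j _; rewrite -natr1; ring.
rewrite big_split /= telescope_sumr// big_nat_recr//= subrr mul0r addr0 IH.
by rewrite [in RHS]big_nat_recr//= -(natr1 n.+1); ring.
Qed.

Lemma sum_telescope_lt (a : nat -> R) i n : (i <= n)%N ->
  \sum_(0 <= j < n) (j < i)%N%:R * (a j.+1 - a j) = a i - a 0.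
Proof.
move=> le_in; rewrite (big_cat_nat (n := i))//= -(telescope_sumr a (leq0n i)).
rewrite [X in _ + X](eq_big_nat _ _ (F2 := fun=> 0)); last first.
  by move=> j /andP[ij _]; rewrite ltnNge ij mul0r.
rewrite [X in _ + X]big1_eq addr0; apply: eq_big_nat => j /andP[_ ->].
by rewrite mul1r.
Qed.

Lemma sum_Jx (N : nat) (F : int -> R) :
  \sum_(n <- Jx N) F n = \sum_(0 <= j < N.+1) F (- N%:Z + (j.*2)%:Z).
Proof. by rewrite big_map /index_iota subn0. Qed.

Lemma sum_Jc (N : nat) (F : int -> R) :
  \sum_(k <- Jc N) F k = \sum_(0 <= i < N.+2) F (- N%:Z - 1 + (i.*2)%:Z).
Proof.
rewrite [RHS]big_nat_recl// [in RHS]big_nat_recr//= addr0.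
rewrite [LHS]big_cons [X in _ + X]big_cons big_map.
rewrite (_ : - N%:Z - 1 + (N.+1.*2)%:Z = N%:Z + 1); last by lia.
rewrite (addrC (F (N%:Z + 1))); congr (_ + (_ + _)).
rewrite /index_iota subn0; apply: eq_bigr => i _; congr F; lia.
Qed.

Lemma control_inversion (N : nat) (T : R) (u : int -> R -> R) (k : int) (t : R) :
  is_control N T u -> t \in `[0, T] -> k \in Js N ->
  u k t = \sum_(n <- Jx N) ctrl_coef R N k n * u n t.
Proof.
move=> [_ _ u_diff u_sum] tT /Js_mem[i iN ->].
pose a (j : nat) := u (- N%:Z - 1 + (j.*2)%:Z) t.
have a_diff j : (j < N.+1)%N -> u (- N%:Z + (j.*2)%:Z) t = a j.+1 - a j.
  move=> jN; rewrite u_diff//; last by apply/mapP; exists j; rewrite ?mem_iota.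
  by congr (u _ t - u _ t); lia.
have := u_sum t tT; rewrite sum_Jc -/a => a_sum.
have N2 : N.+2%:R != 0 :> R by rewrite pnatr_eq0.
rewrite sum_Jx (_ : u _ t = a i.+1); last by congr (u _ t); lia.
(* The first part telescopes to [a i.+1 - a 0]. The second adds [a 0] back, because the vanishing
   total leaves only [- N.+2%:R * a 0] in the weighted sum. *)
transitivity (\sum_(0 <= j < N.+1) ((j < i.+1)%N%:R * (a j.+1 - a j) -
    N.+2%:R^-1 * ((N.+1%:R - j%:R) * (a j.+1 - a j)))).
  rewrite sumrB (sum_telescope_lt _ (leqW iN)) -mulr_sumr sum_telescope_weighted a_sum.
  by field.
apply: eq_big_nat => j /andP[_ jN].
rewrite a_diff// /ctrl_coef (_ : (_ < _)%R = (j < i.+1)%N); last by lia.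
rewrite (_ : N%:Z + 2 - (- N%:Z + (j.*2)%:Z) = 2 * (N.+1%:Z - j%:Z)); last by lia.
rewrite intrM intrB addn2 /=.
rewrite -[N.+1%:~R]/(N.+1%:R) -[j%:~R]/(j%:R) -[2%:~R]/(2%:R).
move: N2; move: (N.+2%:R) (N.+1%:R) (j%:R : R) (a _) (a _) => n2 n1 rj b c n20.
by field.
Qed.

Lemma dalembert_piecesP (N M : nat) (T tau0 : R) (k : int) (v r : R * R -> R)
    (u : int -> R -> R) (wp wm : R -> R) :
  T = lam R N * M%:R + tau0 -> is_control N T u -> k \in Js N ->
  dalembert N T k v r (u k) wp wm -> dalembert_pieces N M T tau0 k v r u wp wm.
Proof.
move=> TE cu kJ dal; have [t1 t3] := t_last N M tau0.
have off1 : {ae mu2 R, forall p, forall m, p.1 + 1 * p.2 <> z_plus R N k + t_ N tau0 m}.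
  by apply: ae_countable => m; exact: ae_off_line.
have offN1 : {ae mu2 R, forall p, forall m, p.1 + -1 * p.2 <> z_minus R N k + t_ N tau0 m}.
  by apply: ae_countable => m; exact: ae_off_line.
have off0 : {ae mu2 R, forall p, forall m, p.1 + 0 * p.2 <> t_ N tau0 m}.
  by apply: ae_countable => m; exact: ae_off_line.
have off := ae_imply2 offN1 off0 (fun p => @conj _ _).
apply: (ae_imply2 dal (ae_imply2 off1 off (fun p => @conj _ _))).
move=> p hp; case=> o1; case=> oN1 o0 cp; have [vE rE] := hp cp.
case: (cp) => /=; rewrite /I_T /I_x /= !in_itv /= => /andP[p10 p1T] /andP[p2l p2r].
have Te : T = t_ N tau0 (2 * M + 1) by rewrite t1.
have nE := node_itv (R := R) N k; rewrite {1}nE in p2r.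
have [mp [zp [mpM zpI zpE]]] : exists m z', [/\ (m < 2 * M + 3)%N,
    z' \in `]0, tau N tau0 m[ & p.1 + p.2 - z_plus R N k = z' + t_ N tau0 m].
  apply: t_pieces; rewrite ?z_plusE ?t3 -?TE; [lra|lra|].
  by move=> m e; apply: (o1 m); rewrite z_plusE -e; ring.
have [mm [zm [mmM zmI zmE]]] : exists m z', [/\ (m < 2 * M + 3)%N,
    z' \in `]0, tau N tau0 m[ & p.1 - p.2 - z_minus R N k = z' + t_ N tau0 m].
  apply: t_pieces; rewrite ?z_minusE ?t3 -?TE; [lra|lra|].
  by move=> m e; apply: (oN1 m); rewrite z_minusE -e; ring.
have [ml [zu [mlM zuI zuE]]] : exists m z', [/\ (m < 2 * M + 1)%N,
    z' \in `]0, tau N tau0 m[ & p.1 = z' + t_ N tau0 m].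
  by apply: t_pieces; rewrite -?Te// => m e; apply: (o0 m); rewrite mul0r addr0.
have eqp : p.1 + p.2 = zp + (z_plus R N k + t_ N tau0 mp).
  by rewrite -[LHS](subrK (z_plus R N k)) zpE; ring.
have eqm : p.1 - p.2 = zm + (z_minus R N k + t_ N tau0 mm).
  by rewrite -[LHS](subrK (z_minus R N k)) zmE; ring.
rewrite (addnS _ 2) ltnS in mpM; rewrite (addnS _ 2) ltnS in mmM.
rewrite addn1 ltnS in mlM; exists mp, mm, ml, zp, zm, zu; split.
- by split.
- by split.
- by split.
- by rewrite /w_plus_piece /w_minus_piece -eqp -eqm.
rewrite /w_plus_piece /w_minus_piece -eqp -eqm rE; congr (_ + _).
rewrite (control_inversion cu) ?in_itv /= ?(ltW p10) ?(ltW p1T)//.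
by apply: eq_bigr => n _; rewrite /u_piece -zuE.
Qed.

End pieces.

(** * Gluing and interpolating absolutely continuous functions *)

Section absolutely_continuous.
Context {R : realType}.
Local Notation mu := (@lebesgue_measure R).
Implicit Types (a b c l p q t x y z : R) (w g : R -> R).

(** Stopping at both ends yields the density cut off to a closed interval. The open one, two points
    smaller, matches the indicators of the open segments in the glued gradient pointwise. *)
Lemma acf_clamp_oo al be w g : al <= be -> acf w g ->
  acf (fun x => w (Num.min (Num.max x al) be)) (g \_ `]al, be[%classic).
Proof.
move=> ab wg; have [_ gi wgE] := wg.
have [_ _ E] := acf_max al (acf_min be wg).
split; [|exact: intg_patch|].
  case: wg => l2 _ _; rewrite patch_indic_mul.
  by apply: (@Lfun2_mul_bounded _ _ _ _ 1) => //; exact: indic_le1.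
move=> x y xy; rewrite E//.
rewrite [LHS]Rintegral_mkcond [RHS]Rintegral_mkcond; apply: ae_Rintegral.
- by apply: (@intg_measurable _ _ _ mu); repeat apply: intg_patch => //.
- by apply: (@intg_measurable _ _ _ mu); repeat apply: intg_patch => //.
apply: (ae_imply2 (ae_neq al) (ae_neq be)) => z /eqP za /eqP zb.
rewrite !patchE !mem_setE !in_itv /= !andbT.
case: (x <= z <= y) => //.
rewrite !le_eqVlt (eq_sym al) (negbTE za) (negbTE zb) /=.
by case: (al < z); case: (z < be).
Qed.

Lemma acf_shift c w g : acf w g -> acf (fun x => w (x + c)) (fun x => g (x + c)).
Proof.
move=> /(acf_affine c (mulr1 1)); congr acf; apply/funext => x; rewrite !mul1r addrC//.
Qed.

Lemma acf_reflect c w g : acf w g -> acf (fun x => w (c - x)) (fun x => - g (c - x)).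
Proof.
have NN1 : -1 * -1 = 1 :> R by rewrite mulrNN mulr1.
by move=> /(acf_affine c NN1); congr acf; apply/funext => x; rewrite !mulN1r.
Qed.

Lemma acf_sum (I : Type) (s : seq I) (w g : I -> R -> R) :
  (forall i, acf (w i) (g i)) ->
  acf (fun x => \sum_(i <- s) w i x) (fun x => \sum_(i <- s) g i x).
Proof.
move=> acw; elim: s => [|i s IH].
  have E (F : I -> R -> R) : (fun x => \sum_(i <- [::]) F i x) = (fun=> 0).
    by apply/funext => x; rewrite big_nil.
  by rewrite !E; exact: acf_cst.
have E (F : I -> R -> R) : (fun x => \sum_(j <- i :: s) F j x) =
    F i \+ (fun x => \sum_(j <- s) F j x).
  by apply/funext => x; rewrite big_cons.
by rewrite !E; exact: acf_add.
Qed.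

Definition AC w := exists g, acf w g.

Lemma AC_cst k : AC (fun=> k).
Proof. by exists (fun=> 0); exact: acf_cst. Qed.

Lemma AC_add w1 w2 : AC w1 -> AC w2 -> AC (w1 \+ w2).
Proof. by move=> [g1 h1] [g2 h2]; exists (g1 \+ g2); exact: acf_add. Qed.

Lemma AC_scale k w : AC w -> AC (fun x => k * w x).
Proof. by move=> [g h]; exists (fun x => k * g x); exact: acf_scale. Qed.

Lemma AC_sub w1 w2 : AC w1 -> AC w2 -> AC (w1 \- w2).
Proof.
move=> h1 /(AC_scale (-1)) h2; have := AC_add h1 h2; congr AC.
by apply/funext => x /=; rewrite mulN1r.
Qed.

Lemma AC_shift c w : AC w -> AC (fun x => w (x + c)).
Proof. by move=> [g /(acf_shift c) h]; exists (fun x => g (x + c)). Qed.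

Lemma AC_reflect c w : AC w -> AC (fun x => w (c - x)).
Proof. by move=> [g /(acf_reflect c) h]; exists (fun x => - g (c - x)). Qed.

Lemma AC_sum (I : Type) (s : seq I) (w : I -> R -> R) :
  (forall i, AC (w i)) -> AC (fun x => \sum_(i <- s) w i x).
Proof.
move=> /choice[g wg]; exists (fun x => \sum_(i <- s) g i x); exact: acf_sum.
Qed.

(** The glued function is [w1] stopped at [c] plus [w2] started at [c], minus their common value
    there, so no separate argument at the junction is needed. *)
Lemma AC_glue c w1 w2 : AC w1 -> AC w2 -> w1 c = w2 c ->
  AC (fun x => if x <= c then w1 x else w2 x).
Proof.
move=> [g1 h1] [g2 h2] e; have h1' := acf_min c h1; have h2' := acf_max c h2.
have : AC ((fun x => w1 (Num.min x c)) \+ (fun x => w2 (Num.max x c)) \- (fun=> w1 c)).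
  by apply: AC_sub (AC_cst _); apply: AC_add; [exists (g1 \_ `]-oo, c])|exists (g2 \_ `[c, +oo[)].
congr AC; apply/funext => x /=; have [xc|cx] := leP x c; rewrite ?e; ring.
Qed.

Lemma AC_interpolation a b p q : a < b ->
  exists w, [/\ AC w, w a = p & w b = q].
Proof.
move=> ab; exists (fun x => p + (q - p) / (b - a) * (Num.min (Num.max x a) b - a)).
split.
- apply: AC_add (AC_cst _) _; apply: AC_scale; apply: AC_sub (AC_cst _).
  by exists (\1_(`[a, b]%classic)); apply: acf_clamp; exact: ltW.
- by rewrite maxxx min_l ?ltW// subrr mulr0 addr0.
rewrite max_l ?ltW// minxx divfK ?subr_eq0 ?gt_eqF//; ring.
Qed.

(* Sending a prescribed trace L through the left end of a segment: on [0, l]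
   and [T, T + l] the waves are given, and in between there is room to
   interpolate since 2 * l < T. *)
Lemma wave_fill l T (a0 b0 aT bT L : R -> R) : 0 < l -> 2 * l < T ->
  AC a0 -> AC b0 -> AC aT -> AC bT -> AC L ->
  L 0 = a0 0 + b0 l -> L T = aT T + bT (T + l) ->
  exists A B, [/\ AC A, AC B,
    forall s, s \in `[0, l] -> A s = a0 s /\ B s = b0 s,
    forall s, s \in `[T, T + l] -> A s = aT s /\ B s = bT s &
    forall t, t \in `[0, T] -> A t + B (t + l) = L t].
Proof.
move=> l0 lT ca0 cb0 caT cbT cL L0 LT.
have [m [cm m0 mT]] := @AC_interpolation l (T - l) (a0 l) (L (T - l) - bT (T - l + l)) ltac:(lra).
(* On [[T - l, T]] the choice is dictated by [B]: the relation [A s + B (s + l) = L s] must return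
   the prescribed [bT (s + l)]. The interpolation [m] joins this to [a0], which takes
   [l < T - l]. *)
pose A s := if s <= l then a0 s else if s <= T - l then m s else
  if s <= T then L s - bT (s + l) else aT s.
have cA : AC A.
  apply: AC_glue => //; last by rewrite ifT//; lra.
  apply: AC_glue => //; last by rewrite ifT//; lra.
  apply: AC_glue => //; last by rewrite LT; ring.
  by apply: AC_sub => //; exact: AC_shift.
(* Past [l] the required trace determines [B]; continuity at [l] is the compatibility condition on
   [L 0]. *)
pose B s := if s <= l then b0 s else L (s + - l) - A (s + - l).
have cB : AC B.
  apply: AC_glue => //; last by rewrite subrr L0 /A ifT; [ring|lra].
  by apply: AC_sub; exact: AC_shift.
exists A, B; split => // [s|s|t]; rewrite in_itv /= => /andP[s0 s1].
- by rewrite /A /B s1.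
- split.
    rewrite /A ifF; last by apply/negbTE; rewrite -ltNge; lra.
    rewrite ifF; last by apply/negbTE; rewrite -ltNge; lra.
    have [sT|//] := leP s T.
    by have -> : s = T by [apply/le_anti; rewrite s0 sT]; rewrite LT; ring.
  rewrite /B ifF; last by apply/negbTE; rewrite -ltNge; lra.
  rewrite /A ifF; last by apply/negbTE; rewrite -ltNge; lra.
  have [sT|sT] := leP (s + - l) (T - l).
    have -> : s + - l = T - l by apply/le_anti; rewrite sT lerD2r s0.
    by rewrite mT (_ : T - l + l = s); [ring|lra].
  by rewrite ifT ?subrK; [ring|lra].
rewrite /B; have [tl|tl] := leP (t + l) l.
  by have -> : t = 0 by [apply/le_anti; rewrite s0 andbT; lra]; rewrite /A ifT ?add0r//; lra.
by rewrite -[t + l + - l]addrA subrr addr0; ring.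
Qed.

End absolutely_continuous.

(** * Construction of the waves *)

Section wave_chain.
Context {R : realType}.
Variables (l T a : R) (V0 P0 V1 P1 : R -> R).
Hypotheses (l0 : 0 < l) (lT : 2 * l < T).
Hypotheses (cV0 : AC V0) (cP0 : AC P0) (cV1 : AC V1) (cP1 : AC P1).

Local Notation nd i := (a + i%:R * l).

(** The fields of segment [i] are built from [A (t + x - nd i)] and [B (t - x + nd i.+1)]; with
    these shifts both waves of every segment use arguments in [[0, T + l]]. The half sums and
    differences are d'Alembert's formula for the data at times 0 and [T]. *)
Definition segment_waves (i : nat) (L : R -> R) (AB : (R -> R) * (R -> R)) : Prop :=
  [/\ AC AB.1, AC AB.2,
    forall x, x \in `[nd i, nd i.+1] ->
      AB.1 (x - nd i) = (V0 x + P0 x) / 2 /\ AB.2 (nd i.+1 - x) = (V0 x - P0 x) / 2,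
    forall x, x \in `[nd i, nd i.+1] ->
      AB.1 (T + x - nd i) = (V1 x + P1 x) / 2 /\
      AB.2 (T + nd i.+1 - x) = (V1 x - P1 x) / 2 &
    forall t, t \in `[0, T] -> AB.1 t + AB.2 (t + l) = L t].

Definition left_data (i : nat) (L : R -> R) : Prop :=
  [/\ AC L, L 0 = V0 (nd i) & L T = V1 (nd i)].

Lemma node_succ i : nd i.+1 = nd i + l.
Proof. by rewrite -natr1; ring. Qed.

Lemma segment_step i L : left_data i L -> exists AB, segment_waves i L AB.
Proof.
move=> [cL L0 LT].
have half_AC (w : R -> R) : AC w -> AC (fun s => w s / 2).
  by move=> /(AC_scale 2^-1); congr AC; apply/funext => s; rewrite mulrC.
have [|||||||A [B [cA cB init term sum]]] := @wave_fill R l T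
    (fun s => (V0 (s + nd i) + P0 (s + nd i)) / 2)
    (fun s => (V0 (nd i.+1 - s) - P0 (nd i.+1 - s)) / 2)
    (fun s => (V1 (s + (nd i - T)) + P1 (s + (nd i - T))) / 2)
    (fun s => (V1 (T + nd i.+1 - s) - P1 (T + nd i.+1 - s)) / 2) L l0 lT.
- by apply: half_AC; apply: AC_add; exact: AC_shift.
- by apply: half_AC; apply: AC_sub; exact: AC_reflect.
- by apply: half_AC; apply: AC_add; exact: AC_shift.
- by apply: half_AC; apply: AC_sub; exact: AC_reflect.
- exact: cL.
- by rewrite L0 add0r node_succ addrK; field.
- rewrite LT node_succ (_ : T + (nd i - T) = nd i); last by ring.
  by rewrite (_ : T + (nd i + l) - (T + l) = nd i); [field|ring].
exists (A, B); split => //= x; rewrite in_itv /= node_succ => /andP[x1 x2].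
- have [s1 s2] : x - nd i \in `[0, l] /\ nd i + l - x \in `[0, l].
    by rewrite !in_itv /=; split; lra.
  rewrite (init _ s1).1 (init _ s2).2 subrK node_succ.
  by rewrite (_ : nd i + l - (nd i + l - x) = x); [|ring].
- have [s1 s2] : T + x - nd i \in `[T, T + l] /\ T + (nd i + l) - x \in `[T, T + l].
    by rewrite !in_itv /=; split; lra.
  rewrite (term _ s1).1 (term _ s2).2 node_succ (_ : T + x - nd i + (nd i - T) = x); last by ring.
  by rewrite (_ : T + (nd i + l) - (T + (nd i + l) - x) = x); [|ring].
Qed.

Lemma wave_chain : exists A B : nat -> R -> R,
  [/\ forall i, AC (A i) /\ AC (B i),
    forall i x, x \in `[nd i, nd i.+1] ->
      A i (x - nd i) = (V0 x + P0 x) / 2 /\ B i (nd i.+1 - x) = (V0 x - P0 x) / 2,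
    forall i x, x \in `[nd i, nd i.+1] ->
      A i (T + x - nd i) = (V1 x + P1 x) / 2 /\
      B i (T + nd i.+1 - x) = (V1 x - P1 x) / 2 &
    forall i t, t \in `[0, T] -> A i (t + l) + B i t = A i.+1 t + B i.+1 (t + l)].
Proof.
(* Waves are selected for every function [L], with a dummy pair for inadmissible ones, so that the
   recursion from segment to segment can be defined before admissibility is proved by induction. *)
have /choice[F Fspec] : forall iL : nat * (R -> R), exists AB,
    left_data iL.1 iL.2 -> segment_waves iL.1 iL.2 AB.
  move=> [i L] /=; have [/segment_step[AB sAB]|nL] := pselect (left_data i L).
    by exists AB.
  by exists (L, L) => /nL.
have T0 : 0 < T by move: l0 lT; lra.
(* No boundary condition constrains [v] at the left end of the rod: any trace compatible with the
   initial and terminal values will do. *)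
have [L0 [cL0 L00 L0T]] := AC_interpolation (V0 (nd 0)) (V1 (nd 0)) T0.
pose right AB (t : R) : R := AB.1 (t + l) + AB.2 t.
pose Ls := fix Ls (i : nat) : R -> R :=
  if i is j.+1 then right (F (j, Ls j)) else L0.
have right_end i : nd i.+1 \in `[nd i, nd i.+1].
  by rewrite in_itv /= lexx node_succ lerDl ltW.
have good i : left_data i (Ls i).
  elim: i => [//|i /(Fspec (i, _)) /= [c1 c2 init term _]]; split => /=.
  - by apply: AC_add => //; exact: AC_shift.
  - have [e1 e2] := init _ (right_end i); rewrite subrr in e2.
    rewrite node_succ (_ : nd i + l - nd i = l) in e1; last by ring.
    by rewrite /right add0r e1 e2 node_succ; field.
  - have [e1 e2] := term _ (right_end i); rewrite addrK in e2.
    rewrite node_succ (_ : T + (nd i + l) - nd i = T + l) in e1; last by ring.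
    by rewrite /right e1 e2 node_succ; field.
have S i := Fspec (i, Ls i) (good i).
exists (fun i => (F (i, Ls i)).1), (fun i => (F (i, Ls i)).2); split.
- by move=> i; case: (S i).
- by move=> i; case: (S i).
- by move=> i; case: (S i).
by move=> i t tT; case: (S i.+1) => _ _ _ _ /(_ t tT) /= ->.
Qed.

End wave_chain.

(** * Gluing the segments *)

Section plane_L2.
Context {R : realType}.
Local Notation mu := (@lebesgue_measure R).

Lemma L2_shear (s T a b : R) (g : R -> R) : s * s = 1 -> g \in Lfun mu 2%:E ->
  L2 (mu2 R) (`]0, T[%classic `*` `]a, b[%classic) (fun p => g (p.1 + s * p.2)).
Proof.
move=> ss1 g2; pose f (p : R * R) : R := \1_(`]0, T[%classic) p.1 * g p.2.
have /Lfun2P[mf f2] : f \in Lfun (mu2 R) 2%:E.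
  by apply: Lfun2_tensor => //; apply: Lfun2_indic => //; exact: lebesgue_measure_itv_oo_lty.
have F2 : (fun p => f (shear s p)) \in Lfun (mu2 R) 2%:E.
  apply/Lfun2P; split; first exact: (measurableT_comp mf (measurable_shear s)).
  exact: (integrable_shear ss1 f2).
rewrite /L2 (_ : _ \_ _ = (fun p => f (shear s p)) \* (\1_(`]a, b[%classic) \o snd)).
  apply: (@Lfun2_mul_bounded _ _ _ _ 1) => //; last by move=> p; exact: indic_le1.
  by apply: (measurableT_comp _ measurable_snd); exact: measurable_indic.
apply/funext => p; rewrite patchE /f /= !indicE in_setX.
by case: (p.1 \in _) => /=; case: (p.2 \in _); rewrite ?mul1r ?mulr1 ?mulr0 ?mul0r.
Qed.

Lemma L2_indic_snd (D : set (R * R)) (a b : R) (f : R * R -> R) : L2 (mu2 R) D f ->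
  L2 (mu2 R) D (fun p => \1_(`]a, b[%classic) p.2 * f p).
Proof.
move=> f2; rewrite /L2 (_ : _ \_ _ = (f \_ D) \* (\1_(`]a, b[%classic) \o snd)).
  apply: (@Lfun2_mul_bounded _ _ _ _ 1) => //; last by move=> p; exact: indic_le1.
  by apply: (measurableT_comp _ measurable_snd); exact: measurable_indic.
by apply/funext => p; rewrite /= !patchE; case: ifP; rewrite ?mul0r// mulrC.
Qed.

Lemma L2_sum (D : set (R * R)) (I : Type) (r : seq I) (f : I -> R * R -> R) :
  (forall i, L2 (mu2 R) D (f i)) -> L2 (mu2 R) D (fun p => \sum_(i <- r) f i p).
Proof.
move=> f2; elim: r => [|i r IH].
  rewrite /L2 (_ : _ \_ _ = (fun=> 0)).
    by apply/Lfun2P; split => //; rewrite (_ : (fun=> _) = (fun=> 0));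
      [exact: integrable0|apply/funext => ? /=; rewrite expr0n].
  by apply/funext => p; rewrite patchE big_nil; case: ifP.
by apply: eq_L2 (L2_add (f2 i) IH) => p _; rewrite big_cons.
Qed.

Lemma L2_continuous (T a b : R) (v : R * R -> R) : continuous v ->
  L2 (mu2 R) (`]0, T[%classic `*` `]a, b[%classic) v.
Proof.
move=> cv; have [C vC] := continuous_bounded_compact (@compact_closure_rect R 0 T a b) cv.
have mD : measurable (`]0, T[%classic `*` `]a, b[%classic : set (R * R)).
  exact: measurableX.
apply: (@L2_bounded _ _ _ _ C) => //.
- exact: rect_finite.
- rewrite patch_indic_mul; apply: measurable_funM; first exact: measurable_continuous2.
  exact: measurable_indic.
- by move=> p Dp; apply: vC; exact: subset_closure.
Qed.

End plane_L2.

Section gluing.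
Context {R : realType}.
Local Notation mu := (@lebesgue_measure R).
Variables (N : nat) (l T a : R) (w1 w2 w3 g1 g2 g3 : nat -> R -> R).
Hypotheses (N0 : (0 < N)%N) (l0 : 0 < l) (T0 : 0 < T).
Hypotheses (wg1 : forall i, acf (w1 i) (g1 i)) (wg2 : forall i, acf (w2 i) (g2 i))
  (wg3 : forall i, acf (w3 i) (g3 i)).

Local Notation nd i := (a + i%:R * l).

Definition segment_wave i t x : R := w1 i (t + x) + w2 i (t - x) + w3 i t.

Hypothesis matching : forall i t, (i.+1 < N)%N -> t \in `[0, T] ->
  segment_wave i t (nd i.+1) = segment_wave i.+1 t (nd i.+1).

Definition clamp i x : R := Num.min (Num.max x (nd i)) (nd i.+1).

(** The value at the left end of the rod plus the increments over the segments, each stopped outside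
    its own segment by [clamp]. This is continuous on the whole plane by construction; [matching]
    enters only in identifying it with the wave of a segment. *)
Definition glued (p : R * R) : R := segment_wave 0 p.1 (nd 0) +
  \sum_(0 <= i < N) (segment_wave i p.1 (clamp i p.2) - segment_wave i p.1 (nd i)).

Definition glued_t (p : R * R) : R := \sum_(0 <= i < N)
  \1_(`]nd i, nd i.+1[%classic) p.2 * (g1 i (p.1 + p.2) + g2 i (p.1 - p.2) + g3 i p.1).

Definition glued_x (p : R * R) : R := \sum_(0 <= i < N)
  \1_(`]nd i, nd i.+1[%classic) p.2 * (g1 i (p.1 + p.2) - g2 i (p.1 - p.2)).

Lemma nd_le i j : (i <= j)%N -> nd i <= nd j.
Proof. by move=> ij; rewrite lerD2l ler_pM2r// ler_nat. Qed.

(** Segments to the right contribute nothing; those to the left contribute full increments, which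
    telescope because [matching] equates the two values at each interior node. *)
Lemma gluedE j t x : (j < N)%N -> t \in `[0, T] -> x \in `[nd j, nd j.+1] ->
  glued (t, x) = segment_wave j t x.
Proof.
move=> jN tT; rewrite in_itv /= => /andP[jx xj]; rewrite /glued /=.
rewrite (big_cat_nat (n := j))//=; last exact: ltnW.
rewrite (big_ltn jN) [X in _ + (_ + (_ + X))](eq_big_nat _ _ (F2 := fun=> 0)); last first.
  move=> i /andP[ji _]; have xi : x <= nd i by apply: le_trans xj _; exact: nd_le.
  by rewrite /clamp max_r// min_l ?subrr//; exact: nd_le.
rewrite big1_eq addr0 /clamp max_l// min_l//.
rewrite (eq_big_nat _ _ (F2 := fun i => segment_wave i.+1 t (nd i.+1) - segment_wave i t (nd i))).
  by rewrite (telescope_sumr (fun i => segment_wave i t (nd i)))//; ring.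
move=> i /andP[_ ij].
have ix : nd i.+1 <= x by apply: le_trans jx; exact: nd_le.
rewrite max_l ?min_r ?matching//; first exact: leq_ltn_trans jN.
by apply: le_trans ix; exact: nd_le.
Qed.

Lemma continuous_wave (w : R -> R) (s : R) : continuous w ->
  continuous (fun p : R * R => w (p.1 + s * p.2)).
Proof.
move=> cw p; apply: (@cvg_comp _ _ _ (fun p : R * R => p.1 + s * p.2) w); last exact: cw.
by apply: cvgD; [exact: cvg_fst|apply: cvgM; [exact: cvg_cst|exact: cvg_snd]].
Qed.

Lemma glued_continuous : continuous glued.
Proof.
have cs i : continuous (fun p : R * R => segment_wave i p.1 p.2).
  have c1 : continuous (fun p : R * R => w1 i (p.1 + p.2)).
    by have := continuous_wave (s := 1) (acf_continuous (wg1 i)); under eq_fun do rewrite mul1r.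
  have c2 : continuous (fun p : R * R => w2 i (p.1 - p.2)).
    by have := continuous_wave (s := -1) (acf_continuous (wg2 i)); under eq_fun do rewrite mulN1r.
  have c3 : continuous (fun p : R * R => w3 i p.1).
    have := continuous_wave (s := 0) (acf_continuous (wg3 i)).
    by under eq_fun do rewrite mul0r addr0.
  by move=> p; apply: cvgD; [apply: cvgD; [exact: c1|exact: c2]|exact: c3].
have cc (h : R -> R) i : continuous h -> continuous (fun p : R * R => segment_wave i p.1 (h p.2)).
  move=> ch p.
  apply: (@continuous_comp _ _ _ (fun p : R * R => (p.1, h p.2)) (fun p => segment_wave i p.1 p.2)).
    have h2 : h q.2 @[q --> p] --> h p.2.
      by apply: (@cvg_comp _ _ _ snd h); [exact: cvg_snd|exact: ch].
    exact: (cvg_pair cvg_fst h2).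
  exact: cs.
have csum (F : nat -> R * R -> R) (r : seq nat) : (forall i, continuous (F i)) ->
    continuous (fun p => \sum_(i <- r) F i p).
  move=> cF; elim: r => [|i r IH] p.
    by under eq_fun do rewrite big_nil; exact: cvg_cst.
  by under eq_fun do rewrite big_cons; apply: cvgD; [exact: cF|exact: IH].
move=> p; apply: cvgD; first by apply: (cc (fun=> nd 0)) => x; exact: cvg_cst.
apply: csum => i q; apply: cvgB; last by apply: (cc (fun=> nd i)) => x; exact: cvg_cst.
apply: (cc (clamp i)); apply: acf_continuous; apply: acf_clamp; exact: nd_le.
Qed.

Lemma nd_cell n x : nd 0 <= x -> x <= nd n.+1 ->
  exists2 j, (j < n.+1)%N & x \in `[nd j, nd j.+1].
Proof.
move=> x0; elim: n => [|n IH] xn; first by exists 0%N; rewrite // in_itv /= x0.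
have [xn'|nx] := leP x (nd n.+1).
  by have [j jn xj] := IH xn'; exists j => //; exact: ltnW.
by exists n.+1; rewrite // in_itv /= ltW.
Qed.

Lemma sum_cell j x (F : nat -> R) : (j < N)%N -> x \in `]nd j, nd j.+1[ ->
  \sum_(0 <= i < N) \1_(`]nd i, nd i.+1[%classic) x * F i = F j.
Proof.
move=> jN xj; rewrite (bigD1_seq j) ?iota_uniq ?mem_index_iota//= big1 => [|i ij].
  by rewrite indicE mem_set// mul1r addr0.
rewrite indicE memNset ?mul0r//= in_itv /= => /andP[ix xi].
move: xj; rewrite in_itv /= => /andP[jx xj].
case: (ltgtP i j) ij => // /nd_le h _.
  by have := lt_le_trans xi h; rewrite ltNge (ltW jx).
by have := lt_le_trans xj h; rewrite ltNge (ltW ix).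
Qed.

(** Slice by slice: almost every [x] avoids the nodes, so in [t] the function is a sum of shifted
    waves of one segment; for fixed [t] it is a sum of clamped waves in [x], absolutely continuous
    across the nodes. *)
Lemma glued_weak_grad :
  weak_grad (`]0, T[%classic `*` `]nd 0, nd N[%classic) glued glued_t glued_x.
Proof.
have [n Nn] : exists n, N = n.+1 by exists N.-1; rewrite prednK.
have NN1 : -1 * -1 = 1 :> R by rewrite mulrNN mulr1.
have L1 i : L2 (mu2 R) (`]0, T[%classic `*` `]nd 0, nd N[%classic) (fun p => g1 i (p.1 + p.2)).
  apply: eq_L2 (@L2_shear R 1 T (nd 0) (nd N) (g1 i) (mulr1 1) _) => [p _|].
    by rewrite mul1r.
  by case: (wg1 i).
have L2' i : L2 (mu2 R) (`]0, T[%classic `*` `]nd 0, nd N[%classic) (fun p => g2 i (p.1 - p.2)).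
  apply: eq_L2 (@L2_shear R (-1) T (nd 0) (nd N) (g2 i) NN1 _) => [p _|].
    by rewrite mulN1r.
  by case: (wg2 i).
have L3 i : L2 (mu2 R) (`]0, T[%classic `*` `]nd 0, nd N[%classic) (fun p => g3 i p.1).
  by apply: L2_fst; rewrite /L2 patch_indic_mul; apply: (@Lfun2_mul_bounded _ _ _ _ 1) => //;
    [case: (wg3 i)|exact: indic_le1].
apply: weak_grad_slices => //.
- by rewrite ltrD2l ltr_pM2r// ltr_nat.
- exact/L2_continuous/glued_continuous.
- apply: L2_sum => i; apply: L2_indic_snd; apply: L2_add (L3 i); apply: L2_add (L1 i) (L2' i).
- apply: L2_sum => i; apply: L2_indic_snd; apply: eq_L2 (L2_add (L1 i) (L2_scale (-1) (L2' i))).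
  by move=> p _ /=; rewrite mulN1r.
- have : {ae mu, forall x, forall i : nat, x <> nd i}.
    by apply: ae_countable => i; exact: ae_neq.
  move=> /ae_imply; apply => x xnd; rewrite in_itv /= => /andP[x0 xN].
  have [j jN xj] : exists2 j, (j < N)%N & x \in `]nd j, nd j.+1[.
    have [|j jn] := @nd_cell n x (ltW x0); first by rewrite -Nn ltW.
    rewrite in_itv /= !le_eqVlt => /andP[/orP[/eqP/esym/xnd//|jx] /orP[/eqP/xnd//|xj]].
    by exists j; rewrite ?Nn// in_itv /= jx.
  have wg := acf_add (acf_add (acf_shift x (wg1 j)) (acf_shift (- x) (wg2 j))) (wg3 j).
  case: (wg) => _ gi wE; eexists; eexists; split; [exact: gi|exact: wE|] => t tT.
  split; last exact: (sum_cell (fun i => g1 i (t + x) + g2 i (t - x) + g3 i t) jN xj).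
  by rewrite (gluedE jN)//; exact: subset_itv_oo_cc.
apply: aeW => t _.
have acx i : acf (fun x => segment_wave i t x) (fun x => g1 i (t + x) - g2 i (t - x)).
  have := acf_add (acf_add (acf_shift t (wg1 i)) (acf_reflect t (wg2 i))) (acf_cst (w3 i t)).
  by congr acf; apply/funext => x /=; rewrite ?addr0 (addrC x).
have wg := acf_add (acf_cst (segment_wave 0 t (nd 0))) (acf_sum (index_iota 0 N)
  (fun i => acf_add (acf_clamp_oo (nd_le (leqnSn i)) (acx i)) (acf_cst (- segment_wave i t (nd i))))).
case: (wg) => _ gi wE; eexists; eexists; split; [exact: gi|exact: wE|] => x _; split => //=.
rewrite /glued_x /= add0r; apply: eq_bigr => i _.
by rewrite addr0 patch_indic_mul /= mulrC.
Qed.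

End gluing.

(** * Traces, controls and existence *)

Section traces.
Context {R : realType}.

(** The constant sequence [v] is admissible in the definition of the trace, so all limits are
    trivial. *)
Lemma continuous_has_trace (D : set (R * R)) (v vt vx : R * R -> R) (c d : R)
    (gam : R -> R * R) (g : R -> R) :
  continuous v -> weak_grad D v vt vx -> continuous gam ->
  (forall s, s \in `]c, d[ -> v (gam s) = g s) -> has_trace D v `]c, d[ gam g.
Proof.
move=> cv wv cgam vg.
have cvg : continuous (v \o gam) by move=> s; apply: continuous_comp; [exact: cgam|exact: cv].
split.
  have [C vC] := continuous_bounded_itv c d cvg.
  apply: (@L2_bounded _ _ _ _ C) => //; first exact: lebesgue_measure_itv_oo_lty.
    rewrite (_ : _ \_ _ = (v \o gam) \_ `]c, d[%classic).
      rewrite patch_indic_mul; apply: measurable_funM; first exact: measurable_continuous.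
      exact: measurable_indic.
    by apply/funext => s; rewrite !patchE mem_setE; case: ifP => // /vg.
  by move=> s scd; rewrite -vg//; apply: vC; exact: subset_itv_oo_cc.
exists (fun=> v); split => [_||].
- exact: continuous_subspaceT.
- exists (fun=> vt), (fun=> vx), vt, vx; split => //.
  rewrite (_ : (fun=> _) = (fun=> 0%E)); first exact: cvg_cst.
  apply/funext => _; rewrite integral0_eq// => p _.
  by rewrite !subrr expr0n /= !addr0.
- rewrite (_ : (fun=> _) = (fun=> 0%E)); first exact: cvg_cst.
  by apply/funext => _; rewrite integral0_eq// => s scd; rewrite vg// subrr expr0n.
Qed.

End traces.

(** * The fields of the rod *)

Section rod_waves.
Context {R : realType}.
Variables (N : nat) (T : R) (A B U gA gB gU : nat -> R -> R).
Hypotheses (N0 : (0 < N)%N) (T0 : 0 < T).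
Hypotheses (acA : forall i, acf (A i) (gA i)) (acB : forall i, acf (B i) (gB i))
  (acU : forall i, acf (U i) (gU i)).

Local Notation l := (lam R N).
Local Notation nd i := (-1 + i%:R * l).

Lemma rod_nodeS i : nd i.+1 = nd i + l.
Proof. by rewrite -natr1; ring. Qed.

Lemma rod_node0 : nd 0 = -1.
Proof. by rewrite mul0r addr0. Qed.

Lemma rod_nodeN : nd N = 1.
Proof. by rewrite /lam mulrC divfK ?pnatr_eq0 -?lt0n//; ring. Qed.

(** Both fields are glued from the same waves, with [B] entering [v] and [r] with opposite signs and
    [U] added to [r]. The densities therefore satisfy the first-order system pointwise, the density
    of [U] acting as the force. *)
Lemma rod_waves :
  (forall i t, t \in `[0, T] -> A i (t + l) + B i t = A i.+1 t + B i.+1 (t + l)) ->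
  (forall i t, (i.+1 < N)%N -> t \in `[0, T] ->
    A i (t + l) - B i t + U i.+1 t = A i.+1 t - B i.+1 (t + l) + U i.+2 t) ->
  exists v r vt vx rt rx : R * R -> R,
    [/\ continuous v /\ continuous r,
      weak_grad (Omega T) v vt vx,
      weak_grad (Omega T) r rt rx,
      forall p, vt p = rx p /\ vx p = rt p -
        \sum_(0 <= i < N) \1_(`]nd i, nd i.+1[%classic) p.2 * gU i.+1 p.1 &
      forall i t x, (i < N)%N -> t \in `[0, T] -> x \in `[nd i, nd i.+1] ->
        v (t, x) = A i (t + x - nd i) + B i (t - x + nd i.+1) /\
        r (t, x) = A i (t + x - nd i) - B i (t - x + nd i.+1) + U i.+1 t].
Proof.
move=> matchv matchr; have l0 : 0 < l := lam_gt0 N0.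
pose w1 i z := A i (z + - nd i); pose g1 i z := gA i (z + - nd i).
pose w2 (s : R) i z := s * B i (z + nd i.+1); pose g2 (s : R) i z := s * gB i (z + nd i.+1).
have ac1 i : acf (w1 i) (g1 i) by exact: acf_shift.
have ac2 s i : acf (w2 s i) (g2 s i) by exact/acf_scale/acf_shift.
have ac3v (i : nat) : acf (fun=> 0 : R) (fun=> 0) by exact: acf_cst.
have ac3r i : acf (U i.+1) (gU i.+1) by [].
have simp1 t i : t + nd i.+1 + - nd i = t + l by rewrite rod_nodeS; ring.
have simp2 t i : t + nd i + - nd i = t by ring.
have simp3 t i : t - nd i + nd i = t by ring.
have simp4 t i : t - nd i + nd i.+1 = t + l by rewrite rod_nodeS; ring.
have mv i t : (i.+1 < N)%N -> t \in `[0, T] ->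
    segment_wave w1 (w2 1) (fun _ _ => 0) i t (nd i.+1) =
    segment_wave w1 (w2 1) (fun _ _ => 0) i.+1 t (nd i.+1).
  by move=> _ tT; rewrite /segment_wave /w1 /w2 simp1 simp2 simp3 simp4 !addr0 !mul1r matchv.
have mr i t : (i.+1 < N)%N -> t \in `[0, T] ->
    segment_wave w1 (w2 (-1)) (fun i => U i.+1) i t (nd i.+1) =
    segment_wave w1 (w2 (-1)) (fun i => U i.+1) i.+1 t (nd i.+1).
  by move=> iN tT; rewrite /segment_wave /w1 /w2 simp1 simp2 simp3 simp4 !mulN1r matchr.
have OE : Omega T = `]0, T[%classic `*` `]nd 0, nd N[%classic.
  by rewrite rod_node0 rod_nodeN.
exists (glued N l (-1) w1 (w2 1) (fun _ _ => 0)),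
  (glued N l (-1) w1 (w2 (-1)) (fun i => U i.+1)),
  (glued_t N l (-1) g1 (g2 1) (fun _ _ => 0)), (glued_x N l (-1) g1 (g2 1)),
  (glued_t N l (-1) g1 (g2 (-1)) (fun i => gU i.+1)), (glued_x N l (-1) g1 (g2 (-1))).
split.
- split; [exact: (glued_continuous l0 ac1 (ac2 1) ac3v)|exact: (glued_continuous l0 ac1 (ac2 (-1)) ac3r)].
- rewrite OE; exact: (glued_weak_grad N0 l0 T0 ac1 (ac2 1) ac3v mv).
- rewrite OE; exact: (glued_weak_grad N0 l0 T0 ac1 (ac2 (-1)) ac3r mr).
- move=> p; split.
    by apply: eq_bigr => i _; rewrite /g2; ring.
  by rewrite -sumrB; apply: eq_bigr => i _; rewrite /g2; ring.
move=> i t x iN tT xi; split.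
  by rewrite (gluedE l0 mv iN tT xi) /segment_wave /w1 /w2 mul1r addr0.
by rewrite (gluedE l0 mr iN tT xi) /segment_wave /w1 /w2 mulN1r.
Qed.

End rod_waves.

(** * Controls with prescribed jumps and zero sum *)

Section zero_sum.
Context {R : realType}.

(** Partial sums have the right increments; subtracting their mean changes no increment and makes
    the total vanish. *)
Lemma zero_sum_primitive (D : nat -> R -> R) n : (forall i, AC (D i)) ->
  exists U : nat -> R -> R, [/\ forall i, AC (U i),
    forall i t, U i.+1 t - U i t = D i t &
    forall t, \sum_(0 <= i < n.+1) U i t = 0].
Proof.
move=> cD; pose S i t := \sum_(0 <= j < i) D j t.
have cS i : AC (S i) by exact: AC_sum.
exists (fun i t => S i t - n.+1%:R^-1 * \sum_(0 <= j < n.+1) S j t); split => [i|i t|t].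
- by apply: AC_sub => //; apply: AC_scale; exact: AC_sum.
- by rewrite /S big_nat_recr//=; ring.
rewrite sumrB sumr_const_nat subn0 -[X in _ - X]mulr_natl mulrA mulfV ?mul1r ?subrr// pnatr_eq0.
Qed.

(** Equal increments leave a constant difference, which equal sums force to be zero. It serves to
    read off the controls at times 0 and [T]. *)
Lemma zero_sum_unique (b c : nat -> R) n :
  (forall i, (i < n)%N -> b i.+1 - b i = c i.+1 - c i) ->
  \sum_(0 <= i < n.+1) b i = \sum_(0 <= i < n.+1) c i ->
  forall i, (i <= n)%N -> b i = c i.
Proof.
move=> bc sbc; pose e := b 0 - c 0.
have be i : (i <= n)%N -> b i = c i + e.
  elim: i => [_|i IH lin]; first by rewrite /e addrC subrK.
  by rewrite -[LHS](subrK (b i)) bc// IH ?(ltnW lin)//; ring.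
have : \sum_(0 <= i < n.+1) b i = \sum_(0 <= i < n.+1) (c i + e).
  by apply: eq_big_nat => i /andP[_]; rewrite ltnS; exact: be.
rewrite sbc big_split /= sumr_const_nat subn0 -[LHS]addr0 => /addrI/esym/eqP.
rewrite mulrn_eq0 /= => /eqP e0 i lin.
by rewrite be// e0 addr0.
Qed.

End zero_sum.

Section controls.
Context {R : realType}.

(* The functions u_k, k in J_c, are numbered from left to right as U 0, ...,
   U N.+1 (U i is u_(2i-N-1)); at indices of the other parity the differences
   required of a control are filled in. *)
Definition control_of (N : nat) (U : nat -> R -> R) (m : int) (t : R) : R :=
  let n := absz (m + N%:Z + 1) in
  if odd n then U n./2.+1 t - U n./2 t else U n./2 t.

Lemma control_of_Jc N U i : control_of N U (- N%:Z - 1 + (i.*2)%:Z) = U i.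
Proof.
apply/funext => t; rewrite /control_of.
rewrite (_ : absz _ = i.*2); last by lia.
by rewrite odd_double doubleK.
Qed.

Lemma control_of_Jx N U i :
  control_of N U (- N%:Z + (i.*2)%:Z) = (fun t => U i.+1 t - U i t).
Proof.
apply/funext => t; rewrite /control_of.
rewrite (_ : absz _ = i.*2.+1); last by lia.
by rewrite /= odd_double /= uphalf_double.
Qed.

Lemma control_of_Js N U i : control_of N U (1 - N%:Z + (i.*2)%:Z) = U i.+1.
Proof. by rewrite -(control_of_Jc N U i.+1); congr (control_of N U _); lia. Qed.

Lemma Jc_mem N (k : int) : k \in Jc N ->
  exists2 i : nat, (i <= N.+1)%N & k = - N%:Z - 1 + (i.*2)%:Z.
Proof.
rewrite /Jc !inE => /or3P[/eqP ->|/eqP ->|/Js_mem[i iN ->]].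
- by exists 0%N => //; lia.
- by exists N.+1 => //; lia.
- by exists i.+1; [exact: ltnW|lia].
Qed.

Lemma Jx_mem N (n : int) : n \in Jx N ->
  exists2 i : nat, (i <= N)%N & n = - N%:Z + (i.*2)%:Z.
Proof. by case/mapP => i; rewrite mem_iota add0n => /andP[_ iN] ->; exists i. Qed.

Lemma AC_H1_interval (a b : R) (w : R -> R) : a < b -> AC w -> H1_interval a b w.
Proof. by move=> ab [g]; exact: acf_H1_interval. Qed.

Lemma control_of_is_control N (T : R) U : 0 < T -> (forall i, AC (U i)) ->
  (forall i, (i <= N.+1)%N -> U i 0 = 0) ->
  (forall t, \sum_(0 <= i < N.+2) U i t = 0) -> is_control N T (control_of N U).
Proof.
move=> T0 cU U0 Usum; split.
- move=> n /Jx_mem[i iN ->]; rewrite control_of_Jx; split.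
    by apply: AC_H1_interval => //; exact: AC_sub.
  by rewrite !U0 ?subrr//; exact: leqW.
- move=> k /Jc_mem[i iN ->]; rewrite control_of_Jc; split; last exact: U0.
  exact: AC_H1_interval.
- move=> n /Jx_mem[i iN ->] t _; rewrite control_of_Jx.
  rewrite (_ : _ + 1 = - N%:Z - 1 + (i.+1.*2)%:Z); last by lia.
  rewrite (_ : - N%:Z + (i.*2)%:Z - 1 = - N%:Z - 1 + (i.*2)%:Z); last by lia.
  by rewrite !control_of_Jc.
- by move=> t _; rewrite sum_Jc -[RHS](Usum t); apply: eq_bigr => i _; rewrite control_of_Jc.
Qed.

(* Here D i is the jump at node i of the waves inside the segments, the
   outermost ones being relative to the boundary data. *)
Lemma rod_controls (N : nat) (T c0 c1 kap : R) (D : nat -> R -> R) :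
  (0 < N)%N -> (forall i, AC (D i)) -> (forall i, (i <= N)%N -> D i 0 = 0) ->
  D 0 T = kap - c0 -> D N T = c1 - kap ->
  (forall i, (0 < i < N)%N -> D i T = 0) ->
  kap * N%:R + c0 + c1 = 0 ->
  exists U : nat -> R -> R, [/\ forall i, AC (U i),
    forall i t, U i.+1 t - U i t = D i t,
    forall t, \sum_(0 <= i < N.+2) U i t = 0,
    forall i, (i <= N.+1)%N -> U i 0 = 0 &
    forall i, (i < N)%N -> U i.+1 T = kap].
Proof.
move=> N0 cD D0 D0T DNT DT kapE.
have [U [cU dU sU]] := zero_sum_primitive N.+1 cD.
exists U; split => //.
  apply: (@zero_sum_unique R (fun i => U i 0) (fun=> 0)).
    by move=> i iN; rewrite dU subrr D0.
  by rewrite sU big1_eq.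
(* The expected terminal values: [c0] and [c1] on the outside, [kap] on the segments. Their
   increments are the given [D i T], and [kapE] says that their sum is zero. *)
pose c i := if i is j.+1 then (if (j < N)%N then kap else c1) else c0.
suff UT i : (i <= N.+1)%N -> U i T = c i by move=> i iN; rewrite UT /c ?iN//; exact: leqW.
move: i; apply: zero_sum_unique.
  move=> [|i]; rewrite ltnS dU /c; first by rewrite N0.
  rewrite leq_eqVlt => /orP[/eqP iN|iN].
    by rewrite iN eqxx ltnn.
  by rewrite iN orbT subrr DT.
rewrite sU big_nat_recl//= big_nat_recr//= ltnn.
rewrite (eq_big_nat _ _ (F2 := fun=> kap)) => [|i /andP[_ ->]//].
by rewrite sumr_const_nat subn0 -mulr_natr -kapE; ring.
Qed.

End controls.

Section rod_nodes.
Context {R : realType}.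
Variable N : nat.
Hypothesis N0 : (0 < N)%N.

Local Notation l := (lam R N).
Local Notation nd i := (-1 + i%:R * l).

Lemma node_rod (i : nat) : node R N (- N%:Z + (i.*2)%:Z) = nd i.
Proof.
rewrite nodeD (nodeN N0).1 -muln2 PoszM intrM.
by rewrite -[i%:~R]/(i%:R) -[2%:~R]/(2%:R); field.
Qed.

Lemma Ix_rod (i : nat) : I_x R N (1 - N%:Z + (i.*2)%:Z) = `]nd i, nd i.+1[%classic.
Proof.
rewrite /I_x (_ : _ - 1 = - N%:Z + (i.*2)%:Z); last by lia.
by rewrite (_ : _ + 1 = - N%:Z + (i.+1.*2)%:Z) ?node_rod//; lia.
Qed.

Lemma node_rod_mem (i : nat) : (i <= N)%N -> nd i \in `[-1, 1].
Proof.
move=> iN; rewrite in_itv /= lerDl mulr_ge0//=; last by rewrite ltW// lam_gt0.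
rewrite -[leRHS](rod_nodeN N0); exact: nd_le (lam_gt0 N0) _ _ iN.
Qed.

Lemma node_rod_itv (i : nat) x : (i < N)%N -> x \in `[nd i, nd i.+1] -> x \in `[-1, 1].
Proof.
move=> iN; have := node_rod_mem (ltnW iN); have := node_rod_mem iN.
rewrite !in_itv /= => /andP[_ h1] /andP[h2 _] /andP[h3 h4].
by rewrite (le_trans h2)// (le_trans h4).
Qed.

Lemma rod_cell x : x \in `]-1, 1[ -> exists2 i, (i < N)%N & x \in `[nd i, nd i.+1].
Proof.
have [n Nn] : exists n, N = n.+1 by exists N.-1; rewrite prednK.
rewrite in_itv /= => /andP[/ltW x0 /ltW x1].
have [||i iN xi] := @nd_cell R l (-1) n x; last by exists i; [rewrite Nn|].
- by rewrite rod_node0.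
- by rewrite -Nn rod_nodeN.
Qed.

Lemma mem_Js (i : nat) : (i < N)%N -> 1 - N%:Z + (i.*2)%:Z \in Js N.
Proof. by move=> iN; apply/mapP; exists i; rewrite // mem_iota. Qed.

Lemma force_control_of (gU : nat -> R -> R) (p : R * R) :
  force N (control_of N gU) p =
  \sum_(0 <= i < N) \1_(`]nd i, nd i.+1[%classic) p.2 * gU i.+1 p.1.
Proof.
rewrite /force big_map /index_iota subn0; apply: eq_bigr => i _.
by rewrite control_of_Js Ix_rod mulrC.
Qed.

End rod_nodes.

Section existence.
Context {R : realType}.

Lemma bvp_solvable (N : nat) (T : R) (v0 r0 v1 r1 : R -> R) :
  (0 < N)%N -> 2 * lam R N < T ->
  H1_interval (-1) 1 v0 -> H1_interval (-1) 1 r0 ->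
  H1_interval (-1) 1 v1 -> H1_interval (-1) 1 r1 ->
  exists (v r : R * R -> R) (u : int -> R -> R), bvp_solution N T v0 r0 v1 r1 v r u.
Proof.
move=> N0 lT hv0 hr0 hv1 hr1.
pose l := lam R N; pose nd (i : nat) := -1 + i%:R * l.
have l0 : 0 < l := lam_gt0 N0.
have T0 : 0 < T by apply: lt_trans lT; rewrite mulr_gt0.
have ab : -1 < 1 :> R by lra.
have AC_ext (u : R -> R) : H1_interval (-1) 1 u -> exists2 w, AC w & forall x, x \in `[-1, 1] -> w x = u x.
  by move=> /(H1_interval_acf ab)[w [g [wg wu]]]; exists w => //; exists g.
have [V0 cV0 V0E] := AC_ext _ hv0; have [P0 cP0 P0E] := AC_ext _ hr0.
have [V1 cV1 V1E] := AC_ext _ hv1; have [P1 cP1 P1E] := AC_ext _ hr1.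
have N0R : N%:R != 0 :> R by rewrite pnatr_eq0 -lt0n.
pose c0 := r1 (-1) - r0 (-1); pose c1 := r1 1 - r0 1.
pose kap := - (c0 + c1) / N%:R.
(* At time [T] every inner control equals [kap], so the waves alone must produce [r1 - kap]. *)
have cP1' : AC (fun x => P1 x - kap) by apply: AC_sub => //; exact: AC_cst.
have [A [B [cAB init term matchv]]] := wave_chain (-1) l0 lT cV0 cP0 cV1 cP1'.
have initE i x : (i < N)%N -> x \in `[nd i, nd i.+1] ->
    A i (x - nd i) + B i (nd i.+1 - x) = v0 x /\ A i (x - nd i) - B i (nd i.+1 - x) = r0 x.
  move=> iN xi; have xI := node_rod_itv N0 iN xi; have [-> ->] := init i x xi.
  by rewrite V0E// P0E//; split; field.
have termE i x : (i < N)%N -> x \in `[nd i, nd i.+1] ->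
    A i (T + x - nd i) + B i (T + nd i.+1 - x) = v1 x /\
    A i (T + x - nd i) - B i (T + nd i.+1 - x) = r1 x - kap.
  move=> iN xi; have xI := node_rod_itv N0 iN xi; have [-> ->] := term i x xi.
  by rewrite V1E// P1E//; split; field.
have ndS i : nd i.+1 = nd i + l := rod_nodeS N i.
have nd0 : nd 0 = -1 := rod_node0 N.
have ndN : nd N = 1 := rod_nodeN N0.
have ndl i : nd i \in `[nd i, nd i.+1] by rewrite in_itv /= lexx ndS lerDl ltW.
have ndr i : nd i.+1 \in `[nd i, nd i.+1] by rewrite in_itv /= lexx ndS lerDl ltW.
(* [pl i] and [pr i] are the values of the wave part of [r] at node [i], taken in the segment to its
   right and to its left. At the two outer nodes the missing side is replaced by the constant
   boundary datum, so that one jump formula covers interior and boundary controls. *)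
pose pl i t := if i == N then r0 1 else A i t - B i (t + l).
pose pr i t := if i is j.+1 then A j (t + l) - B j t else r0 (-1).
have pl0 i : (i <= N)%N -> pl i 0 = r0 (nd i).
  rewrite leq_eqVlt /pl; case: eqP => [->|_] /= iN; first by rewrite ndN.
  rewrite add0r -(initE i _ iN (ndl i)).2 subrr.
  by congr (_ - B i _); rewrite ndS; ring.
have pr0 i : (i <= N)%N -> pr i 0 = r0 (nd i).
  case: i => [_|i iN] /=; first by rewrite nd0.
  rewrite add0r -(initE i _ iN (ndr i)).2 subrr.
  by congr (A i _ - _); rewrite ndS; ring.
have plT i : (i < N)%N -> pl i T = r1 (nd i) - kap.
  move=> iN; rewrite /pl (ltn_eqF iN) -(termE i _ iN (ndl i)).2.
  by congr (A i _ - B i _); rewrite ?ndS; ring.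
have prT i : (i < N)%N -> pr i.+1 T = r1 (nd i.+1) - kap.
  move=> iN; rewrite /pr -(termE i _ iN (ndr i)).2.
  by congr (A i _ - B i _); rewrite ?ndS; ring.
have cpl i : AC (pl i).
  rewrite /pl; case: eqP => _; first exact: AC_cst.
  by apply: AC_sub; [exact: (cAB i).1|apply: AC_shift; exact: (cAB i).2].
have cpr i : AC (pr i).
  case: i => [|i]; first exact: AC_cst.
  by apply: AC_sub; [apply: AC_shift; exact: (cAB i).1|exact: (cAB i).2].
have [||||||U [cU dU sU U0 UT]] := @rod_controls R N T c0 c1 kap (fun i t => pr i t - pl i t) N0.
- by move=> i; exact: AC_sub.
- by move=> i iN; rewrite pr0// pl0// subrr.
- by rewrite plT// nd0 /c0 /=; ring.
- have [n Nn] : exists n, N = n.+1 by exists N.-1; rewrite prednK.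
  by rewrite {1}Nn prT -?Nn// ndN /pl eqxx /c1; ring.
- by move=> [//|i] /andP[_ iN]; rewrite (prT i (ltnW iN)) (plT _ iN) subrr.
- by rewrite /kap; field.
have matchr i t : (i.+1 < N)%N -> t \in `[0, T] ->
    A i (t + l) - B i t + U i.+1 t = A i.+1 t - B i.+1 (t + l) + U i.+2 t.
  move=> iN _; have := dU i.+1 t; rewrite /pl /pr (ltn_eqF iN) => /eqP.
  by rewrite subr_eq => /eqP ->; ring.
have /choice[gA gAP] : forall i, exists g, acf (A i) g by move=> i; case: (cAB i).
have /choice[gB gBP] : forall i, exists g, acf (B i) g by move=> i; case: (cAB i).
have /choice[gU gUP] : forall i, exists g, acf (U i) g by [].
have [v [r [vt [vx [rt [rx [[cv cr] wv wr eqs vals]]]]]]] :=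
  rod_waves N0 T0 gAP gBP gUP matchv matchr.
have {}vals i t x : (i < N)%N -> t \in `[0, T] -> x \in `[nd i, nd i.+1] ->
  v (t, x) = A i (t + x - nd i) + B i (t - x + nd i.+1) /\
  r (t, x) = A i (t + x - nd i) - B i (t - x + nd i.+1) + U i.+1 t := vals i t x.
have t0I : (0 : R) \in `[0, T] by rewrite in_itv /= lexx ltW.
have tTI : T \in `[0, T] by rewrite in_itv /= lexx ltW.
have val0 x : x \in `]-1, 1[ -> v (0, x) = v0 x /\ r (0, x) = r0 x.
  move=> /(rod_cell N0)[i iN xi]; have [-> ->] := vals i 0 x iN t0I xi.
  have [<- <-] := initE i x iN xi.
  by rewrite !add0r (addrC (- x)) U0 ?addr0//; exact: leqW.
have valT x : x \in `]-1, 1[ -> v (T, x) = v1 x /\ r (T, x) = r1 x.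
  move=> /(rod_cell N0)[i iN xi]; have [-> ->] := vals i T x iN tTI xi.
  rewrite UT// (addrAC T (- x)); have [<- ->] := termE i x iN xi.
  by rewrite subrK.
exists v, r, (control_of N U); split.
- by exists vt, vx.
- by exists rt, rx.
- exact: control_of_is_control.
- exists vt, vx, rt, rx, (control_of N gU); split => //.
    by move=> k /Js_mem[i iN ->]; rewrite !control_of_Js; exact: acf_weak_deriv.
  rewrite integral0_eq// => p _; rewrite /q_density force_control_of//.
  have [-> ->] := eqs p; rewrite !subrr expr0n /= mulr0 addr0//.
- exact: (continuous_has_trace cv wv (@continuous_pair_r R 0) (fun x xI => (val0 x xI).1)).
- exact: (continuous_has_trace cr wr (@continuous_pair_r R 0) (fun x xI => (val0 x xI).2)).
- exact: (continuous_has_trace cv wv (@continuous_pair_r R T) (fun x xI => (valT x xI).1)).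
- exact: (continuous_has_trace cr wr (@continuous_pair_r R T) (fun x xI => (valT x xI).2)).
- move=> n /Jx_mem[i iN ->] nN nN'.
  have [j ij] : exists j, i = j.+1 by exists i.-1; lia.
  have iN' : (i < N)%N by lia.
  have s1 : (- N%:Z + (i.*2)%:Z - 1) \in Js N.
    rewrite (_ : _ - 1 = 1 - N%:Z + (j.*2)%:Z); last by lia.
    by apply: mem_Js; lia.
  have s2 : (- N%:Z + (i.*2)%:Z + 1) \in Js N.
    rewrite (_ : _ + 1 = 1 - N%:Z + (i.*2)%:Z); last by lia.
    exact: mem_Js.
  have cl := @continuous_pair_l R (node R N (- N%:Z + (i.*2)%:Z)).
  have wsub k w wt wx : k \in Js N -> weak_grad (Omega T) w wt wx ->
      weak_grad (cell N T k) w wt wx.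
    by move=> kJ; apply: weak_grad_sub; [exact: measurable_cell|exact: cell_sub].
  (* The continuous fields have their own restriction to the node as trace from both sides. *)
  split; eexists; split.
  + exact: (continuous_has_trace cv (wsub _ _ _ _ s1 wv) cl (fun _ _ => erefl)).
  + exact: (continuous_has_trace cv (wsub _ _ _ _ s2 wv) cl (fun _ _ => erefl)).
  + exact: (continuous_has_trace cr (wsub _ _ _ _ s1 wr) cl (fun _ _ => erefl)).
  + exact: (continuous_has_trace cr (wsub _ _ _ _ s2 wr) cl (fun _ _ => erefl)).
- apply: (continuous_has_trace cr wr (@continuous_pair_l R (-1))) => t /subset_itv_oo_cc tT.
  rewrite (_ : - N%:Z - 1 = - N%:Z - 1 + (0.*2)%:Z) ?control_of_Jc; last by lia.
  rewrite -nd0 (vals 0 t (nd 0) N0 tT (ndl 0)).2 nd0.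
  have := dU 0 t; rewrite /pr /pl (ltn_eqF N0) => /eqP; rewrite subr_eq => /eqP ->.
  rewrite (_ : t + -1 - -1 = t) /=; last by ring.
  by rewrite (_ : t - -1 + nd 1 = t + l); [ring|rewrite ndS nd0; ring].
- apply: (continuous_has_trace cr wr (@continuous_pair_l R 1)) => t /subset_itv_oo_cc tT.
  rewrite (_ : N%:Z + 1 = - N%:Z - 1 + (N.+1.*2)%:Z) ?control_of_Jc; last by lia.
  have [n Nn] : exists n, N = n.+1 by exists N.-1; rewrite prednK.
  have nN : (n < N)%N by rewrite Nn.
  have := dU N t; rewrite {1}/pl eqxx => /eqP; rewrite subr_eq => /eqP ->.
  rewrite -{1}ndN Nn (vals n t (nd n.+1) nN tT (ndr n)).2 /=.
  rewrite (_ : t + nd n.+1 - nd n = t + l); last by rewrite ndS; ring.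
  by rewrite (_ : t - nd n.+1 + nd n.+1 = t); ring.
Qed.

End existence.

Theorem theorem1 (R : realType) (N M : nat) (T tau0 : R)
    (hN : (2 <= N)%N) (hM : (1 < M)%N) (htau0 : 0 < tau0 < lam R N)
    (hT : T = lam R N * M%:R + tau0)
    (v0 r0 v1 r1 : R -> R)
    (hv0 : H1_interval (-1) 1 v0) (hr0 : H1_interval (-1) 1 r0)
    (hv1 : H1_interval (-1) 1 v1) (hr1 : H1_interval (-1) 1 r1) :
  (exists (v r : R * R -> R) (u : int -> R -> R),
     bvp_solution N T v0 r0 v1 r1 v r u) /\
  (forall (v r : R * R -> R) (u : int -> R -> R),
     bvp_solution N T v0 r0 v1 r1 v r u ->
     forall k : int, k \in Js N ->
     exists wp wm : R -> R,
       [/\ {within I_plus N T k, continuous wp},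
           {within I_minus N T k, continuous wm},
           dalembert N T k v r (u k) wp wm &
           dalembert_pieces N M T tau0 k v r u wp wm]).
Proof.
have N0 : (0 < N)%N := ltnW hN.
have [tau_gt0 _] := andP htau0.
(* [M] is at least 2 and [tau0 > 0] makes the inequality strict; this is the room needed by the
   interpolation in [wave_fill]. *)
have lT : 2 * lam R N < T.
  have h : lam R N * 2 <= lam R N * M%:R.
    by rewrite ler_wpM2l ?ler_nat// ltW// lam_gt0.
  by rewrite hT mulrC (le_lt_trans h)// ltrDl.
have T0 : 0 < T by apply: lt_trans lT; rewrite mulr_gt0// lam_gt0.
split; first exact: bvp_solvable.
move=> v r u sol k kJ; have cu := sol_control sol.
have [wp [wm [cp cm dal]]] := solution_dalembert N0 T0 cu (sol_Q sol) kJ.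
by exists wp, wm; split => //; exact: dalembert_piecesP dal.
Qed.
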